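(* Let $d\ge 2$ be an integer and let $m>0$ be real. Let $c_0=c(2,2,\infty,d)<\infty$ be a constant depending only on $d$ such that $\omega_{2,m,2}[f](h)\le c_0\,\omega_{2,m,\infty}[f](h)$ for all $f\in L^2(\mathbb{R}^d)$ and $h>0$ (such a constant exists by the Hölder inequality). There exist $c_1,c_2>0$ depending on $d$ and $m$ only such that for all $f\in L^2(\mathbb{R}^d)$ and all $t>0$ $$c_1\,\omega_{2,m,\infty}[f](1/t)\le\psi_{2,m}[\hat f](t)\le c_2\,\omega_{2,m,2}[f](1/t)\le c_2c_0\,\omega_{2,m,\infty}[f](1/t).$$
   Context: Fourier transform: $\hat f(\xi)=\int_{\mathbb{R}^d}e^{-i\xi\cdot x}f(x)\,dx$, extended in the standard way to $L^2(\mathbb{R}^d)$. $\|\cdot\|_{2,\mathbb{R}^d}$ is the $L^2(\mathbb{R}^d)$ norm. Differences: for $m\in\mathbb{N}$ and $x,y\in\mathbb{R}^d$, $\Delta_y^m f(x)=\sum_{k=0}^m(-1)^{m-k}\binom{m}{k}f(x+ky)$; its Fourier transform in $x$ is $(2i\sin(y\cdot\xi/2))^m e^{imy\cdot\xi/2}\hat f(\xi)$. For real $m>0$, $m\notin\mathbb{N}$, $\Delta_y^m f$ is defined as the inverse Fourier transform (in the variable $\xi$) of $(2i\sin(y\cdot\xi/2))^m e^{imy\cdot\xi/2}\hat f(\xi)$, where the power $(2i\sin(y\cdot\xi/2))^m$ is taken with the principal branch. Moduli of continuity: $\mathbb{S}^{d-1}$ is the unit sphere in $\mathbb{R}^d$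 with its standard surface measure $dS$. For $h>0$, $$\omega_{2,m,2}[f](h)=\Big(\int_{\mathbb{S}^{d-1}}\|\Delta_{hy}^m f\|_{2,\mathbb{R}^d}^2\,dS_y\Big)^{1/2},\qquad \omega_{2,m,\infty}[f](h)=\sup_{|y|\le h}\|\Delta_y^m f\|_{2,\mathbb{R}^d}.$$ Modified tail of the Fourier transform: for $t>0$, $$\psi_{2,m}[\hat f](t)=\Big(\int_{\mathbb{R}^d}\min\big(1,(|\xi|/t)^{2m}\big)|\hat f(\xi)|^2\,d\xi\Big)^{1/2}.$$ *)

(* Defs.v *)
From HB Require Import structures.
From mathcomp Require Import all_boot all_order all_algebra.
From mathcomp Require Import all_classical all_reals all_analysis.
From mathcomp Require Import measurable_realfun complex.

Set Implicit Arguments.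
Unset Strict Implicit.
Unset Printing Implicit Defensive.

Import Order.TTheory GRing.Theory Num.Theory.
Import numFieldNormedType.Exports.

Local Open Scope classical_set_scope.
Local Open Scope ring_scope.
Local Open Scope complex_scope.

Definition rV_display : measure_display. Proof. exact. Qed.

(* The sigma-algebra generated by the coordinate functions, i.e., the Borel
   sets of R^n. *)
Section measurable_rV.
Context {R : realType} (n : nat).

Let coord (i : 'I_n) (v : 'rV[R]_n) : measurableTypeR R := v ord0 i.

Let rV_set0 : g_sigma_preimage coord set0.
Proof. exact: sigma_algebra0. Qed.

Let rV_setC A : g_sigma_preimage coord A -> g_sigma_preimage coord (~` A).
Proof. exact: sigma_algebraC. Qed.

Let rV_bigcup (F : (set 'rV[R]_n)^nat) :
  (forall i, g_sigma_preimage coord (F i)) ->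
  g_sigma_preimage coord (\bigcup_i F i).
Proof. exact: sigma_algebra_bigcup. Qed.

HB.instance Definition _ := @isMeasurable.Build rV_display
  'rV[R]_n (g_sigma_preimage coord) rV_set0 rV_setC rV_bigcup.

Lemma measurable_coord (i : 'I_n) :
  measurable_fun [set: 'rV[R]_n] (fun v => v ord0 i : measurableTypeR R).
Proof.
move=> _ Y mY; rewrite setTI; apply: sub_sigma_algebra => /=.
rewrite -bigcup_seq/=; exists i => /=; first by rewrite mem_index_enum.
by exists Y => //; rewrite setTI.
Qed.

Lemma measurable_fun_rVP d (T : measurableType d) (f : T -> 'rV[R]_n) :
  (forall i, measurable_fun [set: T] (fun t => f t ord0 i : measurableTypeR R))
  -> measurable_fun [set: T] f.
Proof.
move=> mf.
suff : g_sigma_preimage (fun i => coord i \o f) `<=` measurable.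
  rewrite g_sigma_preimage_comp => H _ Y mY.
  by apply: H; exists Y.
apply: smallest_sub; first exact: sigma_algebra_measurable.
rewrite -bigcup_seq => A [i _ [B mB <-]].
exact: mf.
Qed.

End measurable_rV.

Section lebesgue_measure_rV.
Context {R : realType}.

Definition cons_rV n (p : measurableTypeR R * 'rV[R]_n) : 'rV[R]_n.+1 :=
  row_mx (const_mx p.1 : 'rV_1) p.2.

Lemma measurable_cons_rV n : measurable_fun [set: _] (@cons_rV n).
Proof.
apply: measurable_fun_rVP => i; rewrite /cons_rV.
pose j : 'I_(1 + n) := i.
rewrite (_ : (fun t => _) = fun t : measurableTypeR R * 'rV[R]_n =>
  row_mx (const_mx t.1 : 'rV_1) t.2 ord0 j)//.
have [k jk|k jk] := splitP j.
  rewrite (_ : (fun t => _) = fst) //.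
  apply/funext => t; rewrite (_ : j = lshift n k) ?row_mxEl ?mxE//.
  exact/val_inj.
rewrite (_ : (fun t => _) = (fun v : 'rV[R]_n => v ord0 k) \o snd).
  apply: measurableT_comp => //; exact: measurable_coord.
apply/funext => t /=; rewrite (_ : j = rshift 1 k) ?row_mxEr//.
exact/val_inj.
Qed.

Section lebesgue_cons.
Variables (n : nat) (mu : {sigma_finite_measure set 'rV[R]_n -> \bar R}).

Definition lebesgue_cons : set 'rV[R]_n.+1 -> \bar R :=
  pushforward (@lebesgue_measure R \x mu)%E (@cons_rV n).

HB.instance Definition _ := Measure.copy lebesgue_cons
  (measure_function_pushforward__canonical__measure_function_Measure
     (@lebesgue_measure R \x mu)%E (@measurable_cons_rV n)).

Let lebesgue_prod_sigma_finite :
  sigma_finite setT (@lebesgue_measure R \x mu)%E.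
Proof.
have /sigma_finiteP[F [TF ndF Foo]] := sigma_finiteT (@lebesgue_measure R).
have /sigma_finiteP[G [TG ndG Goo]] := sigma_finiteT mu.
exists (fun k => F k `*` G k).
  apply/seteqP; split => // -[x y] _.
  have [i _ Fx] : (\bigcup_i F i) x by rewrite -TF.
  have [j _ Gy] : (\bigcup_i G i) y by rewrite -TG.
  exists (maxn i j) => //; split.
    by move: x Fx; exact/subsetPset/ndF/leq_maxl.
  by move: y Gy; exact/subsetPset/ndG/leq_maxr.
move=> k; have [? ?] := Foo k; have [? ?] := Goo k.
split; first exact: measurableX.
by rewrite product_measure1E// lte_mul_pinfty// ge0_fin_numE.
Qed.

Let lebesgue_cons_sigma_finite : sigma_finite setT lebesgue_cons.
Proof.
have [F FT Ffin] := lebesgue_prod_sigma_finite.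
pose uncons (v : 'rV[R]_n.+1) : measurableTypeR R * 'rV[R]_n :=
  (v ord0 ord0, rsubmx (v : 'rV_(1 + n))).
have consK : cancel (@cons_rV n) uncons.
  move=> [a v]; rewrite /uncons /cons_rV row_mxKr /=; congr pair.
  by rewrite mxE; case: splitP => // j _; rewrite mxE.
have muncons : measurable_fun setT uncons.
  apply: measurable_fun_pair; first exact: measurable_coord.
  apply: measurable_fun_rVP => i.
  rewrite (_ : (fun t => _) = fun t : 'rV[R]_n.+1 => t ord0 (rshift 1 i)).
    exact: measurable_coord.
  by apply/funext => v; rewrite /= mxE.
exists (fun k => uncons @^-1` F k).
  by rewrite -preimage_bigcup -FT preimage_setT.
move=> k; have [mF Foo] := Ffin k; split.
  by rewrite -[X in measurable X]setTI; exact: muncons.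
rewrite /lebesgue_cons /pushforward -comp_preimage.
by rewrite (_ : uncons \o _ = id) ?preimage_id//; apply/funext => p; exact: consK.
Qed.

HB.instance Definition _ := Measure_isSigmaFinite.Build _ _ _ lebesgue_cons
  lebesgue_cons_sigma_finite.

End lebesgue_cons.

Fixpoint lebesgue_rV n : {sigma_finite_measure set 'rV[R]_n -> \bar R} :=
  match n return {sigma_finite_measure set 'rV[R]_n -> \bar R} with
  | 0%N => \d_(0 : 'rV[R]_0)
  | n'.+1 => lebesgue_cons (lebesgue_rV n')
  end.

End lebesgue_measure_rV.

Definition dotv {R : realType} n (x y : 'rV[R]_n) : R :=
  \sum_(i < n) x ord0 i * y ord0 i.

(* Pitfall: the library's norm `|x| on 'rV[R]_n is the sup norm. *)
Definition enorm {R : realType} n (x : 'rV[R]_n) : R := Num.sqrt (dotv x x).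

Definition sphere {R : realType} n : set 'rV[R]_n := [set y | enorm y = 1].

Section sphere_measure.
Context {R : realType} (n : nat).

Definition normalize (x : 'rV[R]_n) : 'rV[R]_n := (enorm x)^-1 *: x.

Definition punctured_ball : set 'rV[R]_n := [set x | 0 < enorm x <= 1].

Let measurable_enorm : measurable_fun setT (@enorm R n : _ -> measurableTypeR R).
Proof.
apply: (@measurableT_comp _ _ _ _ _ _ (@Num.sqrt R : R -> R)).
  by apply: continuous_measurable_fun; exact: sqrt_continuous.
apply: measurable_sum => i; apply: measurable_funM; exact: measurable_coord.
Qed.

Lemma measurable_normalize : measurable_fun setT normalize.
Proof.
apply: measurable_fun_rVP => i.
rewrite (_ : (fun t => _) = (fun v => enorm v `^ (-1)) \*
    (fun v : 'rV[R]_n => v ord0 i)).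
  apply: measurable_funM; last exact: measurable_coord.
  apply: (@measurableT_comp _ _ _ _ _ _ ((@powR R) ^~ (-1))).
    exact: measurable_powR.
  exact: measurable_enorm.
by apply/funext => v; rewrite /= /normalize mxE powR_inv1// sqrtr_ge0.
Qed.

Lemma measurable_punctured_ball : measurable punctured_ball.
Proof.
have -> : punctured_ball =
    (@enorm R n : _ -> measurableTypeR R) @^-1` `]0, 1].
  by apply/seteqP; split=> x /=; rewrite in_itv.
by rewrite -[X in measurable X]setTI; apply: measurable_enorm.
Qed.

(* The surface measure of the unit sphere S of R^n, seen as a measure on R^n
   concentrated on S: for A included in S, the surface of A is n times the
   volume of the cone {r y | y in A, 0 < r <= 1}. *)
Definition sphere_measure : set 'rV[R]_n -> \bar R :=
  fun A => (n%:R%:E * lebesgue_rV n (normalize @^-1` A `&` punctured_ball))%E.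

Let sphere_measure0 : sphere_measure set0 = 0%E.
Proof. by rewrite /sphere_measure preimage_set0 set0I measure0 mule0. Qed.

Let sphere_measure_ge0 A : (0 <= sphere_measure A)%E.
Proof. by rewrite /sphere_measure mule_ge0. Qed.

Let sphere_measure_sigma_additive : semi_sigma_additive sphere_measure.
Proof.
pose nu := measure_function_pushforward__canonical__measure_function_Measure
  (mrestr (lebesgue_rV n) measurable_punctured_ball) measurable_normalize.
exact: (@measure_semi_sigma_additive _ _ _ (mscale n%:R%:nng nu)).
Qed.

HB.instance Definition _ := isMeasure.Build _ _ _ sphere_measure
  sphere_measure0 sphere_measure_ge0 sphere_measure_sigma_additive.

End sphere_measure.
Arguments sphere_measure {R} n.

Definition expi {R : realType} (t : R) : R[i] := cos t +i* sin t.

(* The principal argument, in ]-pi, pi] for z != 0. *)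
Definition carg {R : realType} (z : R[i]) : R :=
  if 0 <= complex.Im z then acos (complex.Re z / Normc.normc z)
  else - acos (complex.Re z / Normc.normc z).

(* The principal branch of z^a, for a > 0 (so that 0^a = 0). *)
Definition cpow {R : realType} (z : R[i]) (a : R) : R[i] :=
  if z == 0 then 0 else (Normc.normc z `^ a)%:C * expi (a * carg z).

Section complex_functions.
Context {R : realType} (d : nat).
Local Notation mu := (lebesgue_rV d : {measure set 'rV[R]_d -> \bar R}).
Implicit Types f g u : 'rV[R]_d -> R[i].

Definition cmeasurable f :=
  measurable_fun setT (fun x => complex.Re (f x) : measurableTypeR R) /\
  measurable_fun setT (fun x => complex.Im (f x) : measurableTypeR R).

Definition cintegral f : R[i] :=
  (\int[mu]_x complex.Re (f x)) +i* (\int[mu]_x complex.Im (f x)).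

Definition in_L1 f :=
  cmeasurable f /\ (Lnorm mu 1 (fun x => (Normc.normc (f x))%:E) < +oo)%E.

Definition L2norm f : \bar R := Lnorm mu 2%:E (fun x => (Normc.normc (f x))%:E).

Definition in_L2 f := cmeasurable f /\ (L2norm f < +oo)%E.

Definition fourierL1 f (xi : 'rV[R]_d) : R[i] :=
  cintegral (fun x => expi (- dotv xi x) * f x).

(* g is the Fourier transform of f in the sense of the extension by continuity
   to L^2 of fourierL1 on the dense subspace L^1 `&` L^2. *)
Definition is_fourier f g :=
  [/\ in_L2 f, in_L2 g &
    exists F : nat -> 'rV[R]_d -> R[i],
    [/\ forall n, in_L1 (F n) /\ in_L2 (F n),
        L2norm (F n \- f) @[n --> \oo] --> 0%E &
        L2norm (fourierL1 (F n) \- g) @[n --> \oo] --> 0%E]].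

(* [fourier f] and [inv_fourier g] choose a representative of an element of L^2,
   i.e., a function determined up to a null set. *)
Definition fourier f : 'rV[R]_d -> R[i] :=
  xget (cst 0) [set g | is_fourier f g].

Definition inv_fourier g : 'rV[R]_d -> R[i] :=
  xget (cst 0) [set u | is_fourier u g].

Definition diff_nat (m : nat) (y : 'rV[R]_d) f (x : 'rV[R]_d) : R[i] :=
  \sum_(k < m.+1) (-1) ^+ (m - k) * 'C(m, k)%:R * f (x + k%:R *: y).

Definition diff_symbol (m : R) (y xi : 'rV[R]_d) : R[i] :=
  cpow (0 +i* (2 * sin (dotv y xi / 2))) m * expi (m * dotv y xi / 2).

Definition diff (m : R) (y : 'rV[R]_d) f : 'rV[R]_d -> R[i] :=
  if m \is a Num.nat then diff_nat (Num.truncn m) y f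
  else inv_fourier (fun xi => diff_symbol m y xi * fourier f xi).

Definition omega2 (m : R) f (h : R) : \bar R :=
  ((\int[sphere_measure d]_(y in @sphere R d)
      (L2norm (diff m (h *: y) f) `^ 2)) `^ 2^-1)%E.

Definition omegaoo (m : R) f (h : R) : \bar R :=
  ereal_sup [set L2norm (diff m y f) | y in [set y | enorm y <= h]].

Definition psi (m : R) g (t : R) : \bar R :=
  ((\int[mu]_xi (Num.min 1 ((enorm xi / t) `^ (2 * m))
                 * Normc.normc (g xi) ^+ 2)%:E) `^ 2^-1)%E.

End complex_functions.

(* Main.v *)
Require Import Defs.
From mathcomp Require Import all_boot all_order all_algebra.
From mathcomp Require Import all_classical all_reals all_analysis.
From mathcomp Require Import measurable_realfun complex ring lra.

(** Everything takes place on the Fourier side. By the Plancherel theorem, for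
    integral as well as for other exponents m,

      |Delta_y^m f|^2 = (2 pi)^-d int |2 sin (y.xi / 2)|^(2m) |f^(xi)|^2 dxi

    ([diff_energy]), where |.| on the left is the L2 norm. The theorem then
    amounts to comparing three weights at each frequency xi: the multiplier
    |2 sin (y.xi / 2)|^(2m), its average over the y of norm h = 1 / t, and the
    weight min (1, (h |xi|)^(2m)) of the tail.

    - The supremum dominates the spherical average because the sphere has a
      finite surface ([omega2_le_omegaoo]).
    - For |y| <= h the multiplier is at most 4^m min (1, (h |xi|)^(2m)), as
      |sin u| <= min (1, |u|); hence the first inequality
      ([omegaoo_le_psi]).
    - In dimension at least 2 the average of the multiplier over the sphere of
      radius h is at least c min (1, (h |xi|)^(2m)) ([sphere_multiplier_ge]);
      with the Tonelli theorem this yields the second inequality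
      ([psi_le_omega2]). The third one is the hypothesis on c0.

    For the lower bound on the average, the sphere integral is an integral over
    the ball of a function of x / |x|. With e = xi / |xi| and r = h |xi|, the
    claim is first proved for sin^2 (r u / 2), where u is the component of
    x / |x| along e. The integral over the ball is bounded below by an average
    over short segments directed by e, starting near half a basis vector that
    makes an angle of at least pi / 4 with e. On such a segment u moves with a
    speed between two positive constants, and the integral of sin^2 (r u / 2)
    over the segment is computed up to constants from a primitive; it is at
    least c min (1, r^2), both for small and for large r. The exponent 2 is
    replaced by 2m by discarding the points where sin^2 is small.

    The Plancherel theorem on integrable functions of finite energy is obtained
    by damping: multiplying the transform by exp (- e (|xi_1| + ... + |xi_d|))
    before inverting it amounts to convolving f with a product of Cauchy
    densities, which tends to f in square mean as e tends to 0, because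
    translations are continuous in L2. The extension to L2, that is, the
    existence of a transform and of an inverse transform of every function of
    L2, follows from the completeness of L2. A transform in the sense of
    [is_fourier] is a limit along some approximating sequence; the equality of
    norms holds for each such limit, so that the choices made by [fourier] and
    [inv_fourier] have no influence on the norms. *)

Set Implicit Arguments.
Unset Strict Implicit.
Unset Printing Implicit Defensive.
Import Order.TTheory GRing.Theory Num.Theory.
Import numFieldNormedType.Exports.
Local Open Scope classical_set_scope.
Local Open Scope ring_scope.
Local Open Scope complex_scope.

Local Notation normc := Normc.normc.
Local Notation Re := complex.Re.
Local Notation Im := complex.Im.

(** * Modulus and unimodular exponential of complex numbers *)

Section complex_modulus.
Context {R : realType}.
Implicit Types z w : R[i].

Lemma cReD z w : Re (z + w) = Re z + Re w. Proof. by case: z; case: w. Qed.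
Lemma cImD z w : Im (z + w) = Im z + Im w. Proof. by case: z; case: w. Qed.
Lemma cReN z : Re (- z) = - Re z. Proof. by case: z. Qed.
Lemma cImN z : Im (- z) = - Im z. Proof. by case: z. Qed.
Lemma cReB z w : Re (z - w) = Re z - Re w. Proof. by rewrite cReD cReN. Qed.
Lemma cImB z w : Im (z - w) = Im z - Im w. Proof. by rewrite cImD cImN. Qed.
Lemma cReM z w : Re (z * w) = Re z * Re w - Im z * Im w.
Proof. by case: z; case: w. Qed.
Lemma cImM z w : Im (z * w) = Re z * Im w + Im z * Re w.
Proof. by case: z => a b; case: w => c e. Qed.
Lemma complex_ext z w : Re z = Re w -> Im z = Im w -> z = w.
Proof. by case: z => a b; case: w => c e /= -> ->. Qed.

Lemma normc_sqr z : normc z ^+ 2 = Re z ^+ 2 + Im z ^+ 2.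
Proof. by case: z => a b /=; rewrite sqr_sqrtr// addr_ge0// sqr_ge0. Qed.

Lemma normc_ge0 z : 0 <= normc z.
Proof. by case: z => a b; exact: sqrtr_ge0. Qed.

Lemma ler_normcD z w : normc (z + w) <= normc z + normc w.
Proof. exact: le_normcD. Qed.

Lemma normcJ_eq z : normc (conjc z) = normc z.
Proof. by case: z => a b /=; rewrite sqrrN. Qed.

Lemma normcNE z : normc (- z) = normc z.
Proof. exact: normcN. Qed.

Lemma normcBC z w : normc (z - w) = normc (w - z).
Proof. by rewrite -normcNE opprB. Qed.

Lemma normc_real (x : R) : normc x%:C = `|x|.
Proof. by rewrite /= expr0n/= addr0 sqrtr_sqr. Qed.

Lemma Re_le_normc z : `|Re z| <= normc z.
Proof.
rewrite -(@ler_pXn2r _ 2)// ?nnegrE ?normc_ge0//.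
by rewrite real_normK ?num_real// normc_sqr lerDl sqr_ge0.
Qed.

Lemma Im_le_normc z : `|Im z| <= normc z.
Proof.
rewrite -(@ler_pXn2r _ 2)// ?nnegrE ?normc_ge0//.
by rewrite real_normK ?num_real// normc_sqr lerDr sqr_ge0.
Qed.

Lemma mulJc_normc z : conjc z * z = (normc z ^+ 2)%:C.
Proof.
apply: complex_ext.
  by rewrite cReM [RHS]normc_sqr; case: z => a b /=; rewrite mulNr opprK -!expr2.
by rewrite cImM; case: z => a b /=; rewrite mulNr mulrC subrr.
Qed.

Lemma conjcM z w : conjc (z * w) = conjc z * conjc w.
Proof. exact: rmorphM. Qed.

Lemma conjc_real (x : R) : conjc x%:C = x%:C.
Proof. by rewrite /= oppr0. Qed.

(** Plays the part of the triangle inequality for integrals of squares. *)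
Lemma sqr_normcD_le z w :
  normc (z + w) ^+ 2 <= 2 * normc z ^+ 2 + 2 * normc w ^+ 2.
Proof.
rewrite !normc_sqr cReD cImD; move: (Re z) (Re w) (Im z) (Im w) => a b c e.
have := sqr_ge0 (a - b); have := sqr_ge0 (c - e); lra.
Qed.

Lemma normc_expi (t : R) : normc (expi t) = 1.
Proof. by rewrite /expi /= cos2Dsin2 sqrtr1. Qed.

Lemma expiD (s t : R) : expi (s + t) = expi s * expi t.
Proof.
apply: complex_ext; first by rewrite cReM /= cosD.
by rewrite cImM /= sinD addrC; congr (_ + _); rewrite mulrC.
Qed.

Lemma expi0 : expi (0 : R) = 1.
Proof. by rewrite /expi cos0 sin0. Qed.

Lemma expiN (t : R) : expi (- t) = conjc (expi t).
Proof. by rewrite /expi cosN sinN. Qed.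

End complex_modulus.

(** * Integration of complex-valued functions *)

Section complex_integral.
Context d (T : measurableType d) (R : realType).
Implicit Types (f g : T -> R[i]) (h : T -> R).

Definition cmeas f :=
  measurable_fun setT (fun x => Re (f x) : measurableTypeR R) /\
  measurable_fun setT (fun x => Im (f x) : measurableTypeR R).

Lemma cmeasD f g : cmeas f -> cmeas g -> cmeas (fun x => f x + g x).
Proof.
move=> [f1 f2] [g1 g2]; split.
  under eq_fun do rewrite cReD; exact: measurable_funD.
by under eq_fun do rewrite cImD; exact: measurable_funD.
Qed.

Lemma cmeasN f : cmeas f -> cmeas (fun x => - f x).
Proof.
move=> [f1 f2]; split.
  under eq_fun do rewrite cReN; exact: measurableT_comp.
by under eq_fun do rewrite cImN; exact: measurableT_comp.
Qed.

Lemma cmeasB f g : cmeas f -> cmeas g -> cmeas (fun x => f x - g x).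
Proof. by move=> mf mg; apply: cmeasD => //; exact: cmeasN. Qed.

Lemma cmeasM f g : cmeas f -> cmeas g -> cmeas (fun x => f x * g x).
Proof.
move=> [f1 f2] [g1 g2]; split.
  under eq_fun do rewrite cReM.
  by apply: measurable_funB; exact: measurable_funM.
under eq_fun do rewrite cImM.
by apply: measurable_funD; exact: measurable_funM.
Qed.

Lemma cmeas_cst (c : R[i]) : cmeas (fun=> c).
Proof. by split; exact: measurable_cst. Qed.

Lemma cmeas_real h : measurable_fun setT h -> cmeas (fun x => (h x)%:C).
Proof. by move=> mh; split => //; exact: measurable_cst. Qed.

Lemma cmeas_conj f : cmeas f -> cmeas (fun x => conjc (f x)).
Proof.
move=> [f1 f2]; split.
  by rewrite (_ : (fun _ => _) = fun x => Re (f x))//; apply/funext => x; case: (f x).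
rewrite (_ : (fun _ => _) = fun x => - Im (f x)); first exact: measurableT_comp.
by apply/funext => x; case: (f x).
Qed.

Lemma cmeas_expi h : measurable_fun setT h -> cmeas (fun x => expi (h x)).
Proof.
move=> mh; split => /=; apply: measurableT_comp => //.
  by apply: continuous_measurable_fun; exact: continuous_cos.
by apply: continuous_measurable_fun; exact: continuous_sin.
Qed.

Lemma measurable_normc f : cmeas f -> measurable_fun setT (fun x => normc (f x)).
Proof.
move=> [f1 f2].
rewrite (_ : (fun _ => _) = fun x => Num.sqrt (Re (f x) ^+ 2 + Im (f x) ^+ 2)).
  apply: (@measurableT_comp _ _ _ _ _ _ (@Num.sqrt R : R -> R)).
    by apply: continuous_measurable_fun; exact: sqrt_continuous.
  by apply: measurable_funD; exact: measurable_funX.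
by apply/funext => x; case: (f x).
Qed.

Variable mu : {measure set T -> \bar R}.

Definition cint f : R[i] := (\int[mu]_x Re (f x)) +i* (\int[mu]_x Im (f x)).

Definition cintegrable f :=
  cmeas f /\ (\int[mu]_x (normc (f x))%:E < +oo)%E.

Lemma cintegrable_normc f : cintegrable f ->
  mu.-integrable setT (EFin \o (fun x => normc (f x))).
Proof.
move=> [mf foo]; apply/integrableP; split.
  by apply/measurable_EFinP; exact: measurable_normc.
under eq_integral do rewrite /= (ger0_norm (normc_ge0 _)).
exact: foo.
Qed.

Lemma cintegrable_Re f : cintegrable f ->
  mu.-integrable setT (EFin \o (fun x => Re (f x))).
Proof.
move=> fi; apply: (le_integrable _ _ _ (cintegrable_normc fi)) => //.
  by apply/measurable_EFinP; case: fi => -[].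
by move=> x _ /=; rewrite lee_fin (ger0_norm (normc_ge0 _)) Re_le_normc.
Qed.

Lemma cintegrable_Im f : cintegrable f ->
  mu.-integrable setT (EFin \o (fun x => Im (f x))).
Proof.
move=> fi; apply: (le_integrable _ _ _ (cintegrable_normc fi)) => //.
  by apply/measurable_EFinP; case: fi => -[].
by move=> x _ /=; rewrite lee_fin (ger0_norm (normc_ge0 _)) Im_le_normc.
Qed.

Lemma le_cintegrable f h : cmeas f -> mu.-integrable setT (EFin \o h) ->
  (forall x, normc (f x) <= h x) -> cintegrable f.
Proof.
move=> mf hi fh; split => //; move/integrableP: (hi) => [mh].
apply: le_lt_trans; apply: ge0_le_integral => //.
- by move=> x _; rewrite lee_fin normc_ge0.
- by apply/measurable_EFinP; exact: measurable_normc.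
- exact: measurableT_comp.
- by move=> x _ /=; rewrite lee_fin (le_trans (fh x))// ler_norm.
Qed.

Lemma le_cintegrable_normc f g : cmeas f -> cintegrable g ->
  (forall x, normc (f x) <= normc (g x)) -> cintegrable f.
Proof. by move=> mf /cintegrable_normc; exact: le_cintegrable. Qed.

Lemma cintegrableD f g : cintegrable f -> cintegrable g ->
  cintegrable (fun x => f x + g x).
Proof.
move=> fi gi; have [[mf _] [mg _]] := (fi, gi).
apply: (@le_cintegrable _ (fun x => normc (f x) + normc (g x))).
- exact: cmeasD.
- exact: (integrableD _ (cintegrable_normc fi) (cintegrable_normc gi)).
- by move=> x; exact: ler_normcD.
Qed.

Lemma cintegrableZl c f : cintegrable f -> cintegrable (fun x => c * f x).
Proof.
move=> fi; have [mf _] := fi.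
apply: (@le_cintegrable _ (fun x => normc c * normc (f x))).
- by apply: cmeasM => //; exact: cmeas_cst.
- exact: (integrableZl measurableT (normc c) (cintegrable_normc fi)).
- by move=> x; rewrite Normc.normcM.
Qed.

Lemma cintegrableN f : cintegrable f -> cintegrable (fun x => - f x).
Proof.
by move=> fi; apply: (le_cintegrable_normc _ fi) => [|x];
  [apply: cmeasN; case: fi|rewrite normcNE].
Qed.

Lemma cintegrableB f g : cintegrable f -> cintegrable g ->
  cintegrable (fun x => f x - g x).
Proof. by move=> fi gi; apply: cintegrableD => //; exact: cintegrableN. Qed.

Lemma cintegrable_conj f : cintegrable f -> cintegrable (fun x => conjc (f x)).
Proof.
by move=> fi; apply: (le_cintegrable_normc _ fi) => [|x];
  [apply: cmeas_conj; case: fi|rewrite normcJ_eq].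
Qed.

Lemma cintegrable_real h : mu.-integrable setT (EFin \o h) ->
  cintegrable (fun x => (h x)%:C).
Proof.
move=> hi; apply: (@le_cintegrable _ (fun x => `|h x|)).
- apply: cmeas_real; apply/measurable_EFinP; exact: (measurable_int mu).
- exact: (integrable_norm hi).
- by move=> x; rewrite normc_real.
Qed.

Lemma cintegrableM_bounded f k : cmeas k -> cintegrable f ->
  (forall x, normc (k x) <= 1) -> cintegrable (fun x => f x * k x).
Proof.
move=> mk fi k1; apply: (le_cintegrable_normc _ fi).
  by apply: cmeasM => //; case: fi.
by move=> x; rewrite Normc.normcM ler_piMr// normc_ge0.
Qed.

Lemma eq_cint f g : f =1 g -> cint f = cint g.
Proof. by move=> /funext ->. Qed.

Lemma cintD f g : cintegrable f -> cintegrable g ->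
  cint (fun x => f x + g x) = cint f + cint g.
Proof.
move=> fi gi; rewrite /cint; apply: complex_ext; rewrite ?cReD ?cImD /=.
  under eq_Rintegral do rewrite cReD.
  by rewrite RintegralD//; exact: cintegrable_Re.
under eq_Rintegral do rewrite cImD.
by rewrite RintegralD//; exact: cintegrable_Im.
Qed.

Lemma cintZl c f : cintegrable f -> cint (fun x => c * f x) = c * cint f.
Proof.
move=> fi; have [re im] := (cintegrable_Re fi, cintegrable_Im fi).
apply: complex_ext; rewrite ?cReM ?cImM /=.
  under eq_Rintegral do rewrite cReM.
  rewrite RintegralB// ?RintegralZl//.
    exact: (integrableZl measurableT (Re c) re).
  exact: (integrableZl measurableT (Im c) im).
under eq_Rintegral do rewrite cImM.
rewrite RintegralD// ?RintegralZl//.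
  exact: (integrableZl measurableT (Re c) im).
exact: (integrableZl measurableT (Im c) re).
Qed.

Lemma cintB f g : cintegrable f -> cintegrable g ->
  cint (fun x => f x - g x) = cint f - cint g.
Proof.
move=> fi gi; rewrite (@eq_cint _ (fun x => f x + (- 1) * g x)).
  by rewrite cintD// ?cintZl// ?mulN1r//; exact: cintegrableZl.
by move=> x; rewrite mulN1r.
Qed.

Lemma cint_conj f : cintegrable f ->
  cint (fun x => conjc (f x)) = conjc (cint f).
Proof.
move=> fi; rewrite /cint /=; congr (_ +i* _).
  by apply: eq_Rintegral => x _; case: (f x).
rewrite -mulN1r -RintegralZl//; last exact: cintegrable_Im.
by apply: eq_Rintegral => x _; case: (f x) => a b /=; rewrite mulN1r.
Qed.

Lemma cint_real h : cint (fun x => (h x)%:C) = (\int[mu]_x h x)%:C.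
Proof. by rewrite /cint /= Rintegral_cst// mul0r. Qed.

(** Multiplying by the conjugate of the value of the integral turns it into a
    real integral, to which the real inequality applies. *)
Lemma normc_cint_le f : cintegrable f ->
  normc (cint f) <= \int[mu]_x normc (f x).
Proof.
move=> fi; set I := cint f.
have [I0|I0] := eqVneq (normc I) 0.
  by rewrite I0 Rintegral_ge0// => x _; exact: normc_ge0.
have Ip : 0 < normc I by rewrite lt_neqAle eq_sym I0 normc_ge0.
rewrite -(ler_pM2l Ip) -expr2.
have -> : normc I ^+ 2 = Re (cint (fun x => conjc I * f x)).
  by rewrite cintZl// mulJc_normc.
rewrite -[leLHS]/(\int[mu]_x Re (conjc I * f x)) -RintegralZl//;
  last exact: cintegrable_normc.
apply: le_Rintegral => //.
- exact: (cintegrable_Re (cintegrableZl _ fi)).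
- exact: (integrableZl measurableT (normc I) (cintegrable_normc fi)).
- move=> x _; rewrite (le_trans (ler_norm _))// (le_trans (Re_le_normc _))//.
  by rewrite Normc.normcM normcJ_eq.
Qed.

End complex_integral.

Section complex_fubini.
Context d1 d2 (T1 : measurableType d1) (T2 : measurableType d2) (R : realType).
Variables (m1 : {sigma_finite_measure set T1 -> \bar R})
          (m2 : {sigma_finite_measure set T2 -> \bar R}).

Lemma cint_prod1 (K : T1 * T2 -> R[i]) :
  cintegrable (m1 \x m2)%E K ->
  (forall x, cintegrable m2 (fun y => K (x, y))) ->
  cint (m1 \x m2)%E K = cint m1 (fun x => cint m2 (fun y => K (x, y))).
Proof.
move=> Ki Kx; rewrite /cint; apply: complex_ext => /=; rewrite /Rintegral.
  rewrite -(integral12_prod_meas1 (cintegrable_Re Ki)); congr fine.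
  apply: eq_integral => x _; rewrite fineK//.
  exact: integrable_fin_num (cintegrable_Re (Kx x)).
rewrite -(integral12_prod_meas1 (cintegrable_Im Ki)); congr fine.
apply: eq_integral => x _; rewrite fineK//.
exact: integrable_fin_num (cintegrable_Im (Kx x)).
Qed.

Lemma cint_prod2 (K : T1 * T2 -> R[i]) :
  cintegrable (m1 \x m2)%E K ->
  (forall y, cintegrable m1 (fun x => K (x, y))) ->
  cint (m1 \x m2)%E K = cint m2 (fun y => cint m1 (fun x => K (x, y))).
Proof.
move=> Ki Ky; rewrite /cint; apply: complex_ext => /=; rewrite /Rintegral.
  rewrite -(integral21_prod_meas1 (cintegrable_Re Ki)); congr fine.
  apply: eq_integral => x _; rewrite fineK//.
  exact: integrable_fin_num (cintegrable_Re (Ky x)).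
rewrite -(integral21_prod_meas1 (cintegrable_Im Ki)); congr fine.
apply: eq_integral => x _; rewrite fineK//.
exact: integrable_fin_num (cintegrable_Im (Ky x)).
Qed.

(** The shape of the integrands to which Fubini's theorem is applied: a bounded
    kernel k between two integrable functions makes the product integrable. *)
Section tensor.
Variables (a : T1 -> R[i]) (b : T2 -> R[i]) (k : T1 * T2 -> R[i]).
Hypotheses (ai : cintegrable m1 a) (bi : cintegrable m2 b)
  (mk : cmeas k) (k1 : forall p, normc (k p) <= 1).

Let K (p : T1 * T2) := a p.1 * (b p.2 * k p).

Let cmeas_fst : cmeas (fun p : T1 * T2 => a p.1).
Proof.
case: ai => -[re im] _; split.
  exact: (measurableT_comp re measurable_fst).
exact: (measurableT_comp im measurable_fst).
Qed.

Let cmeas_snd : cmeas (fun p : T1 * T2 => b p.2).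
Proof.
case: bi => -[re im] _; split.
  exact: (measurableT_comp re measurable_snd).
exact: (measurableT_comp im measurable_snd).
Qed.

Let cmeasK : cmeas K.
Proof. by apply: cmeasM => //; exact: cmeasM. Qed.

Let cmeas_sec1 x : cmeas (fun y => k (x, y)).
Proof.
case: mk => re im; split; first exact: (measurableT_comp re (pair1_measurable x)).
exact: (measurableT_comp im (pair1_measurable x)).
Qed.

Let cmeas_sec2 y : cmeas (fun x => k (x, y)).
Proof.
case: mk => re im; split; first exact: (measurableT_comp re (pair2_measurable y)).
exact: (measurableT_comp im (pair2_measurable y)).
Qed.

Lemma cintegrable_tensor : cintegrable (m1 \x m2)%E K.
Proof.
split => //; have mnK : measurable_fun setT (fun p => (normc (K p))%:E).
  by apply/measurable_EFinP; exact: measurable_normc.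
rewrite fubini_tonelli1//; last by move=> p; rewrite lee_fin normc_ge0.
rewrite /fubini_F; pose B := (\int[m2]_y (normc (b y))%:E)%E.
have B0 : (0 <= B)%E by apply: integral_ge0 => y _; rewrite lee_fin normc_ge0.
have ma : measurable_fun setT (fun x => (normc (a x))%:E).
  by apply/measurable_EFinP; apply: measurable_normc; case: ai.
have mb : measurable_fun setT (fun x => (normc (b x))%:E).
  by apply/measurable_EFinP; apply: measurable_normc; case: bi.
apply: (@le_lt_trans _ _ (\int[m1]_x ((normc (a x))%:E * B))%E).
  apply: ge0_le_integral => //.
  - by move=> x _; apply: integral_ge0 => y _; rewrite lee_fin normc_ge0.
  - apply: (measurable_fun_fubini_tonelli_F (fun p => (normc (K p))%:E)) => //.
    by move=> p; rewrite lee_fin normc_ge0.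
  - by apply: emeasurable_funM => //; exact: measurable_cst.
  - move=> x _; rewrite /B -ge0_integralZl//; last 2 first.
    + by move=> y _; rewrite lee_fin normc_ge0.
    + by rewrite lee_fin normc_ge0.
    apply: ge0_le_integral => //.
    + by move=> y _; rewrite lee_fin normc_ge0.
    + exact: (measurable_fun_pair2 (f := fun p => (normc (K p))%:E)).
    + by apply: emeasurable_funM => //; exact: measurable_cst.
    + move=> y _; rewrite -EFinM lee_fin /K !Normc.normcM/=.
      by rewrite ler_wpM2l ?normc_ge0// ler_piMr ?normc_ge0.
rewrite ge0_integralZr//; last by move=> x _; rewrite lee_fin normc_ge0.
rewrite lte_mul_pinfty//.
- by apply: integral_ge0 => x _; rewrite lee_fin normc_ge0.
- rewrite ge0_fin_numE; first by case: ai.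
  by apply: integral_ge0 => x _; rewrite lee_fin normc_ge0.
- by case: bi.
Qed.

Let sec1 x : cintegrable m2 (fun y => b y * k (x, y)).
Proof. exact: cintegrableM_bounded. Qed.

Let sec2 y : cintegrable m1 (fun x => a x * k (x, y)).
Proof. exact: cintegrableM_bounded. Qed.

Lemma cint_tensor : cint (m1 \x m2)%E K =
  cint m1 (fun x => a x * cint m2 (fun y => b y * k (x, y))).
Proof.
rewrite cint_prod1; [|exact: cintegrable_tensor|].
  by apply: eq_cint => x; rewrite /K /= cintZl.
by move=> x; exact: (cintegrableZl (a x) (sec1 x)).
Qed.

Lemma cint_tensor_swap :
  cint m1 (fun x => a x * cint m2 (fun y => b y * k (x, y))) =
  cint m2 (fun y => b y * cint m1 (fun x => a x * k (x, y))).
Proof.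
have E y : (fun x => K (x, y)) = (fun x => b y * (a x * k (x, y))).
  by apply/funext => x; rewrite /K /= mulrCA.
rewrite -cint_tensor cint_prod2; [|exact: cintegrable_tensor|].
  by apply: eq_cint => y; rewrite E cintZl.
by move=> y; rewrite E; exact: (cintegrableZl (b y) (sec2 y)).
Qed.

End tensor.

End complex_fubini.

(** * Lebesgue measure on row vectors *)

Section lebesgue_rV_theory.
Context {R : realType}.
Local Notation leb := (@lebesgue_measure R).
Local Notation mu n := (@lebesgue_rV R n).

Lemma cons_rV0 n (s : R) (v : 'rV[R]_n) : cons_rV (s, v) ord0 ord0 = s.
Proof. rewrite mxE; case: splitP => [j _|j]; rewrite ?mxE//. Qed.

Lemma cons_rVS n (s : R) (v : 'rV[R]_n) (i : 'I_n) :
  cons_rV (s, v) ord0 (lift ord0 i) = v ord0 i.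
Proof.
rewrite mxE; case: splitP => [j /= ij|j jk].
  by move: (ltn_ord j); rewrite -ij.
by congr (v _ _); apply/val_inj; move: jk => /=; rewrite /bump/= !add1n => -[].
Qed.

Lemma rV_ext n (u v : 'rV[R]_n) : (forall i, u ord0 i = v ord0 i) -> u = v.
Proof. by move=> uv; apply/rowP. Qed.

Lemma cons_rVD n (s t : R) (u v : 'rV[R]_n) :
  cons_rV (s, u) + cons_rV (t, v) = cons_rV (s + t, u + v).
Proof.
apply: rV_ext => i; have [j ->|->] := unliftP ord0 i.
  by rewrite mxE !cons_rVS mxE.
by rewrite mxE !cons_rV0.
Qed.

Lemma cons_rV_surj n (x : 'rV[R]_n.+1) :
  x = cons_rV (x ord0 ord0, \row_j x ord0 (lift ord0 j)).
Proof.
apply: rV_ext => i; have [j ->|->] := unliftP ord0 i; last by rewrite cons_rV0.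
by rewrite cons_rVS mxE.
Qed.

Local Open Scope ereal_scope.

Lemma ge0_integral_cons_rV n (f : 'rV[R]_n.+1 -> \bar R) :
  measurable_fun setT f -> (forall x, 0 <= f x) ->
  \int[mu n.+1]_x f x = \int[leb]_s \int[mu n]_v f (cons_rV (s, v)).
Proof.
move=> mf f0.
have mfc : measurable_fun setT (f \o @cons_rV R n).
  by apply: measurableT_comp => //; exact: measurable_cons_rV.
rewrite [LHS](_ : _ = \int[leb \x mu n]_p (f \o @cons_rV R n) p).
  by rewrite fubini_tonelli1// => x; exact: f0.
rewrite -[LHS]/(\int[pushforward (leb \x mu n) (@cons_rV R n)]_x f x).
rewrite (ge0_integral_pushforward (@measurable_cons_rV R n))//.
Qed.

Lemma integrable_cons_rV n (f : 'rV[R]_n.+1 -> \bar R) :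
  (leb \x mu n).-integrable setT (f \o (@cons_rV R n)) ->
  measurable_fun setT f ->
  \int[mu n.+1]_x f x = \int[leb \x mu n]_p f (cons_rV p).
Proof.
move=> fi mf.
rewrite -[LHS]/(\int[pushforward (leb \x mu n) (@cons_rV R n)]_x f x).
by rewrite (integral_pushforward (@measurable_cons_rV R n)).
Qed.

Lemma lebesgue_measure_translate (a : R) (A : set R) : measurable A ->
  pushforward leb (fun x => x + a : measurableTypeR R)%R A = leb A.
Proof.
move=> mA; apply/esym.
have mt : measurable_fun setT (fun x : measurableTypeR R => x + a : measurableTypeR R)%R.
  by apply: measurable_funD => //; exact: measurable_cst.
apply: (@lebesgue_measure_unique R
  (measure_function_pushforward__canonical__measure_function_Measure leb mt)) => //.
move=> _ [[b c]] _ <- /=; rewrite /pushforward.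
rewrite (_ : _ @^-1` _ = `](b - a)%R, (c - a)%R]%classic).
  rewrite !lebesgue_measure_itv/= !lte_fin ltrD2r.
  by case: ifP => // _; rewrite !EFinB; congr EFin; ring.
apply/seteqP; split => x /=; rewrite !in_itv/= ltrBlDr lerBrDr//.
Qed.

Lemma ge0_integral_leb_translate (a : R) (f : R -> \bar R) :
  measurable_fun setT f -> (forall x, 0 <= f x) ->
  \int[leb]_x f (x + a)%R = \int[leb]_x f x.
Proof.
move=> mf f0.
have mt : measurable_fun setT (fun x : measurableTypeR R => x + a : measurableTypeR R)%R.
  by apply: measurable_funD => //; exact: measurable_cst.
transitivity (\int[pushforward leb (fun x => x + a : measurableTypeR R)%R]_x f x).
  by rewrite (ge0_integral_pushforward mt).
apply: (@eq_measure_integral _ _ _ _ leb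
  (measure_function_pushforward__canonical__measure_function_Measure leb mt)).
by move=> A mA _; exact: lebesgue_measure_translate.
Qed.

Lemma measurable_translate n (a : 'rV[R]_n) :
  measurable_fun setT (fun x : 'rV[R]_n => x + a)%R.
Proof.
apply: measurable_fun_rVP => i.
rewrite (_ : (fun t => _) = (fun x : 'rV[R]_n => x ord0 i + a ord0 i)%R).
  by apply: measurable_funD; [exact: measurable_coord|exact: measurable_cst].
by apply/funext => x; rewrite mxE.
Qed.

(** Induction on the dimension: translating the last coordinates is the
    induction hypothesis, translating the first one is the translation
    invariance on the line. *)
Lemma ge0_integral_translate n (a : 'rV[R]_n) (f : 'rV[R]_n -> \bar R) :
  measurable_fun setT f -> (forall x, 0 <= f x) ->
  \int[mu n]_x f (x + a)%R = \int[mu n]_x f x.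
Proof.
elim: n a f => [|n IH] a f mf f0.
  by apply: eq_integral => x _; congr f; apply: rV_ext => -[].
rewrite !ge0_integral_cons_rV//; last first.
  exact: (measurableT_comp mf (measurable_translate a)).
have mfc : measurable_fun setT (f \o @cons_rV R n).
  by apply: measurableT_comp => //; exact: measurable_cons_rV.
rewrite (cons_rV_surj a); set s0 := a _ _; set v0 := (\row_j _)%R.
transitivity (\int[leb]_s \int[mu n]_v f (cons_rV ((s + s0)%R, v))).
  apply: eq_integral => s _; under eq_integral do rewrite cons_rVD.
  rewrite (IH v0 (fun v => f (cons_rV ((s + s0)%R, v))))//.
  exact: (measurable_fun_pair2 (f := f \o @cons_rV R n)).
rewrite (ge0_integral_leb_translate s0
  (f := fun s => \int[mu n]_v f (cons_rV (s, v))))//.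
  exact: (measurable_fun_fubini_tonelli_F (f \o @cons_rV R n) mfc (fun=> f0 _)).
by move=> s; exact: integral_ge0.
Qed.

End lebesgue_rV_theory.

Section ereal_small.
Context {R : realType}.
Local Open Scope ereal_scope.

(** A form of convergence to 0 that combines directly with inequalities
    between integrals. *)
Lemma cvge0_small (u : nat -> \bar R) : (forall n, 0 <= u n) ->
  (u @ \oo --> 0 <->
   forall e : R, (0 < e)%R -> \forall n \near \oo, u n <= e%:E).
Proof.
move=> u0; split => [u_cvg e e0|u_small].
  have /fine_cvgP[ufin] := u_cvg.
  move=> /cvgrPdist_le/(_ e e0) ule.
  near=> n; have un : u n \is a fin_num by near: n.
  rewrite -(fineK un) lee_fin; have : (`|0 - fine (u n)| <= e)%R by near: n.
  by rewrite sub0r normrN => /(le_trans (ler_norm _)).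
apply/fine_cvgP; split.
  have := u_small 1%R ltr01; apply: filterS => n un.
  by rewrite ge0_fin_numE// (le_lt_trans un)// ltry.
apply/cvgrPdist_le => e e0; have := u_small e e0; apply: filterS => n un.
rewrite sub0r normrN ger0_norm ?fine_ge0// -lee_fin fineK//.
by rewrite ge0_fin_numE// (le_lt_trans un)// ltry.
Unshelve. all: by end_near. Qed.

Lemma cvge0_squeeze (u v : nat -> \bar R) : (forall n, 0 <= u n) ->
  (forall n, u n <= v n) -> v @ \oo --> 0 -> u @ \oo --> 0.
Proof.
move=> u0 uv v0; apply: (@squeeze_cvge _ _ _ _ (fun=> 0) _ v) => //.
  by apply: nearW => n; rewrite u0 uv.
exact: cvg_cst.
Qed.

End ereal_small.

Section bounded_convergence.
Context d (T : measurableType d) (R : realType) (mu : {measure set T -> \bar R}).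

Lemma bounded_sqr_cvg0 (D : set T) (h : nat -> T -> R) (M : R) :
  measurable D -> (mu D < +oo)%E -> (forall k, measurable_fun setT (h k)) ->
  (forall k x, `|h k x| <= M) -> (forall x, h k x @[k --> \oo] --> 0) ->
  (\int[mu]_(x in D) (h k x ^+ 2)%:E @[k --> \oo] --> 0)%E.
Proof.
move=> mD Doo mh hM h0.
have [] := @dominated_convergence _ T R mu D mD (fun k x => (h k x ^+ 2)%:E)
  (cst 0%E) (cst (M ^+ 2)%:E).
- by move=> k; apply/measurable_EFinP; apply: measurable_funTS; exact: measurable_funX.
- exact: measurable_cst.
- apply: aeW => x _; apply: cvg_EFin; first exact: nearW.
  rewrite -[X in _ --> X](mulr0 (0 : R)).
  exact: (cvgM (h0 x) (h0 x)).
- apply/integrableP; split; first exact: measurable_cst.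
  rewrite integral_cst//= lte_mul_pinfty//.
- apply: aeW => x k _; rewrite /= normrX lee_fin ler_pXn2r ?nnegrE//.
  exact: le_trans (hM k x).
- by move=> _ _; rewrite integral_cst//= mul0e.
Qed.

End bounded_convergence.

Section lebesgue_rV_integrals.
Context {R : realType}.
Local Notation leb := (@lebesgue_measure R).
Local Notation mu n := (@lebesgue_rV R n).

Lemma integral_translate n (a : 'rV[R]_n) (f : 'rV[R]_n -> \bar R) :
  measurable_fun setT f -> (\int[mu n]_x f (x + a)%R = \int[mu n]_x f x)%E.
Proof.
move=> mf; rewrite [LHS]integralE [RHS]integralE.
congr (_ - _)%E.
  rewrite -(ge0_integral_translate a (measurable_funepos mf))//.
  by apply: eq_integral => x _; exact: (congr1 (@^~ x) (funepos_comp f (fun x => x + a))).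
rewrite -(ge0_integral_translate a (measurable_funeneg mf))//.
by apply: eq_integral => x _; exact: (congr1 (@^~ x) (funeneg_comp f (fun x => x + a))).
Qed.

Lemma cmeas_translate n (a : 'rV[R]_n) (f : 'rV[R]_n -> R[i]) :
  cmeas f -> cmeas (fun x : 'rV[R]_n => f (x + a)).
Proof.
move=> [re im]; split; first exact: (measurableT_comp re (measurable_translate a)).
exact: (measurableT_comp im (measurable_translate a)).
Qed.

Lemma cint_translate n (a : 'rV[R]_n) (f : 'rV[R]_n -> R[i]) : cmeas f ->
  cint (mu n) (fun x : 'rV[R]_n => f (x + a)) = cint (mu n) f.
Proof.
move=> [re im]; rewrite /cint /Rintegral; apply: complex_ext => /=; congr fine.
  rewrite (integral_translate a (f := fun x => (Re (f x))%:E))//.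
  exact/measurable_EFinP.
rewrite (integral_translate a (f := fun x => (Im (f x))%:E))//.
exact/measurable_EFinP.
Qed.

Lemma cintegrable_translate n (a : 'rV[R]_n) (f : 'rV[R]_n -> R[i]) :
  cintegrable (mu n) f -> cintegrable (mu n) (fun x : 'rV[R]_n => f (x + a)).
Proof.
move=> [mf foo]; split; first exact: cmeas_translate.
rewrite (ge0_integral_translate a (f := fun x => (normc (f x))%:E))//.
  by apply/measurable_EFinP; exact: measurable_normc.
by move=> x; rewrite lee_fin normc_ge0.
Qed.

Lemma cint_cons_rV n (f : 'rV[R]_n.+1 -> R[i]) : cmeas f ->
  cintegrable (leb \x mu n)%E (fun p => f (cons_rV p)) ->
  cint (mu n.+1) f = cint (leb \x mu n)%E (fun p => f (cons_rV p)).
Proof.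
move=> [re im] fi; apply: complex_ext => /=; congr fine.
  apply: (integrable_cons_rV (cintegrable_Re fi)); exact/measurable_EFinP.
apply: (integrable_cons_rV (cintegrable_Im fi)); exact/measurable_EFinP.
Qed.

Lemma cintegrable_cons_rV n (f : 'rV[R]_n.+1 -> R[i]) : cmeas f ->
  cintegrable (leb \x mu n)%E (fun p => f (cons_rV p)) ->
  cintegrable (mu n.+1) f.
Proof.
move=> mf [mfc foo]; split => //.
rewrite -[X in (X < _)%E]/(\int[pushforward (leb \x mu n) (@cons_rV R n)]_x
  (normc (f x))%:E)%E.
rewrite (ge0_integral_pushforward (@measurable_cons_rV R n))//.
  by apply/measurable_EFinP; exact: measurable_normc.
by move=> x _; rewrite lee_fin normc_ge0.
Qed.

Lemma cmeas_prod_coord n (h : 'I_n -> R -> R[i]) :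
  (forall i, cmeas (h i : measurableTypeR R -> R[i])) ->
  cmeas (fun x : 'rV[R]_n => \prod_i h i (x ord0 i)).
Proof.
move=> mh; elim: (index_enum _) => [|i s IH].
  by under eq_fun do rewrite big_nil; exact: cmeas_cst.
under eq_fun do rewrite big_cons; apply: cmeasM => //.
by case: (mh i) => re im; split; [exact: (measurableT_comp re (measurable_coord i))|
  exact: (measurableT_comp im (measurable_coord i))].
Qed.

Lemma cint_prod_coord n (h : 'I_n -> R -> R[i]) :
  (forall i, cintegrable leb (h i)) ->
  cintegrable (mu n) (fun x => \prod_i h i (x ord0 i)) /\
  cint (mu n) (fun x => \prod_i h i (x ord0 i)) = \prod_i cint leb (h i).
Proof.
elim: n h => [|n IH] h hi.
  have -> : (fun x : 'rV[R]_0 => \prod_i h i (x ord0 i)) = fun=> 1.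
    by apply/funext => x; rewrite big_ord0.
  rewrite big_ord0; split; last first.
    rewrite /cint /Rintegral; apply: complex_ext => /=.
      by rewrite integral_dirac//= indicT mul1r.
    by rewrite integral0.
  split; first exact: cmeas_cst.
  under eq_integral do rewrite Normc.normc1.
  rewrite integral_dirac//=. by rewrite diracT mul1e ltry.
have [Gi GE] := IH (fun i => h (lift ord0 i)) (fun i => hi _).
have E p : \prod_i h i (cons_rV p ord0 i) =
    h ord0 p.1 * (\prod_i h (lift ord0 i) (p.2 ord0 i) * 1).
  case: p => s v; rewrite big_ord_recl cons_rV0 mulr1.
  by congr (_ * _); apply: eq_bigr => i _; rewrite cons_rVS.
pose k1 (_ : measurableTypeR R * 'rV[R]_n) : R[i] := 1.
have m1 : cmeas k1 by exact: cmeas_cst.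
have n1 p : normc (k1 p) <= 1.
  by rewrite Normc.normc1.
have mF : cmeas (fun x : 'rV[R]_n.+1 => \prod_i h i (x ord0 i)).
  by apply: (@cmeas_prod_coord _ h) => i; case: (hi i).
have Fi : cintegrable (leb \x mu n)%E (fun p => \prod_i h i (cons_rV p ord0 i)).
  by rewrite (funext E); exact: (cintegrable_tensor (hi ord0) Gi m1 n1).
split; first exact: cintegrable_cons_rV.
rewrite cint_cons_rV// (eq_cint _ E).
rewrite (cint_tensor (hi ord0) Gi m1 n1) big_ord_recl -GE.
rewrite mulrC -cintZl//.
by apply: eq_cint => s; under eq_cint do rewrite mulr1; rewrite mulrC.
Qed.

Lemma integral_prod_coord n (h : 'I_n -> R -> R) (c : 'I_n -> R) :
  (forall i s, 0 <= h i s) ->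
  (forall i, measurable_fun setT (h i : measurableTypeR R -> R)) ->
  (forall i, (\int[leb]_s (h i s)%:E = (c i)%:E)%E) ->
  (\int[mu n]_x (\prod_i h i (x ord0 i))%:E = (\prod_i c i)%:E)%E.
Proof.
move=> h0 mh hc.
have hi i : cintegrable leb (fun s => (h i s)%:C).
  apply: cintegrable_real; apply/integrableP; split; first exact/measurable_EFinP.
  by under eq_integral do rewrite /= ger0_norm//; rewrite hc ltry.
have [Fi FE] := cint_prod_coord hi.
have E (x : 'rV[R]_n) : \prod_i (h i (x ord0 i))%:C = (\prod_i h i (x ord0 i))%:C.
  by rewrite rmorph_prod.
have p0 (x : 'rV[R]_n) : 0 <= \prod_i h i (x ord0 i) by exact: prodr_ge0.
have Foo : (\int[mu n]_x (\prod_i h i (x ord0 i))%:E)%E \is a fin_num.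
  rewrite ge0_fin_numE; last by apply: integral_ge0 => x _; rewrite lee_fin.
  case: Fi => _; under eq_integral do rewrite E normc_real ger0_norm//.
  exact.
rewrite -(fineK Foo); congr EFin.
move: FE; rewrite (eq_cint _ E) cint_real.
rewrite (eq_bigr (fun i => (c i)%:C)).
  by rewrite -rmorph_prod => -[].
by move=> i _; rewrite cint_real /Rintegral hc.
Qed.

Definition box n (N : R) : set 'rV[R]_n := [set x | forall i, `|x ord0 i| <= N].

Lemma measurable_box n N : measurable (@box n N).
Proof.
rewrite (_ : box N = \bigcap_(i in [set: 'I_n]) [set x | `|x ord0 i| <= N]).
  apply: fin_bigcap_measurable => // i _.
  rewrite [X in measurable X](_ : _ = (fun x : 'rV[R]_n => x ord0 i) @^-1` `[- N, N]%classic).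
    by rewrite -[X in measurable X]setTI; apply: measurable_coord.
  by apply/seteqP; split => x /=; rewrite in_itv/= ler_norml.
by apply/seteqP; split => x xN i; [move=> _; exact: xN|exact: (xN i I)].
Qed.

Lemma indic_box n N (x : 'rV[R]_n) :
  \1_(box N) x = \prod_i \1_(`[- N, N]%classic) (x ord0 i) :> R.
Proof.
have [xN|xN] := pselect (box N x).
  rewrite indicE mem_set//= big1// => i _; rewrite indicE mem_set//=.
  by rewrite in_itv/= -ler_norml; exact: xN.
rewrite indicE memNset//=; apply/esym/eqP/prodf_eq0.
have /existsNP[i iN] := xN; exists i => //.
by rewrite indicE memNset//= in_itv/= -ler_norml.
Qed.

Lemma lebesgue_box n N : 0 <= N -> (mu n (@box n N) = ((N *+ 2) ^+ n)%:E)%E.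
Proof.
move=> N0; have -> : (mu n (@box n N) = \int[mu n]_x (\1_(box N) x)%:E)%E.
  by rewrite integral_indic ?setIT//; exact: measurable_box.
under eq_integral do rewrite indic_box.
rewrite (@integral_prod_coord n (fun=> \1_(`[- N, N]%classic)) (fun=> N *+ 2)).
- by rewrite prodr_const card_ord.
- by move=> i s; rewrite indicE.
- by move=> i; exact: measurable_indic.
- move=> i; rewrite integral_indic//= setIT lebesgue_measure_itv/= lte_fin.
  case: ifP => [_|]; first by rewrite -EFinB opprK mulr2n.
  move=> /negbT; rewrite -leNgt => NN; have -> : N = 0 by lra.
  by rewrite mul0rn.
Qed.

Lemma lebesgue_box_lty n N : (mu n (@box n N) < +oo)%E.
Proof.
apply: (@le_lt_trans _ _ (mu n (@box n `|N|))).
  apply: le_measure; rewrite ?inE; try exact: measurable_box.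
  by move=> x xN i; rewrite (le_trans (xN i))// ler_norm.
by rewrite lebesgue_box// ltry.
Qed.

Lemma box_exhaust n (x : 'rV[R]_n) : exists N : nat, box N%:R x.
Proof.
exists (Num.truncn (\sum_i `|x ord0 i|)).+1 => i.
apply: (@le_trans _ _ (\sum_i `|x ord0 i|)).
  by rewrite (bigD1 i)//= lerDl sumr_ge0.
by rewrite ltW// truncnS_gt.
Qed.

End lebesgue_rV_integrals.

Section integral_comparison.
Context d (T : measurableType d) (R : realType) (mu : {measure set T -> \bar R}).
Local Open Scope ereal_scope.

Lemma le_integral_lincomb2 (D : set T) (c : R) (f g h : T -> R) :
  measurable D -> (0 <= c)%R ->
  measurable_fun D f -> measurable_fun D g -> measurable_fun D h ->
  (forall x, D x -> 0 <= f x)%R -> (forall x, D x -> 0 <= g x)%R ->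
  (forall x, D x -> 0 <= h x)%R ->
  (forall x, D x -> h x <= c * (f x + g x))%R ->
  \int[mu]_(x in D) (h x)%:E <=
    c%:E * (\int[mu]_(x in D) (f x)%:E + \int[mu]_(x in D) (g x)%:E).
Proof.
move=> mD c0 mf mg mh f0 g0 h0 hfg.
have mf' : measurable_fun D (EFin \o f) by exact/measurable_EFinP.
have mg' : measurable_fun D (EFin \o g) by exact/measurable_EFinP.
rewrite -ge0_integralD//.
rewrite -ge0_integralZl//; last 2 first.
  exact: emeasurable_funD.
  by move=> x Dx; apply: adde_ge0; rewrite lee_fin ?f0 ?g0.
apply: ge0_le_integral => //.
- exact/measurable_EFinP.
- by apply: emeasurable_funM; [exact: measurable_cst|exact: emeasurable_funD].
Qed.

Lemma cvg0_integral_lincomb2 (D : set T) (c : R) (f g h : nat -> T -> R) :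
  measurable D -> (0 <= c)%R ->
  (forall k, measurable_fun D (f k)) -> (forall k, measurable_fun D (g k)) ->
  (forall k, measurable_fun D (h k)) ->
  (forall k x, D x -> 0 <= f k x)%R -> (forall k x, D x -> 0 <= g k x)%R ->
  (forall k x, D x -> 0 <= h k x)%R ->
  (forall k x, D x -> h k x <= c * (f k x + g k x))%R ->
  \int[mu]_(x in D) (f k x)%:E @[k --> \oo] --> 0 ->
  \int[mu]_(x in D) (g k x)%:E @[k --> \oo] --> 0 ->
  \int[mu]_(x in D) (h k x)%:E @[k --> \oo] --> 0.
Proof.
move=> mD c0 mf mg mh f0 g0 h0 hfg If Ig.
apply: (@cvge0_squeeze _ _ (fun k => c%:E *
  (\int[mu]_(x in D) (f k x)%:E + \int[mu]_(x in D) (g k x)%:E))).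
- by move=> k; apply: integral_ge0 => x Dx; rewrite lee_fin h0.
- by move=> k; apply: le_integral_lincomb2 => //; [exact: f0|exact: g0|exact: h0|exact: hfg].
- rewrite -[X in _ --> X](mule0 c%:E); apply: cvgeZl => //.
  by rewrite -[X in _ --> X](adde0 0); apply: cvgeD.
Qed.

End integral_comparison.

(** * Continuity of translations in the space of square-integrable functions *)

Section translation_continuity.
Context {R : realType} (n : nat).
Local Notation mu := (@lebesgue_rV R n).
Implicit Types (p q : 'rV[R]_n -> R) (z : nat -> 'rV[R]_n).

(** An explicit rate makes the translation vectors uniformly bounded. *)
Definition shrinking z := forall k i, `|z k ord0 i| <= k.+1%:R^-1.

Lemma shrinking_le1 z k i : shrinking z -> `|z k ord0 i| <= 1.
Proof. by move=> /(_ k i)/le_trans; apply; rewrite invf_le1// ler1n. Qed.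

Lemma shrinking_cvg z i : shrinking z -> z k ord0 i @[k --> \oo] --> (0 : R).
Proof.
move=> zs; apply: norm_cvg0; apply: (squeeze_cvgr _ (cvg_cst 0) (@cvg_harmonic R)).
by apply: nearW => k; rewrite normr_ge0/= zs.
Qed.

(** The bounded functions whose translates converge to them in square mean on
    bounded sets. Localizing makes the class contain the constants, which makes
    it an algebra closed under bounded pointwise limits; it therefore contains
    all the bounded measurable functions as soon as it contains the continuous
    functions of one coordinate. *)
Definition locally_translation_continuous p :=
  [/\ measurable_fun setT p, (exists M, forall x, `|p x| <= M) &
    forall z N, shrinking z ->
      (\int[mu]_(x in box N) ((p (x + z k) - p x) ^+ 2)%:E @[k --> \oo] --> 0)%E].
Local Notation ltc := locally_translation_continuous.

Lemma measurable_fun_translate p (a : 'rV[R]_n) :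
  measurable_fun setT p -> measurable_fun setT (fun x : 'rV[R]_n => p (x + a)).
Proof. by move=> mp; exact: (measurableT_comp mp (measurable_translate a)). Qed.

Lemma measurable_sqr_diff p (a : 'rV[R]_n) (D : set 'rV[R]_n) :
  measurable_fun setT p ->
  measurable_fun D (fun x : 'rV[R]_n => (p (x + a) - p x) ^+ 2).
Proof.
move=> mp; apply: measurable_funTS; apply: measurable_funX.
by apply: measurable_funB => //; exact: measurable_fun_translate.
Qed.

Lemma ltc_cst c : ltc (fun=> c).
Proof.
split; [exact: measurable_cst|by exists (`|c|)|move=> z N _].
under eq_fun do under eq_integral do rewrite subrr expr0n/=.
by under eq_fun do rewrite integral0; exact: cvg_cst.
Qed.

Lemma ltcD p q : ltc p -> ltc q -> ltc (fun x => p x + q x).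
Proof.
move=> [mp [M pM] pc] [mq [L qL] qc]; split; first exact: measurable_funD.
  by exists (M + L) => x; rewrite (le_trans (ler_normD _ _))// lerD.
move=> z N zs; have mpq : measurable_fun setT (fun x => p x + q x).
  exact: measurable_funD.
apply: (@cvg0_integral_lincomb2 _ _ _ mu _ 2
  (fun k x => (p (x + z k) - p x) ^+ 2) (fun k x => (q (x + z k) - q x) ^+ 2)
  (fun k x => (p (x + z k) + q (x + z k) - (p x + q x)) ^+ 2)).
- exact: measurable_box.
- by [].
- by move=> k; exact: measurable_sqr_diff.
- by move=> k; exact: measurable_sqr_diff.
- by move=> k; exact: measurable_sqr_diff.
- by move=> k x _; exact: sqr_ge0.
- by move=> k x _; exact: sqr_ge0.
- by move=> k x _; exact: sqr_ge0.
- move=> k x _; set a := p _; set b := q (_ + _).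
  have := sqr_ge0 ((a - p x) - (b - q x)); nra.
- exact: pc.
- exact: qc.
Qed.

Lemma ltcM p q : ltc p -> ltc q -> ltc (fun x => p x * q x).
Proof.
move=> [mp [M pM] pc] [mq [L qL] qc].
have mpq : measurable_fun setT (fun x => p x * q x) by exact: measurable_funM.
have M0 : 0 <= M by exact: le_trans (normr_ge0 _) (pM 0).
have L0 : 0 <= L by exact: le_trans (normr_ge0 _) (qL 0).
split => //; first by exists (M * L) => x; rewrite normrM ler_pM.
move=> z N zs.
apply: (@cvg0_integral_lincomb2 _ _ _ mu _ (2 * (M ^+ 2 + L ^+ 2))
  (fun k x => (p (x + z k) - p x) ^+ 2) (fun k x => (q (x + z k) - q x) ^+ 2)
  (fun k x => (p (x + z k) * q (x + z k) - p x * q x) ^+ 2)).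
- exact: measurable_box.
- by rewrite mulr_ge0// addr_ge0// sqr_ge0.
- by move=> k; exact: measurable_sqr_diff.
- by move=> k; exact: measurable_sqr_diff.
- by move=> k; exact: measurable_sqr_diff.
- by move=> k x _; exact: sqr_ge0.
- by move=> k x _; exact: sqr_ge0.
- by move=> k x _; exact: sqr_ge0.
- move=> k x _; have := pM x; have := qL (x + z k).
  set a := p (_ + _); set a' := p x; set b := q (_ + _); set b' := q x.
  move=> bL aM.
  have b2 : b ^+ 2 <= L ^+ 2 by rewrite -real_normK ?num_real// ler_pXn2r ?nnegrE.
  have a2 : a' ^+ 2 <= M ^+ 2 by rewrite -real_normK ?num_real// ler_pXn2r ?nnegrE.
  have -> : a * b - a' * b' = (a - a') * b + a' * (b - b') by ring.
  apply: (@le_trans _ _ (2 * ((a - a') ^+ 2 * b ^+ 2 + a' ^+ 2 * (b - b') ^+ 2))).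
    have := sqr_ge0 ((a - a') * b - a' * (b - b')); nra.
  rewrite -[X in _ <= X]mulrA ler_pM2l// mulrDr lerD//.
    rewrite mulrC ler_wpM2r ?sqr_ge0//; have := sqr_ge0 M; lra.
  rewrite ler_wpM2r ?sqr_ge0//; have := sqr_ge0 L; lra.
- exact: pc.
- exact: qc.
Qed.

Lemma ltcZ c p : ltc p -> ltc (fun x => c * p x).
Proof. exact: ltcM (ltc_cst c). Qed.

Lemma ltc_sum I (s : seq I) (F : I -> 'rV[R]_n -> R) :
  (forall i, ltc (F i)) -> ltc (fun x => \sum_(i <- s) F i x).
Proof.
move=> hF; elim: s => [|i s IH].
  by under eq_fun do rewrite big_nil; exact: ltc_cst.
by under eq_fun do rewrite big_cons; exact: ltcD.
Qed.

(** Pointwise convergence by continuity, and dominated convergence on the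
    box. *)
Lemma ltc_coord (i : 'I_n) (c : R -> R) M :
  continuous c -> (forall t, `|c t| <= M) -> ltc (fun x => c (x ord0 i)).
Proof.
move=> cc cM.
have mc : measurable_fun setT (fun x : 'rV[R]_n => c (x ord0 i)).
  apply: (measurableT_comp _ (measurable_coord i)).
  exact: continuous_measurable_fun.
split => //; first by exists M.
move=> z N zs; apply: (@bounded_sqr_cvg0 _ _ _ mu _
  (fun k x => c ((x + z k) ord0 i) - c (x ord0 i)) (M + M)).
- exact: measurable_box.
- exact: lebesgue_box_lty.
- by move=> k; apply: measurable_funB => //; exact: (measurable_fun_translate _ mc).
- by move=> k x; rewrite (le_trans (ler_normB _ _))// lerD.
- move=> x; rewrite -(subrr (c (x ord0 i))); apply: cvgB; last exact: cvg_cst.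
  have h : (x + z k) ord0 i @[k --> \oo] --> x ord0 i.
    rewrite (_ : (fun k => (x + z k) ord0 i) = fun k => x ord0 i + z k ord0 i).
      rewrite -[X in _ --> X]addr0.
      by apply: cvgD; [exact: cvg_cst|exact: shrinking_cvg].
    by apply/funext => k; rewrite mxE.
  exact: (continuous_cvg _ (cc _) h).
Qed.

Lemma le_integral_box_translate (f : 'rV[R]_n -> \bar R) N (a : 'rV[R]_n) :
  measurable_fun setT f -> (forall x, 0 <= f x)%E ->
  (forall i, `|a ord0 i| <= 1) ->
  (\int[mu]_(x in box N) f (x + a)%R <= \int[mu]_(x in box (N + 1)%R) f x)%E.
Proof.
move=> mf f0 a1.
have mr (g : 'rV[R]_n -> \bar R) M : measurable_fun setT g ->
    measurable_fun setT (g \_ (box M)).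
  move=> mg; apply/(measurable_restrictT g (measurable_box M)).
  exact: measurable_funTS.
rewrite [leRHS]integral_mkcond -(ge0_integral_translate a); last 2 first.
- exact: mr.
- by move=> x; exact: erestrict_ge0.
rewrite [leLHS]integral_mkcond; apply: ge0_le_integral => //.
- by move=> x _; exact: erestrict_ge0.
- by apply: mr; exact: (measurableT_comp mf (measurable_translate a)).
- exact: (measurableT_comp (mr _ _ mf) (measurable_translate a)).
- move=> x _; rewrite /patch; case: ifPn => [/set_mem xN|_].
    rewrite mem_set// => i; rewrite mxE (le_trans (ler_normD _ _))//.
    by rewrite lerD.
  by case: ifPn.
Qed.

(** The error made by replacing p with an approximant on a box, and on its
    translates, is controlled by the square mean error on a box larger by 1. *)
Lemma ltc_lim (pj : nat -> 'rV[R]_n -> R) p (M : R) :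
  (forall j, ltc (pj j)) -> (forall j x, `|pj j x| <= M) ->
  (forall x, pj j x @[j --> \oo] --> p x) -> ltc p.
Proof.
move=> pjc pjM pjp.
have mpj j : measurable_fun setT (pj j) by case: (pjc j).
have mp : measurable_fun setT p.
  by apply: (measurable_fun_cvg (h := pj)) => // x _; exact: pjp.
have pM x : `|p x| <= M.
  have h : `|pj j x| @[j --> \oo] --> `|p x|.
    exact: cvg_norm (pjp x).
  rewrite -(cvg_lim (@Rhausdorff R) h); apply: limr_le; first by apply/cvg_ex; exists (`|p x|).
  by apply: nearW => j; exact: pjM.
split => //; first by exists M.
move=> z N zs.
have d0 L : (\int[mu]_(x in box L) ((pj j x - p x) ^+ 2)%:E @[j --> \oo] --> 0)%E.
  apply: (@bounded_sqr_cvg0 _ _ _ mu _ (fun k x => pj k x - p x) (M + M)).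
  - exact: measurable_box.
  - exact: lebesgue_box_lty.
  - by move=> k; exact: measurable_funB.
  - by move=> k x; rewrite (le_trans (ler_normB _ _))// lerD.
  - by move=> x; rewrite -(subrr (p x)); apply: cvgB => //; exact: cvg_cst.
have ge0 D (f : 'rV[R]_n -> R) : (0 <= \int[mu]_(x in D) (f x ^+ 2)%:E)%E.
  by apply: integral_ge0 => x _; rewrite lee_fin sqr_ge0.
apply/cvge0_small => [k|e e0]; first exact: ge0.
(* The square of a sum of three terms costs a factor 4, and each of the three
   terms contributes e / 12. *)
pose e' := e / 12; have e'0 : 0 < e' by rewrite divr_gt0.
have [j [dj1 dj2]] : exists j,
    (\int[mu]_(x in box N) ((pj j x - p x) ^+ 2)%:E <= e'%:E)%E /\
    (\int[mu]_(x in box (N + 1)%R) ((pj j x - p x) ^+ 2)%:E <= e'%:E)%E.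
  have h1 := iffLR (cvge0_small (fun j => ge0 _ (fun x => pj j x - p x))) (d0 N) _ e'0.
  have h2 := iffLR (cvge0_small (fun j => ge0 _ (fun x => pj j x - p x))) (d0 (N + 1)) _ e'0.
  have [m _ h] := filterI h1 h2.
  by exists m; apply: h => /=.
have [_ _ /(_ z N zs) cj] := pjc j.
have := iffLR (cvge0_small (fun k => ge0 _ (fun x => pj j (x + z k) - pj j x))) cj _ e'0.
apply: filterS => k hk.
have mB := @measurable_box R n N.
have mD : measurable_fun setT (fun x => (pj j x - p x) ^+ 2).
  by apply: measurable_funX; exact: measurable_funB.
have mDz : measurable_fun setT (fun x : 'rV[R]_n => (pj j (x + z k) - p (x + z k)) ^+ 2).
  exact: (measurable_fun_translate _ mD).
have djz : (\int[mu]_(x in box N) ((pj j (x + z k)%R - p (x + z k)%R) ^+ 2)%:E <= e'%:E)%E.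
  apply: le_trans dj2.
  apply: (@le_integral_box_translate (fun x => ((pj j x - p x) ^+ 2)%:E)) => //.
  + exact/measurable_EFinP.
  + by move=> x; rewrite lee_fin sqr_ge0.
  + by move=> i; exact: shrinking_le1.
have s1 : (\int[mu]_(x in box N) ((pj j (x + z k)%R - pj j x) ^+ 2 + (pj j x - p x) ^+ 2)%:E
    <= (e' + e')%:E)%E.
  under eq_integral do rewrite EFinD.
  rewrite ge0_integralD//.
  - by rewrite EFinD leeD.
  - by move=> x _; rewrite lee_fin sqr_ge0.
  - by apply/measurable_EFinP; exact: measurable_sqr_diff.
  - by move=> x _; rewrite lee_fin sqr_ge0.
  - by apply/measurable_EFinP; exact: measurable_funTS.
apply: (@le_trans _ _ (4%:E * (e'%:E + (e' + e')%:E))%E); last first.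
  by rewrite -EFinD -EFinM lee_fin /e'; lra.
apply: le_trans (lee_wpmul2l _ (leeD djz s1)); last by rewrite lee_fin.
apply: le_integral_lincomb2 => //.
- exact: measurable_funTS.
- apply: measurable_funD; first exact: measurable_sqr_diff.
  exact: measurable_funTS.
- exact: measurable_sqr_diff.
- by move=> x _; exact: sqr_ge0.
- by move=> x _; rewrite addr_ge0 ?sqr_ge0.
- by move=> x _; exact: sqr_ge0.
- move=> x _; set a := pj j (_ + _); set b := p (_ + _); set c := pj j x; set f := p x.
  have := sqr_ge0 ((a - b) + (a - c)); have := sqr_ge0 ((a - b) + (c - f)).
  by have := sqr_ge0 ((a - c) - (c - f)); have := sqr_ge0 (c - f); nra.
Qed.

End translation_continuity.

Section translation_continuity_L2.
Context {R : realType} (n : nat).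
Local Notation mu := (@lebesgue_rV R n).
Local Notation ltc := (@locally_translation_continuous R n).
Implicit Types (p q : 'rV[R]_n -> R) (z : nat -> 'rV[R]_n).

Definition ltc_set (A : set 'rV[R]_n) := ltc (\1_A).

Lemma normr_indic_le1 T (A : set T) (x : T) : `|\1_A x : R| <= 1.
Proof. by rewrite indicE; case: (x \in A); rewrite ?normr1 ?normr0. Qed.

Lemma ltc_setC A : ltc_set A -> ltc_set (~` A).
Proof.
move=> hA; rewrite /ltc_set.
rewrite (_ : \1_(~` A) = fun x => 1 + (-1) * \1_A x).
  by apply: ltcD; [exact: ltc_cst|exact: ltcZ].
apply/funext => x; rewrite !indicE in_setC.
by case: (x \in A) => /=; rewrite ?mulr1 ?mulr0 ?subrr ?addr0.
Qed.

Lemma ltc_setU A B : ltc_set A -> ltc_set B -> ltc_set (A `|` B).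
Proof.
move=> hA hB; rewrite -[A `|` B]setCK setCU.
apply: ltc_setC; rewrite /ltc_set indicI.
by apply: ltcM; exact: ltc_setC.
Qed.

Lemma sigma_algebra_ltc_set : sigma_algebra setT ltc_set.
Proof.
have l0 : ltc_set set0 by rewrite /ltc_set indic0; exact: ltc_cst.
split => // [A|A hA]; first by rewrite setTD; exact: ltc_setC.
have hU j : ltc_set (\bigcup_(i < j) A i).
  by rewrite bigcup_mkord; elim/big_rec : _ => // i B _; exact: ltc_setU.
apply: (ltc_lim hU) => [j x|x]; first exact: normr_indic_le1.
apply: cvg_near_cst; have [[i _ Aix]|Ax] := pselect ((\bigcup_k A k) x).
  exists i.+1 => // j /= ij; rewrite !indicE !mem_set//; first by exists i.
  by exists i.
apply: nearW => j; rewrite !indicE !memNset// => -[i _ Aix].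
by apply: Ax; exists i.
Qed.

(** The continuous functions t |-> min (1, max (0, 1 + j (t - a))) tend to the
    indicator function of the ray. *)
Lemma ltc_set_ray (i : 'I_n) (a : R) :
  ltc_set ((fun v : 'rV[R]_n => v ord0 i) @^-1` `[a, +oo[%classic).
Proof.
pose c (j : nat) (t : R) := Num.min 1 (Num.max 0 (1 + j%:R * (t - a))).
have cc j : continuous (c j).
  have cl : continuous (fun t : R => 1 + j%:R * (t - a)).
    move=> t; apply: cvgD; first exact: cvg_cst.
    by apply: cvgM; [exact: cvg_cst|apply: cvgB; [exact: cvg_id|exact: cvg_cst]].
  have cmax : continuous (fun t : R => Num.max 0 (1 + j%:R * (t - a))).
    rewrite (_ : (fun _ => _) = fun t : R => ((0 : R) + (1 + j%:R * (t - a)) +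
        `|0 - (1 + j%:R * (t - a))|) / 2); last by apply/funext => t; rewrite maxr_absE.
    move=> t.
    apply: cvgM; last exact: cvg_cst.
    apply: cvgD; first by apply: cvgD; [exact: cvg_cst|exact: cl].
    by apply: cvg_norm; apply: cvgB; [exact: cvg_cst|exact: cl].
  rewrite (_ : c j = fun t : R => ((1 : R) + Num.max 0 (1 + j%:R * (t - a)) -
      `|1 - Num.max 0 (1 + j%:R * (t - a))|) / 2); last first.
    by apply/funext => t; rewrite /c minr_absE.
  move=> t.
  apply: cvgM; last exact: cvg_cst.
  apply: cvgB; first by apply: cvgD; [exact: cvg_cst|exact: cmax].
  by apply: cvg_norm; apply: cvgB; [exact: cvg_cst|exact: cmax].
have c1 j t : `|c j t| <= 1.
  by rewrite ger0_norm /c ?ge_min ?lexx// le_min ler01 le_max lexx.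
apply: (@ltc_lim _ _ (fun j x => c j (x ord0 i)) _ 1).
- by move=> j; exact: (ltc_coord i (cc j) (c1 j)).
- by move=> j x; exact: c1.
move=> x; apply: cvg_near_cst; rewrite indicE; have [ax|xa] := leP a (x ord0 i).
  rewrite mem_set/= ?in_itv/= ?ax//; apply: nearW => j; rewrite /c.
  rewrite max_r ?min_l//; first by rewrite lerDl mulr_ge0// subr_ge0.
  by rewrite addr_ge0// mulr_ge0// subr_ge0.
rewrite memNset/= ?in_itv/= ?andbT; last by apply/negP; rewrite -ltNge.
exists (Num.truncn (a - x ord0 i)^-1).+1 => // j /= Nj; rewrite /c max_l.
  by rewrite min_r.
rewrite -lerBrDl sub0r -opprB mulrN lerN2 -ler_pdivrMr ?subr_gt0// div1r.
by rewrite ltW// (lt_le_trans (truncnS_gt _))// ler_nat.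
Qed.

Lemma ltc_set_coord (i : 'I_n) (Y : set (measurableTypeR R)) : measurable Y ->
  ltc_set ((fun v : 'rV[R]_n => v ord0 i) @^-1` Y).
Proof.
move: Y; suff : (measurable : set (set (measurableTypeR R))) `<=`
    [set Y | ltc_set ((fun v : 'rV[R]_n => v ord0 i) @^-1` Y)] by exact.
rewrite [X in X `<=` _](RGenCInfty.measurableE R); apply: smallest_sub.
  have [s0 sC sU] := sigma_algebra_ltc_set; split.
  - by rewrite /= preimage_set0.
  - by move=> A /= hA; rewrite setTD preimage_setC; exact: ltc_setC.
  - by move=> A /= hA; rewrite preimage_bigcup; exact: sU.
by move=> _ [a ->] /=; exact: ltc_set_ray.
Qed.

(** The sets in the class form a sigma-algebra, which contains the preimages
    of rays by the coordinates, and these generate the measurable sets. *)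
Lemma ltc_measurable_set (A : set 'rV[R]_n) : measurable A -> ltc_set A.
Proof.
move: A; apply: smallest_sub; first exact: sigma_algebra_ltc_set.
rewrite -bigcup_seq => A [i _ [B mB <-]]; rewrite setTI.
exact: ltc_set_coord.
Qed.

Import HBNNSimple.

Lemma ltc_bounded p (M : R) : measurable_fun setT p -> (forall x, `|p x| <= M) -> ltc p.
Proof.
move=> mp pM; rewrite (_ : p = fun x => (p x + M) + - M); last first.
  by apply/funext => x; rewrite addrK.
apply: ltcD; last exact: ltc_cst.
have pM0 x : 0 <= p x + M.
  by have := pM x; rewrite ler_norml => /andP[+ _]; rewrite -subr_ge0 opprK.
have mpM : measurable_fun setT (EFin \o (fun x => p x + M)).
  by apply/measurable_EFinP; apply: measurable_funD => //; exact: measurable_cst.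
pose s := nnsfun_approx measurableT mpM.
have sp x : s j x @[j --> \oo] --> p x + M.
  have /fine_cvgP[_] := @cvg_nnsfun_approx _ _ _ _ measurableT _ mpM
    (fun x _ => pM0 x) x I.
  exact.
apply: (@ltc_lim _ _ (fun j => s j) _ (M + M)) => // [j|j x].
  rewrite (funext (fimfunEord (s j))).
  apply: ltc_sum => y; apply: ltcZ; apply: ltc_measurable_set.
  exact: measurable_sfunP.
rewrite ger0_norm//; have nd : nondecreasing_seq (fun j => s j x).
  by move=> a b ab; have /lefP := nd_nnsfun_approx measurableT mpM ab; exact.
apply: (@le_trans _ _ (p x + M)).
  rewrite -(cvg_lim (@Rhausdorff R) (sp x)).
  by apply: (nondecreasing_cvgn_le nd); apply/cvg_ex; exists (p x + M).
by rewrite lerD2r (le_trans (ler_norm _)).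
Qed.

Lemma translation_cvg_compact p (M N : R) z : measurable_fun setT p ->
  (forall x, `|p x| <= M) -> (forall x, ~ box N x -> p x = 0) ->
  shrinking z ->
  (\int[mu]_x ((p (x + z k) - p x) ^+ 2)%:E @[k --> \oo] --> 0)%E.
Proof.
move=> mp pM p0 zs; have [_ _ /(_ z (N + 1) zs)] := ltc_bounded mp pM.
suff E k : (\int[mu]_x ((p (x + z k)%R - p x) ^+ 2)%:E =
    \int[mu]_(x in box (N + 1)%R) ((p (x + z k)%R - p x) ^+ 2)%:E)%E.
  by under eq_fun do rewrite -E.
rewrite [RHS]integral_mkcond; apply: eq_integral => x _; rewrite /patch.
case: ifPn => // /negP; rewrite inE => xN.
rewrite !p0 ?subrr ?expr0n//; apply: contra_not xN => xN i.
  by rewrite (le_trans (xN i))// lerDl.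
rewrite -[x ord0 i](addrK (z k ord0 i)) (le_trans (ler_normB _ _))// lerD//.
  by have := xN i; rewrite mxE.
exact: shrinking_le1.
Qed.

Lemma le_integral_sqr3 (f g h u : 'rV[R]_n -> R) (a b c : R) :
  measurable_fun setT f -> measurable_fun setT g -> measurable_fun setT h ->
  measurable_fun setT u -> (forall x, u x = f x + g x + h x) ->
  (\int[mu]_x (f x ^+ 2)%:E <= a%:E)%E ->
  (\int[mu]_x (g x ^+ 2)%:E <= b%:E)%E ->
  (\int[mu]_x (h x ^+ 2)%:E <= c%:E)%E ->
  (\int[mu]_x (u x ^+ 2)%:E <= (4 * (a + (b + c)))%:E)%E.
Proof.
move=> mf mg mh m_u uE fa gb hc.
have msq (w : 'rV[R]_n -> R) : measurable_fun setT w -> measurable_fun setT (fun x : 'rV[R]_n => w x ^+ 2 : R).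
  exact: measurable_funX.
have gh : (\int[mu]_x (g x ^+ 2 + h x ^+ 2)%:E <= (b + c)%:E)%E.
  under eq_integral do rewrite EFinD.
  rewrite ge0_integralD//.
  - by rewrite EFinD leeD.
  - by move=> x _; rewrite lee_fin sqr_ge0.
  - by apply/measurable_EFinP; exact: msq.
  - by move=> x _; rewrite lee_fin sqr_ge0.
  - by apply/measurable_EFinP; exact: msq.
rewrite EFinM EFinD; apply: le_trans (lee_wpmul2l _ (leeD fa gh)); last by rewrite lee_fin.
apply: le_integral_lincomb2 => //; try exact: msq.
- by apply: measurable_funD; exact: msq.
- by move=> x _; exact: sqr_ge0.
- by move=> x _; rewrite addr_ge0 ?sqr_ge0.
- by move=> x _; exact: sqr_ge0.
- move=> x _; rewrite uE; have := sqr_ge0 (f x - g x); have := sqr_ge0 (f x - h x).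
  by have := sqr_ge0 (g x - h x); have := sqr_ge0 (f x); nra.
Qed.

Definition truncation p (j : nat) (x : 'rV[R]_n) : R :=
  p x * (\1_(box j%:R) x * \1_[set y | `|p y| <= j%:R] x).

Lemma truncation_cvg p : measurable_fun setT p ->
  (\int[mu]_x (p x ^+ 2)%:E < +oo)%E ->
  let t := truncation p in
  [/\ forall j, measurable_fun setT (t j), forall j x, `|t j x| <= j%:R,
    forall j x, ~ box j%:R x -> t j x = 0 &
    (\int[mu]_x ((t j x - p x) ^+ 2)%:E @[j --> \oo] --> 0)%E].
Proof.
move=> mp poo t.
have mlev (j : nat) : measurable [set y | `|p y| <= j%:R].
  rewrite (_ : mkset _ = p @^-1` `[- j%:R, j%:R]%classic).
    by rewrite -[X in measurable X]setTI; apply: mp.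
  by apply/seteqP; split => x /=; rewrite in_itv/= ler_norml.
have mt j : measurable_fun setT (t j).
  apply: measurable_funM => //; apply: measurable_funM.
    by apply: measurable_indic; exact: measurable_box.
  exact: measurable_indic.
have tp j x : `|t j x| <= `|p x|.
  rewrite normrM ler_piMr// normrM mulr_ile1 ?normr_ge0//; exact: normr_indic_le1.
split => //.
- move=> j x; rewrite /t /truncation; have [pj|pj] := leP `|p x| j%:R.
    exact: le_trans (tp j x) pj.
  rewrite [X in _ * (_ * X)]indicE memNset ?mulr0 ?normr0//=.
  by apply/negP; rewrite -ltNge.
- by move=> j x xj; rewrite /t /truncation indicE memNset// mul0r mulr0.
have [] := @dominated_convergence _ _ R mu setT measurableT
  (fun j x => ((t j x - p x) ^+ 2)%:E) (cst 0%E) (fun x => (4 * (p x ^+ 2))%:E).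
- by move=> j; apply/measurable_EFinP; apply: measurable_funX; exact: measurable_funB.
- exact: measurable_cst.
- apply: aeW => x _; apply: cvg_near_cst.
  have [N xN] := box_exhaust x.
  exists (maxn N (Num.truncn `|p x|).+1) => // j /=; rewrite geq_max => /andP[Nj pj].
  rewrite /t /truncation !indicE !mem_set ?mulr1 ?subrr ?expr0n//=.
    by rewrite ltW// (lt_le_trans (truncnS_gt _))// ler_nat.
  by move=> i; rewrite (le_trans (xN i))// ler_nat.
- under eq_fun do rewrite EFinM; apply: integrableZl => //.
  apply/integrableP; split; first by apply/measurable_EFinP; exact: measurable_funX.
  by under eq_integral do rewrite /= ger0_norm ?sqr_ge0//.
- apply: aeW => x j _; rewrite /= lee_fin ger0_norm ?sqr_ge0//.
  have tp2 : t j x ^+ 2 <= p x ^+ 2.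
    rewrite -real_normK ?num_real// -[leRHS]real_normK ?num_real//.
    by rewrite ler_pXn2r ?nnegrE.
  by have := sqr_ge0 (t j x + p x); nra.
by rewrite integral0.
Qed.

(** Truncations in size and support are bounded with bounded support, and the
    square mean error of the truncation is the same for p and its translates. *)
Lemma translation_cvg_real p z : measurable_fun setT p ->
  (\int[mu]_x (p x ^+ 2)%:E < +oo)%E -> shrinking z ->
  (\int[mu]_x ((p (x + z k) - p x) ^+ 2)%:E @[k --> \oo] --> 0)%E.
Proof.
move=> mp poo zs; have [] := truncation_cvg mp poo.
set t := truncation p => mt tb tsupp tcvg.
have ge0 (f : 'rV[R]_n -> R) : (0 <= \int[mu]_x (f x ^+ 2)%:E)%E.
  by apply: integral_ge0 => x _; rewrite lee_fin sqr_ge0.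
apply/cvge0_small => [k|e e0]; first exact: ge0.
pose e' := e / 12; have e'0 : 0 < e' by rewrite divr_gt0.
have [j _ /(_ j (leqnn j)) /= dj] :=
  iffLR (cvge0_small (fun j => ge0 (fun x => t j x - p x))) tcvg _ e'0.
have cj := translation_cvg_compact (mt j) (tb j) (tsupp j) zs.
have := iffLR (cvge0_small (fun k => ge0 (fun x => t j (x + z k) - t j x))) cj _ e'0.
apply: filterS => k hk.
have -> : e = 4 * (e' + (e' + e')) by rewrite /e'; field.
apply: (@le_integral_sqr3 (fun x => - (t j (x + z k) - p (x + z k)))
  (fun x => t j (x + z k) - t j x) (fun x => t j x - p x)) => //.
- apply: measurableT_comp => //; apply: (measurable_fun_translate _ (p := fun x => t j x - p x)).
  exact: measurable_funB.
- by apply: measurable_funB => //; exact: measurable_fun_translate.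
- exact: measurable_funB.
- by apply: measurable_funB => //; exact: measurable_fun_translate.
- by move=> x; ring.
- under eq_integral do rewrite sqrrN.
  rewrite (ge0_integral_translate (z k) (f := fun x => ((t j x - p x) ^+ 2)%:E))//.
    by apply/measurable_EFinP; apply: measurable_funX; exact: measurable_funB.
  by move=> x; rewrite lee_fin sqr_ge0.
Qed.

End translation_continuity_L2.

(** * Square-integrable complex functions *)

Lemma le_poweR {R : realType} (r : R) (x y : \bar R) :
  0 <= r -> (0 <= x)%E -> (x <= y)%E -> (x `^ r <= y `^ r)%E.
Proof.
move=> r0 x0 xy; apply: gt0_ler_poweR => //.
  by rewrite in_itv/= x0 leey.
by rewrite in_itv/= (le_trans x0 xy) leey.
Qed.

Section energy.
Context d (T : measurableType d) (R : realType) (mu : {measure set T -> \bar R}).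
Implicit Types (f g h : T -> R[i]).
Local Open Scope ereal_scope.

(** The square of the L2 norm: estimates on it involve no square roots. *)
Definition energy f : \bar R := \int[mu]_x (normc (f x) ^+ 2)%:E.

Lemma energy_ge0 f : 0 <= energy f.
Proof. by apply: integral_ge0 => x _; rewrite lee_fin sqr_ge0. Qed.

Lemma measurable_normc_sqr f : cmeas f ->
  measurable_fun setT (fun x => (normc (f x) ^+ 2)%:E).
Proof.
by move=> mf; apply/measurable_EFinP; apply: measurable_funX; exact: measurable_normc.
Qed.

Lemma le_energy f g : cmeas f -> cmeas g ->
  (forall x, normc (f x) <= normc (g x))%R -> energy f <= energy g.
Proof.
move=> mf mg fg; apply: ge0_le_integral => //.
- by move=> x _; rewrite lee_fin sqr_ge0.
- exact: measurable_normc_sqr.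
- exact: measurable_normc_sqr.
- by move=> x _; rewrite lee_fin ler_pXn2r// ?nnegrE ?normc_ge0.
Qed.

Lemma energyZ c f : cmeas f ->
  energy (fun x => c * f x)%R = (normc c ^+ 2)%:E * energy f.
Proof.
move=> mf; rewrite /energy -ge0_integralZl//.
- by apply: eq_integral => x _; rewrite Normc.normcM exprMn EFinM.
- exact: measurable_normc_sqr.
- by move=> x _; rewrite lee_fin sqr_ge0.
- by rewrite lee_fin sqr_ge0.
Qed.

Lemma energy_conj f : energy (fun x => conjc (f x)) = energy f.
Proof. by apply: eq_integral => x _; rewrite normcJ_eq. Qed.

Lemma energyBC f g : energy (fun x => f x - g x)%R = energy (fun x => g x - f x)%R.
Proof. by apply: eq_integral => x _; rewrite normcBC. Qed.

Lemma energy_ReIm f : cmeas f -> energy f =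
  \int[mu]_x (Re (f x) ^+ 2)%:E + \int[mu]_x (Im (f x) ^+ 2)%:E.
Proof.
move=> [re im]; rewrite -ge0_integralD//.
- by apply: eq_integral => x _; rewrite normc_sqr.
- by move=> x _; rewrite lee_fin sqr_ge0.
- by apply/measurable_EFinP; exact: measurable_funX.
- by move=> x _; rewrite lee_fin sqr_ge0.
- by apply/measurable_EFinP; exact: measurable_funX.
Qed.

Lemma energyD_le f g : cmeas f -> cmeas g ->
  energy (fun x => f x + g x)%R <= 2%:E * (energy f + energy g).
Proof.
move=> mf mg.
have m2 h : cmeas h -> measurable_fun setT (fun x => normc (h x) ^+ 2)%R.
  by move=> mh; apply: measurable_funX; exact: measurable_normc.
apply: le_integral_lincomb2 => //; try exact: m2.
- by apply: m2; exact: cmeasD.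
- by move=> x _; exact: sqr_ge0.
- by move=> x _; exact: sqr_ge0.
- by move=> x _; exact: sqr_ge0.
- by move=> x _; rewrite mulrDr sqr_normcD_le.
Qed.

Lemma energyD_lty f g : cmeas f -> cmeas g -> energy f < +oo -> energy g < +oo ->
  energy (fun x => f x + g x)%R < +oo.
Proof.
move=> mf mg foo goo; apply: le_lt_trans (energyD_le mf mg) _.
by rewrite lte_mul_pinfty// ?fin_numElt// lte_add_pinfty.
Qed.

Lemma energyN f : energy (fun x => - f x)%R = energy f.
Proof. by apply: eq_integral => x _; rewrite normcNE. Qed.

Lemma energyB_lty f g : cmeas f -> cmeas g -> energy f < +oo -> energy g < +oo ->
  energy (fun x => f x - g x)%R < +oo.
Proof.
by move=> mf mg foo goo; apply: energyD_lty => //; [exact: cmeasN|rewrite energyN].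
Qed.

Lemma eq_energy f g : f =1 g -> energy f = energy g.
Proof. by move=> /funext ->. Qed.

Definition norm2 f : \bar R := energy f `^ 2^-1.

Lemma norm2_ge0 f : 0 <= norm2 f. Proof. exact: poweR_ge0. Qed.

Lemma norm2E f : norm2 f = Lnorm mu 2%:E (fun x => (normc (f x))%:E).
Proof.
rewrite unlock /norm2 /energy; congr (_ `^ _); apply: eq_integral => x _.
by rewrite /= ger0_norm ?normc_ge0// -powR_mulrn ?normc_ge0.
Qed.

Lemma norm2_sqr f : norm2 f `^ 2 = energy f.
Proof. by rewrite /norm2 -poweRrM mulVf// poweRe1// energy_ge0. Qed.

Lemma norm2_lty f : (norm2 f < +oo) = (energy f < +oo).
Proof.
apply/idP/idP => [foo|]; last exact: poweR_lty.
by rewrite -norm2_sqr poweR_lty.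
Qed.

Lemma le_norm2 f g : energy f <= energy g -> norm2 f <= norm2 g.
Proof. by apply: le_poweR; rewrite ?invr_ge0//; exact: energy_ge0. Qed.

Lemma le_norm2D f g : cmeas f -> cmeas g ->
  norm2 (fun x => f x + g x)%R <= norm2 f + norm2 g.
Proof.
move=> mf mg; rewrite !norm2E.
apply: (@le_trans _ _ (Lnorm mu 2%:E (fun x => (normc (f x) + normc (g x))%R%:E))).
  rewrite -[leLHS]norm2E [leRHS](_ : _ = norm2 (fun x => (normc (f x) + normc (g x))%R%:C)).
    apply: le_norm2; apply: le_energy.
    - exact: cmeasD.
    - by apply: cmeas_real; apply: measurable_funD; exact: measurable_normc.
    - move=> x; rewrite normc_real ger0_norm ?addr_ge0 ?normc_ge0//.
      exact: ler_normcD.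
  rewrite norm2E; apply: eq_Lnorm => x.
  by rewrite normc_real ger0_norm// addr_ge0// normc_ge0.
apply: (@minkowski_EFin _ _ _ mu (fun x => normc (f x)) (fun x => normc (g x))).
- exact: measurable_normc.
- exact: measurable_normc.
- by rewrite ler1n.
Qed.

Lemma norm2_cvg0 (F : nat -> T -> R[i]) :
  norm2 (F k) @[k --> \oo] --> 0 <-> energy (F k) @[k --> \oo] --> 0.
Proof.
split=> /cvge0_small h; apply/cvge0_small.
- by move=> k; exact: energy_ge0.
- move=> e e0; have se0 : (0 < Num.sqrt e)%R by rewrite sqrtr_gt0.
  have := h (fun k => norm2_ge0 _) _ se0; apply: filterS => k hk.
  rewrite -norm2_sqr -(sqr_sqrtr (ltW e0)) -powR_mulrn ?sqrtr_ge0// -poweR_EFin.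
  by apply: le_poweR => //; exact: norm2_ge0.
- by move=> k; exact: norm2_ge0.
- move=> e e0; have e20 : (0 < e ^+ 2)%R by rewrite exprn_gt0.
  have := h (fun k => energy_ge0 _) _ e20; apply: filterS => k hk.
  have -> : e%:E = (e ^+ 2)%:E `^ 2^-1.
    by rewrite poweR_EFin powR12_sqrt ?sqr_ge0// sqrtr_sqr gtr0_norm.
  by apply: le_poweR; rewrite ?invr_ge0//; exact: energy_ge0.
Qed.

(** By the triangle inequality, norms converge along sequences that converge in
    square mean. *)
Lemma norm2_lim_le (k : R) (F G : nat -> T -> R[i]) f g :
  (0 <= k)%R -> cmeas f -> cmeas g -> (forall n, cmeas (F n)) ->
  (forall n, cmeas (G n)) ->
  (forall n, norm2 (F n) <= k%:E * norm2 (G n)) ->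
  energy (fun x => F n x - f x)%R @[n --> \oo] --> 0 ->
  energy (fun x => G n x - g x)%R @[n --> \oo] --> 0 ->
  norm2 f <= k%:E * norm2 g.
Proof.
move=> k0 mf mg mF mG FG /norm2_cvg0 Ff /norm2_cvg0 Gg.
apply/lee_addgt0Pr => e e0.
pose e' := (e / 2)%R; have e'0 : (0 < e')%R by rewrite divr_gt0.
pose e'' := (e' / (k + 1))%R.
have e''0 : (0 < e'')%R by rewrite divr_gt0// ltr_wpDl.
have h1 := iffLR (cvge0_small (fun n => norm2_ge0 _)) Ff _ e'0.
have h2 := iffLR (cvge0_small (fun n => norm2_ge0 _)) Gg _ e''0.
have [n _ /(_ n (leqnn n))[/= Fn Gn]] := filterI h1 h2.
have E1 : norm2 f <= norm2 (F n) + e'%:E.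
  have -> : f = (fun x => F n x + (f x - F n x))%R.
    by apply/funext => x; rewrite addrC subrK.
  apply: le_trans (le_norm2D (mF n) (cmeasB mf (mF n))) _.
  by rewrite leeD// /norm2 energyBC.
have E2 : norm2 (G n) <= norm2 g + e''%:E.
  have -> : G n = (fun x => g x + (G n x - g x))%R.
    by apply/funext => x; rewrite addrC subrK.
  apply: le_trans (le_norm2D mg (cmeasB (mG n) mg)) _.
  by rewrite leeD// /norm2 energyBC energyBC.
apply: (le_trans E1); apply: (@le_trans _ _ (k%:E * (norm2 g + e''%:E) + e'%:E)).
  rewrite leeD// (le_trans (FG n))//.
  by apply: lee_wpmul2l => //; rewrite lee_fin.
rewrite ge0_muleDr ?norm2_ge0//; last by rewrite lee_fin ltW.
rewrite -addeA leeD2l// -EFinM -EFinD lee_fin.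
suff : (k * e'' <= e')%R by rewrite /e'; lra.
rewrite /e'' mulrCA ger_pMr// ler_pdivrMr ?mul1r ?ltr_wpDl//.
by rewrite lerDl.
Qed.

End energy.

Section energy_rV.
Context {R : realType} (n : nat).
Local Notation mu := (@lebesgue_rV R n).
Implicit Types f g : 'rV[R]_n -> R[i].

Lemma in_L1P f : in_L1 f <-> cintegrable mu f.
Proof.
rewrite /in_L1 /cintegrable Lnorm1.
by under eq_integral do rewrite /= (ger0_norm (normc_ge0 _)).
Qed.

Lemma L2normE f : L2norm f = norm2 mu f.
Proof. by rewrite norm2E. Qed.

Lemma in_L2P f : in_L2 f <-> cmeas f /\ (energy mu f < +oo)%E.
Proof. by rewrite /in_L2 L2normE norm2_lty. Qed.

Lemma energy_translate (a : 'rV[R]_n) f : cmeas f ->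
  energy mu (fun x : 'rV[R]_n => f (x + a)) = energy mu f.
Proof.
move=> mf; rewrite /energy.
rewrite (ge0_integral_translate a (f := fun x => (normc (f x) ^+ 2)%:E))//.
  exact: measurable_normc_sqr.
by move=> x; rewrite lee_fin sqr_ge0.
Qed.

Lemma translation_cvg f (z : nat -> 'rV[R]_n) : cmeas f ->
  (energy mu f < +oo)%E -> shrinking z ->
  (energy mu (fun x : 'rV[R]_n => f (x + z k) - f x)%R @[k --> \oo] --> 0)%E.
Proof.
move=> mf foo zs; have [re im] := mf.
have foo' := foo; rewrite energy_ReIm// in foo'.
have ge0 (h : 'rV[R]_n -> R) : (0 <= \int[mu]_x (h x ^+ 2)%:E)%E.
  by apply: integral_ge0 => x _; rewrite lee_fin sqr_ge0.
have reoo : (\int[mu]_x (Re (f x) ^+ 2)%:E < +oo)%E.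
  by apply: le_lt_trans foo'; rewrite leeDl.
have imoo : (\int[mu]_x (Im (f x) ^+ 2)%:E < +oo)%E.
  by apply: le_lt_trans foo'; rewrite leeDr.
have mfz k : cmeas (fun x : 'rV[R]_n => f (x + z k) - f x).
  by apply: cmeasB => //; exact: cmeas_translate.
have A := translation_cvg_real re reoo zs.
have B := translation_cvg_real im imoo zs.
have AB := cvgeD (isT : (0 +? 0)%E) A B; rewrite adde0 in AB.
apply: (cvg_trans _ (AB _)); apply: near_eq_cvg; apply: nearW => k /=; rewrite (energy_ReIm mu (mfz k)).
by congr (_ + _)%E; apply: eq_integral => x _; rewrite ?cReB ?cImB.
Qed.

(** If it failed, each box of radius 1 / (k + 1) would contain a vector
    violating the bound, and these vectors would form a shrinking sequence. *)
Lemma translation_small f (e : R) : cmeas f -> (energy mu f < +oo)%E -> 0 < e ->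
  exists2 r : R, 0 < r & forall z : 'rV[R]_n, box r z ->
    (energy mu (fun x : 'rV[R]_n => f (x + z) - f x)%R <= e%:E)%E.
Proof.
move=> mf foo e0; apply: contrapT => H.
have {}H (k : nat) : exists z : 'rV[R]_n, box k.+1%:R^-1 z /\
    ~ (energy mu (fun x : 'rV[R]_n => f (x + z) - f x)%R <= e%:E)%E.
  apply: contrapT => Hk; apply: H; exists k.+1%:R^-1; first by rewrite invr_gt0.
  by move=> z zk; apply: contrapT => ze; apply: Hk; exists z.
have [z Hz] := choice H.
have zs : shrinking z by move=> k i; case: (Hz k) => + _; exact.
have := iffLR (cvge0_small (fun k => energy_ge0 _ _)) (translation_cvg mf foo zs) _ e0.
by move=> [k _ /(_ k (leqnn k))]; case: (Hz k).
Qed.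

End energy_rV.

(** * The Laplace kernel and its Fourier transform *)

Section one_dimensional_integrals.
Context {R : realType}.
Local Notation leb := (@lebesgue_measure R).
Implicit Types (f F : R -> R) (e w s : R).

Lemma is_derive_continuous F f : (forall x : R, is_derive x (1 : R) F (f x)) -> continuous F.
Proof.
move=> dF x; apply: differentiable_continuous; apply/derivable1_diffP.
by case: (dF x).
Qed.

(** Nonnegativity of f is what allows the integral on a half-line to be
    computed from a primitive. *)
Lemma ge0_even_integral F f l : (forall x, 0 <= f x) -> continuous f ->
  (forall x, f (- x) = f x) -> (forall x : R, is_derive x (1 : R) F (f x)) ->
  F x @[x --> +oo%R] --> l ->
  (\int[leb]_x (f x)%:E = (2 * (l - F 0))%:E)%E.
Proof.
move=> f0 cf fe dF Fl.
rewrite ge0_symfun_integralT//; last by move=> x /=; rewrite fe.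
rewrite -set_itvcy (ge0_continuous_FTC2y (F := F) (l := l))//.
- exact: continuous_subspaceT.
- by apply: cvg_at_right_filter; exact: (is_derive_continuous dF).
- by move=> x _; rewrite derive1E; exact: derive_val.
Qed.

Lemma integral_derive_itv F f (a b : R) : a < b -> continuous f ->
  (forall x : R, is_derive x (1 : R) F (f x)) ->
  (\int[leb]_(x in `[a, b]) (f x)%:E = (F b - F a)%:E)%E.
Proof.
move=> ab cf dF; have cF := is_derive_continuous dF.
rewrite (continuous_FTC2 (F := F))//.
- exact: continuous_subspaceT.
- split => [x _||]; first by case: (dF x).
    by apply: cvg_at_right_filter; exact: cF.
  by apply: cvg_at_left_filter; exact: cF.
- by move=> x _; rewrite derive1E; exact: derive_val.
Qed.

Lemma is_derive_mulr k (x : R) : is_derive x 1 (fun s : R => k * s) k.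
Proof.
have := @is_deriveZ R _ _ id k x 1 1 (is_derive_id x 1).
by rewrite /GRing.scale/= mulr1.
Qed.

Lemma is_derive_comp_mulr (g : R -> R) k (x : R) g' :
  is_derive (k * x) 1 g g' -> is_derive x 1 (fun s : R => g (k * s)) (k * g').
Proof.
move=> dg; rewrite mulrC; exact: (@is_derive1_comp _ g (fun s => k * s) x _ _ dg (is_derive_mulr k x)).
Qed.

Lemma normr_continuous_R : continuous (fun x : R => `|x|).
Proof. by move=> x; apply: cvg_norm; exact: cvg_id. Qed.

Lemma continuous_compR (g f : R -> R) : continuous f -> continuous g ->
  continuous (fun x => g (f x)).
Proof. by move=> cf cg x; apply: continuous_comp; [exact: cf|exact: cg]. Qed.

Lemma continuous_mulr k : continuous (fun s : R => k * s).
Proof. by move=> x; apply: cvgM; [exact: cvg_cst|exact: cvg_id]. Qed.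

Lemma continuous_laplace e : continuous (fun s : R => expR (- e * `|s|)).
Proof.
apply: (continuous_compR _ (@continuous_expR R)).
exact: (continuous_compR normr_continuous_R (@continuous_mulr _)).
Qed.

Lemma cvgy_laplace e : 0 < e -> expR (- e * s) @[s --> +oo%R] --> (0 : R).
Proof.
move=> e0.
have h : e * s @[s --> +oo%R] --> +oo%R by apply: gt0_cvgMry => //; exact: cvg_id.
rewrite (_ : (fun s => expR (- e * s)) = fun s => expR (- (e * s))).
  exact: (cvg_comp _ _ h (@cvgr_expR R)).
by apply/funext => s; rewrite mulNr.
Qed.

Let den e w := e ^+ 2 + w ^+ 2.

Let antider e w (s : R) : R := - e^-1 * expR (- e * s) +
  (den e w)^-1 * (expR (- e * s) * (w * sin (w * s) - e * cos (w * s))).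

Let den_gt0 e w : 0 < e -> 0 < den e w.
Proof. by move=> e0; rewrite /den ltr_wpDr ?sqr_ge0// exprn_gt0. Qed.

Let antider_derive e w (x : R) : 0 < e ->
  is_derive (x : R) (1 : R) (antider e w) (expR (- e * x) * (1 + cos (w * x))).
Proof.
move=> e0; have dn := lt0r_neq0 (den_gt0 w e0).
have dE := is_derive_comp_mulr (is_derive_expR (- e * x)).
have dS := is_derive_comp_mulr (is_derive_sin (w * x)).
have dC := is_derive_comp_mulr (is_derive_cos (w * x)).
have dWS := @is_deriveZ _ _ _ _ w x 1 _ dS.
have dEC := @is_deriveZ _ _ _ _ e x 1 _ dC.
have dT := @is_deriveM _ _ _ _ x 1 _ _ dE (is_deriveB dWS dEC).
have h := is_deriveD (@is_deriveZ _ _ _ _ (- e^-1) x 1 _ dE)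
  (@is_deriveZ _ _ _ _ (den e w)^-1 x 1 _ dT).
apply: (is_derive_eq h); rewrite /GRing.scale/=.
rewrite -[(_ - _ \*: _) x]/(w * sin (w * x) - e * cos (w * x)).
rewrite /den in dn *; field; rewrite dn/=; exact: lt0r_neq0.
Qed.

Let antider_cvg e w : 0 < e -> antider e w s @[s --> +oo%R] --> (0 : R).
Proof.
move=> e0; have E0 := cvgy_laplace e0.
rewrite -[X in _ --> X](addr0 0); apply: cvgD.
  by rewrite -[X in _ --> X](mulr0 (- e^-1)); apply: cvgM => //; exact: cvg_cst.
rewrite -[X in _ --> X](mulr0 (den e w)^-1); apply: cvgM; first exact: cvg_cst.
apply: norm_cvg0; have C0 : expR (- e * s) * (`|w| + e) @[s --> +oo%R] --> (0 : R).
  by rewrite -[X in _ --> X](mul0r (`|w| + e)); apply: cvgM => //; exact: cvg_cst.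
apply: (squeeze_cvgr _ (cvg_cst 0) C0); apply: nearW => s.
rewrite normr_ge0/= normrM ger0_norm ?expR_ge0// ler_wpM2l ?expR_ge0//.
rewrite (le_trans (ler_normB _ _))// !normrM lerD//.
  by apply: ler_piMr => //; rewrite ler_norml sin_geN1 sin_le1.
rewrite (gtr0_norm e0); apply: ler_piMr; first exact: ltW.
by rewrite ler_norml cos_geN1 cos_le1.
Qed.

(** Adding 1 to the cosine makes the integrand nonnegative, so that its
    integral is given by a primitive. *)
Lemma integral_laplace_cos e w : 0 < e ->
  (\int[leb]_s (expR (- e * `|s|) * (1 + cos (w * s)))%:E =
   (2 / e + 2 * e / (e ^+ 2 + w ^+ 2))%:E)%E.
Proof.
move=> e0.
have cc : continuous (fun s => cos (w * s)).
  exact: (continuous_compR (@continuous_mulr _) (@continuous_cos R)).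
rewrite ge0_symfun_integralT.
- rewrite -set_itvcy.
  rewrite [X in (_ * X)%E](_ : _ =
      \int[leb]_(s in `[0%R, +oo[) (expR (- e * s) * (1 + cos (w * s)))%:E)%E; last first.
    apply: eq_integral => s; rewrite inE/= in_itv/= andbT => s0.
    by rewrite ger0_norm.
  rewrite (ge0_continuous_FTC2y (F := antider e w) (l := 0)).
  + rewrite /antider !mulr0 expR0 sin0 cos0 -EFinB -EFinM; congr EFin.
    have dn := lt0r_neq0 (den_gt0 w e0); rewrite /den in dn *.
    by field; rewrite dn/=; exact: lt0r_neq0.
  + move=> s _; rewrite mulr_ge0 ?expR_ge0// -lerBlDl sub0r; exact: cos_geN1.
  + apply: continuous_subspaceT => x; apply: cvgM.
      exact: (continuous_compR (@continuous_mulr _) (@continuous_expR R)).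
    by apply: cvgD; [exact: cvg_cst|exact: cc].
  + exact: antider_cvg.
  + by move=> x _; case: (antider_derive w x e0).
  + apply: cvg_at_right_filter.
    exact: (is_derive_continuous (fun x => antider_derive w x e0)).
  + by move=> x _; have h := antider_derive w x e0; rewrite derive1E; exact: derive_val.
- by move=> s; rewrite mulr_ge0 ?expR_ge0// -lerBlDl sub0r; exact: cos_geN1.
- move=> x; apply: cvgM; first exact: continuous_laplace.
  by apply: cvgD; [exact: cvg_cst|exact: cc].
- by move=> s /=; rewrite normrN mulrN cosN.
Qed.

Lemma integral_laplace e : 0 < e ->
  (\int[leb]_s (expR (- e * `|s|))%:E = (2 / e)%:E)%E.
Proof.
move=> e0; have := integral_laplace_cos 0 e0.
have E s : (expR (- e * `|s|) * (1 + cos (0 * s)))%:E = (2%:E * (expR (- e * `|s|))%:E)%E.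
  by rewrite mul0r cos0 -EFinM mulrC.
under eq_integral do rewrite E.
have mE : measurable_fun setT (fun s : R => expR (- e * `|s|)).
  by apply: continuous_measurable_fun; exact: continuous_laplace.
have E0 s : (0 <= (expR (- e * `|s|))%:E)%E by rewrite lee_fin expR_ge0.
have mE' : measurable_fun setT (fun s : R => (expR (- e * `|s|))%:E).
  exact/measurable_EFinP.
rewrite (_ : (\int[leb]_s (2%:E * (expR (- e * `|s|))%:E) =
    2%:E * \int[leb]_s (expR (- e * `|s|))%:E)%E); last by apply: ge0_integralZl.
have -> : 2 / e + 2 * e / (e ^+ 2 + 0 ^+ 2) = 2 * (2 / e).
  by rewrite expr0n/= addr0; field; exact: lt0r_neq0.
rewrite EFinM; move: (\int[_]_ _ _)%E => [r| |].
- by rewrite -!EFinM => -[] /mulfI -> //.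
- by rewrite mulry gtr0_sg// mul1e.
- by rewrite mulrNy gtr0_sg// mul1e.
Qed.

Lemma integrable_laplace e : 0 < e ->
  leb.-integrable setT (EFin \o (fun s => expR (- e * `|s|))).
Proof.
move=> e0; apply/integrableP; split.
  apply/measurable_EFinP; apply: continuous_measurable_fun.
  exact: continuous_laplace.
under eq_integral do rewrite /= ger0_norm ?expR_ge0//.
by rewrite integral_laplace// ltry.
Qed.

Let laplace_expi e w s : R[i] := (expR (- e * `|s|))%:C * expi (w * s).

Lemma cintegrable_laplace_expi e w : 0 < e -> cintegrable leb (laplace_expi e w).
Proof.
move=> e0; apply: cintegrableM_bounded.
- apply: cmeas_expi; apply: measurable_funM => //; exact: measurable_cst.
- exact/cintegrable_real/integrable_laplace.
- by move=> s; rewrite normc_expi.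
Qed.

Lemma cint_laplace_expi e w : 0 < e ->
  cint leb (laplace_expi e w) = (2 * e / (e ^+ 2 + w ^+ 2))%:C.
Proof.
move=> e0; have Fi := cintegrable_laplace_expi w e0.
have ReE s : Re (laplace_expi e w s) = expR (- e * `|s|) * cos (w * s).
  by rewrite /laplace_expi cReM/= mul0r subr0.
have ImE s : Im (laplace_expi e w s) = expR (- e * `|s|) * sin (w * s).
  by rewrite /laplace_expi cImM/= mul0r addr0.
rewrite /cint; congr (_ +i* _); last first.
  set I := (\int[_]_ _ _)%R; suff : I = - I by lra.
  have Ii := cintegrable_Im Fi.
  have mN : measurable_fun setT (-%R : measurableTypeR R -> measurableTypeR R).
    by apply: continuous_measurable_fun; exact: opp_continuous.
  rewrite -mulN1r -RintegralZl//; rewrite /I /Rintegral; congr fine.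
  transitivity (\int[pushforward leb (-%R : measurableTypeR R -> measurableTypeR R)]_x
      (Im (laplace_expi e w x))%:E)%E.
    apply: (@eq_measure_integral _ _ _ _
      (measure_function_pushforward__canonical__measure_function_Measure leb mN) leb).
    by move=> A mA _; first [exact: lebesgue_measureN|exact/esym/lebesgue_measureN].
  have E s : -1 * Im (laplace_expi e w s) = Im (laplace_expi e w (- s)).
    by rewrite !ImE normrN mulrN sinN mulrN mulN1r.
  under [RHS]eq_integral do rewrite E.
  rewrite (integral_pushforward mN)//.
    by apply/measurable_EFinP; case: Fi => -[].
  have := integrableZl measurableT (-1) Ii.
  by apply: eq_integrable => // s _; rewrite /= -EFinM E.
have -> : 2 * e / (e ^+ 2 + w ^+ 2) = (2 / e + 2 * e / (e ^+ 2 + w ^+ 2)) - 2 / e.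
  by rewrite [RHS]addrC addKr.
have Ei := integrable_laplace e0.
have E : (\int[leb]_s (expR (- e * `|s|) + Re (laplace_expi e w s)))%R =
    2 / e + 2 * e / (e ^+ 2 + w ^+ 2).
  rewrite /Rintegral -[RHS]/(fine (_%:E)) -integral_laplace_cos//; congr fine.
  by apply: eq_integral => s _; rewrite ReE mulrDr mulr1.
rewrite RintegralD// in E; last exact: cintegrable_Re.
rewrite -E; have -> : 2 / e = \int[leb]_s expR (- e * `|s|).
  by rewrite /Rintegral integral_laplace.
by rewrite [RHS]addrC addKr.
Qed.

Definition cauchy e s : R := pi^-1 * (e / (e ^+ 2 + s ^+ 2)).

Lemma cauchy_ge0 e s : 0 < e -> 0 <= cauchy e s.
Proof.
move=> e0; rewrite mulr_ge0 ?invr_ge0 ?pi_ge0// divr_ge0 ?ltW//.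
exact: den_gt0.
Qed.

Lemma cauchy_le e s : 0 < e -> cauchy e s <= pi^-1 * e^-1.
Proof.
move=> e0; rewrite ler_wpM2l ?invr_ge0 ?pi_ge0// ler_pdivrMr; last exact: den_gt0.
rewrite mulrDr expr2 mulKf ?lt0r_neq0// lerDl mulr_ge0 ?sqr_ge0// invr_ge0 ltW//.
Qed.

Lemma cauchyN e s : cauchy e (- s) = cauchy e s.
Proof. by rewrite /cauchy sqrrN. Qed.

Lemma continuous_cauchy e : 0 < e -> continuous (cauchy e).
Proof.
move=> e0 x; apply: cvgM; first exact: cvg_cst.
apply: cvgM; first exact: cvg_cst.
apply: cvgV; first by apply: lt0r_neq0; exact: (den_gt0 x e0).
apply: cvgD; first exact: cvg_cst.
exact: exprn_continuous.
Qed.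

Lemma measurable_cauchy e : 0 < e -> measurable_fun setT (cauchy e).
Proof. by move=> e0; apply: continuous_measurable_fun; exact: continuous_cauchy. Qed.

Lemma cauchy_derive e (x : R) : 0 < e ->
  is_derive x 1 (fun s => pi^-1 * atan (e^-1 * s)) (cauchy e x).
Proof.
move=> e0; have e_neq0 := lt0r_neq0 e0.
have dA := is_derive_comp_mulr (is_derive1_atan (e^-1 * x)).
have h := @is_deriveZ _ _ _ _ pi^-1 x 1 _ dA.
apply: (is_derive_eq h); rewrite /GRing.scale/= /cauchy; congr (_ * _).
have d0 := lt0r_neq0 (den_gt0 x e0); rewrite /den in d0.
have -> : 1 + (e^-1 * x) ^+ 2 = (e ^+ 2 + x ^+ 2) / e ^+ 2 by field.
by field; rewrite d0 e_neq0.
Qed.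

Lemma integral_cauchy e : 0 < e -> (\int[leb]_s (cauchy e s)%:E = 1%:E)%E.
Proof.
move=> e0; have e_neq0 := lt0r_neq0 e0; have pi_neq0 : pi != 0 :> R.
  by rewrite lt0r_neq0// pi_gt0.
have Fl : pi^-1 * atan (e^-1 * s) @[s --> +oo%R] --> pi^-1 * (pi / 2).
  apply: cvgM; first exact: cvg_cst.
  have h : e^-1 * s @[s --> +oo%R] --> +oo%R.
    by apply: gt0_cvgMry; [rewrite invr_gt0|exact: cvg_id].
  exact: (cvg_comp _ _ h (@cvgy_atan R)).
rewrite (ge0_even_integral (fun s => cauchy_ge0 s e0) (continuous_cauchy e0)
  (cauchyN e) (fun x => cauchy_derive x e0) Fl).
by rewrite mulr0 atan0 mulr0 subr0 mulKf// mulfV.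
Qed.

Lemma integral_cauchy_itv e (r : R) : 0 < e -> 0 < r ->
  (\int[leb]_(s in `[(- r)%R, r]) (cauchy e s)%:E = (2 / pi * atan (e^-1 * r))%:E)%E.
Proof.
move=> e0 r0; have rr : - r < r by rewrite gtrN.
rewrite (integral_derive_itv rr (continuous_cauchy e0) (fun x => cauchy_derive x e0)).
by rewrite mulrN atanN; congr EFin; ring.
Qed.

End one_dimensional_integrals.

(** * Damping factors and product Cauchy kernels *)

Section measurable_parametric_integral.
Context d1 d2 (T1 : measurableType d1) (T2 : measurableType d2) (R : realType).
Variable (m2 : {sigma_finite_measure set T2 -> \bar R}).

Let measurable_Rintegral_param (h : T1 * T2 -> R) : measurable_fun setT h ->
  measurable_fun setT (fun x => \int[m2]_y h (x, y)).
Proof.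
move=> mh; have mh' : measurable_fun setT (EFin \o h) by exact/measurable_EFinP.
rewrite /Rintegral; apply: (measurableT_comp (fine_measurable measurableT)) => //.
rewrite (_ : (fun x => _) = fubini_F m2 (EFin \o h)^\+ \- fubini_F m2 (EFin \o h)^\-)%E.
  apply: emeasurable_funB.
    exact: (measurable_fun_fubini_tonelli_F _ (measurable_funepos mh') (funepos_ge0 _)).
  exact: (measurable_fun_fubini_tonelli_F _ (measurable_funeneg mh') (funeneg_ge0 _)).
apply/funext => x; rewrite /fubini_F integralE; congr (_ - _)%E.
  by apply: eq_integral => y _; exact: (congr1 (@^~ y) (funepos_comp (EFin \o h) (pair x))).
by apply: eq_integral => y _; exact: (congr1 (@^~ y) (funeneg_comp (EFin \o h) (pair x))).
Qed.

Lemma cmeas_cint_param (K : T1 * T2 -> R[i]) : cmeas K ->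
  cmeas (fun x => cint m2 (fun y => K (x, y))).
Proof.
move=> [re im]; split; first exact: (measurable_Rintegral_param re).
exact: (measurable_Rintegral_param im).
Qed.

End measurable_parametric_integral.

Section jensen.
Context d (T : measurableType d) (R : realType) (mu : {measure set T -> \bar R}).

(** The square is convex: 2 |I| |h| <= |h|^2 + |I|^2 is integrated against the
    probability density P, with I the mean of h. *)
Lemma normc_cint_density_sqr_le (P : T -> R) (h : T -> R[i]) :
  (forall x, 0 <= P x) -> measurable_fun setT P ->
  (\int[mu]_x (P x)%:E = 1%:E)%E -> cmeas h ->
  cintegrable mu (fun x => (P x)%:C * h x) ->
  ((normc (cint mu (fun x => (P x)%:C * h x)) ^+ 2)%:E <=
   \int[mu]_x (P x * normc (h x) ^+ 2)%:E)%E.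
Proof.
move=> P0 mP P1 mh Phi; set I := normc _.
have mnh := measurable_normc mh.
have mJ : measurable_fun setT (fun x => P x * normc (h x) ^+ 2).
  by apply: measurable_funM => //; exact: measurable_funX.
have J0 : (0 <= \int[mu]_x (P x * normc (h x) ^+ 2)%:E)%E.
  by apply: integral_ge0 => x _; rewrite lee_fin mulr_ge0// sqr_ge0.
have IA : I <= \int[mu]_x (P x * normc (h x)).
  rewrite (le_trans (normc_cint_le Phi))// le_eqVlt; apply/orP; left; apply/eqP.
  by apply: eq_Rintegral => x _; rewrite Normc.normcM normc_real ger0_norm.
have PnE : (\int[mu]_x (P x * normc (h x))%:E)%E =
    (\int[mu]_x (P x * normc (h x)))%:E.
  rewrite /Rintegral fineK// ge0_fin_numE; last first.
    by apply: integral_ge0 => x _; rewrite lee_fin mulr_ge0// normc_ge0.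
  case: Phi => _; under eq_integral do rewrite Normc.normcM normc_real ger0_norm//.
  exact.
have I0 : 0 <= I by exact: normc_ge0.
have : ((2 * I)%:E * \int[mu]_x (P x * normc (h x))%:E <=
    1%:E * (\int[mu]_x (P x * normc (h x) ^+ 2)%:E + \int[mu]_x (I ^+ 2 * P x)%:E))%E.
  rewrite -ge0_integralZl//.
  - under eq_integral do rewrite -EFinM.
    apply: le_integral_lincomb2 => //.
    + by apply: measurable_funM => //; exact: measurable_cst.
    + by apply: measurable_funM; [exact: measurable_cst|exact: measurable_funM].
    + by move=> x _; rewrite mulr_ge0// sqr_ge0.
    + by move=> x _; rewrite mulr_ge0// sqr_ge0.
    + by move=> x _; rewrite !mulr_ge0// normc_ge0.
    + move=> x _; rewrite mul1r (mulrC (I ^+ 2)) -mulrDr mulrCA.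
      by rewrite ler_wpM2l//; have := sqr_ge0 (normc (h x) - I); lra.
  - by apply/measurable_EFinP; exact: measurable_funM.
  - by move=> x _; rewrite lee_fin mulr_ge0// normc_ge0.
  - by rewrite lee_fin mulr_ge0.
have -> : (\int[mu]_x (I ^+ 2 * P x)%:E)%E = (I ^+ 2)%:E.
  under eq_integral do rewrite EFinM.
  rewrite ge0_integralZl//; first by rewrite P1 mule1.
  - exact/measurable_EFinP.
  - by move=> x _; rewrite lee_fin.
  - by rewrite lee_fin sqr_ge0.
rewrite PnE mul1e; move: (\int[mu]_x (P x * normc (h x) ^+ 2)%:E)%E J0 => [r| |] //.
  rewrite -EFinM -EFinD !lee_fin => _ H.
  have II : I * I <= I * \int[mu]_x (P x * normc (h x)) by rewrite ler_wpM2l.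
  by rewrite expr2 in H *; move: (\int[mu]_x _) H II => A H II; lra.
by move=> _ _; exact: leey.
Qed.

End jensen.

Section product_kernels.
Context {R : realType} (n : nat).
Local Notation mu := (@lebesgue_rV R n).
Implicit Types (x y z w xi : 'rV[R]_n) (e r : R).

(** A product of exponentials in the coordinates, chosen rather than a
    Gaussian because its Fourier transform is a product of elementary integrals
    in one variable. *)
Definition damp e x : R := \prod_i expR (- e * `|x ord0 i|).
(** The probability density of independent Cauchy variables; up to a factor
    it is the Fourier transform of [damp e]. *)
Definition pkernel e z : R := \prod_i cauchy e (z ord0 i).

Lemma damp_ge0 e x : 0 <= damp e x.
Proof. by apply: prodr_ge0 => i _; exact: expR_ge0. Qed.

Lemma damp_le1 e x : 0 < e -> damp e x <= 1.
Proof.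
move=> e0; apply: prodr_ile1 => i _; rewrite expR_ge0/= -expR0 ler_expR mulNr oppr_le0.
by rewrite mulr_ge0// ltW.
Qed.

Lemma measurable_damp e : measurable_fun setT (damp e).
Proof.
apply: measurable_prod => i _.
have mE : measurable_fun setT (fun s : measurableTypeR R => expR (- e * `|s|)).
  by apply: continuous_measurable_fun; exact: continuous_laplace.
exact: (measurableT_comp mE (measurable_coord i)).
Qed.

Lemma integrable_damp e : 0 < e -> mu.-integrable setT (EFin \o damp e).
Proof.
move=> e0; apply/integrableP; split.
  by apply/measurable_EFinP; exact: measurable_damp.
under eq_integral do rewrite /= ger0_norm ?damp_ge0//.
have mE : measurable_fun setT (fun s : measurableTypeR R => expR (- e * `|s|)).
  by apply: continuous_measurable_fun; exact: continuous_laplace.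
have E := @integral_prod_coord R n (fun=> fun s => expR (- e * `|s|)) (fun=> 2 / e)
  (fun _ _ => expR_ge0 _) (fun=> mE) (fun=> integral_laplace e0).
by rewrite [X in (X < _)%E]E ltry.
Qed.

Lemma cvg_damp x : damp k.+1%:R^-1 x @[k --> \oo] --> (1 : R).
Proof.
rewrite [X in _ --> X](_ : 1 = \prod_(i < n) (1 : R)); last by rewrite big1_eq.
apply: cvg_big => [|i _]; first exact: mul_continuous.
have h : - k.+1%:R^-1 * `|x ord0 i| @[k --> \oo] --> (0 : R).
  rewrite -[X in _ --> X](mul0r `|x ord0 i|); apply: cvgM; last exact: cvg_cst.
  by rewrite -[X in _ --> X]oppr0; apply: cvgN; exact: cvg_harmonic.
have H : expR (- k.+1%:R^-1 * `|x ord0 i|) @[k --> \oo] --> expR (0 : R).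
  exact: (continuous_cvg _ (@continuous_expR R 0) h).
by rewrite expR0 in H.
Qed.

Lemma pkernel_ge0 e z : 0 < e -> 0 <= pkernel e z.
Proof. by move=> e0; apply: prodr_ge0 => i _; exact: cauchy_ge0. Qed.

Lemma pkernelN e z : pkernel e (- z) = pkernel e z.
Proof. by apply: eq_bigr => i _; rewrite mxE cauchyN. Qed.

Lemma pkernel_le e z : 0 < e -> pkernel e z <= (pi^-1 * e^-1) ^+ n.
Proof.
move=> e0; apply: (@le_trans _ _ (\prod_(i < n) (pi^-1 * e^-1))).
  by apply: ler_prod => i _; rewrite cauchy_ge0// cauchy_le.
by rewrite prodr_const card_ord.
Qed.

Lemma measurable_pkernel e : 0 < e -> measurable_fun setT (pkernel e).
Proof.
move=> e0; apply: measurable_prod => i _.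
exact: (measurableT_comp (measurable_cauchy e0) (measurable_coord i)).
Qed.

Lemma integral_pkernel e : 0 < e -> (\int[mu]_z (pkernel e z)%:E = 1%:E)%E.
Proof.
move=> e0; have E := @integral_prod_coord R n (fun=> cauchy e) (fun=> 1)
  (fun _ s => cauchy_ge0 s e0) (fun=> measurable_cauchy e0) (fun=> integral_cauchy e0).
by rewrite [LHS]E big1_eq.
Qed.

Lemma integrable_pkernel e : 0 < e -> mu.-integrable setT (EFin \o pkernel e).
Proof.
move=> e0; apply/integrableP; split.
  by apply/measurable_EFinP; exact: measurable_pkernel.
under eq_integral do rewrite /= ger0_norm ?pkernel_ge0//.
by rewrite integral_pkernel// ltry.
Qed.

Lemma integral_pkernel_box e r : 0 < e -> 0 < r ->
  (\int[mu]_(z in box r) (pkernel e z)%:E = ((2 / pi * atan (e^-1 * r)) ^+ n)%:E)%E.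
Proof.
move=> e0 r0; rewrite integral_mkcond.
pose h s := cauchy e s * \1_(`[- r, r]%classic) s.
transitivity (\int[mu]_z (\prod_i h (z ord0 i))%:E)%E.
  apply: eq_integral => z _; rewrite big_split/= -indic_box /patch indicE.
  by case: ifPn => _; rewrite ?mulr1 ?mulr0.
rewrite (@integral_prod_coord _ n (fun=> h) (fun=> 2 / pi * atan (e^-1 * r))).
- by rewrite prodr_const card_ord.
- by move=> i s; rewrite mulr_ge0 ?cauchy_ge0// indicE.
- by move=> i; apply: measurable_funM; [exact: measurable_cauchy|exact: measurable_indic].
- move=> i; rewrite -integral_cauchy_itv// [RHS]integral_mkcond.
  apply: eq_integral => s _; rewrite /h /patch indicE.
  by case: ifPn => _; rewrite ?mulr1 ?mulr0.
Qed.

Lemma dotv_expi x w : expi (dotv x w) = \prod_i expi (w ord0 i * x ord0 i).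
Proof.
rewrite /dotv; elim: (index_enum _) => [|i s IH]; first by rewrite !big_nil expi0.
by rewrite !big_cons expiD IH mulrC [in X in _ * X]mulrC mulrC.
Qed.

Lemma cint_damp_expi e w : 0 < e ->
  cint mu (fun xi => (damp e xi)%:C * expi (dotv xi w)) =
  ((2 * pi) ^+ n * pkernel e w)%:C.
Proof.
move=> e0.
pose h (i : 'I_n) (s : R) : R[i] := (expR (- e * `|s|))%:C * expi (w ord0 i * s).
have hi i : cintegrable lebesgue_measure (h i).
  exact: (cintegrable_laplace_expi (w ord0 i) e0).
have [_ hE] := cint_prod_coord hi.
rewrite (@eq_cint _ _ _ _ _ (fun x => \prod_i h i (x ord0 i))); last first.
  by move=> x; rewrite /damp rmorph_prod dotv_expi -big_split.
rewrite hE (eq_bigr (fun i => (2 * pi * cauchy e (w ord0 i))%:C)); last first.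
  move=> i _; rewrite cint_laplace_expi//; congr (_%:C).
  by rewrite /cauchy -!mulrA mulVKf// lt0r_neq0// pi_gt0.
by rewrite -rmorph_prod big_split/= prodr_const card_ord.
Qed.

End product_kernels.

(** * Smoothing by the product Cauchy kernel *)

Section smoothing.
Context {R : realType} (n : nat).
Local Notation mu := (@lebesgue_rV R n).
Local Notation V := 'rV[R]_n.
Implicit Types (f g : V -> R[i]) (e : R).

Lemma dotvC (x y : V) : dotv x y = dotv y x.
Proof. by apply: eq_bigr => i _; rewrite mulrC. Qed.

Lemma dotvDr (x y z : V) : dotv x (y + z) = dotv x y + dotv x z.
Proof. by rewrite -big_split; apply: eq_bigr => i _; rewrite mxE mulrDr. Qed.

Lemma dotvZr c (x y : V) : dotv x (c *: y) = c * dotv x y.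
Proof. by rewrite mulr_sumr; apply: eq_bigr => i _; rewrite mxE mulrCA. Qed.

Lemma dotvNr (x y : V) : dotv x (- y) = - dotv x y.
Proof. by rewrite -scaleN1r dotvZr mulN1r. Qed.

Lemma dotvDl (x y z : V) : dotv (y + z) x = dotv y x + dotv z x.
Proof. by rewrite dotvC dotvDr !(dotvC x). Qed.

Lemma dotvZl c (x y : V) : dotv (c *: x) y = c * dotv x y.
Proof. by rewrite dotvC dotvZr dotvC. Qed.

Lemma measurable_dotv : measurable_fun setT (fun p : V * V => dotv p.1 p.2).
Proof.
apply: measurable_sum => i; apply: measurable_funM.
  exact: (measurableT_comp (measurable_coord i) measurable_fst).
exact: (measurableT_comp (measurable_coord i) measurable_snd).
Qed.

Lemma measurable_dotvr (y : V) : measurable_fun setT (fun x : V => dotv x y).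
Proof.
apply: measurable_sum => i; apply: measurable_funM; first exact: measurable_coord.
exact: measurable_cst.
Qed.

Lemma measurable_dotvl (y : V) : measurable_fun setT (fun x : V => dotv y x).
Proof. by under eq_fun do rewrite dotvC; exact: measurable_dotvr. Qed.

Lemma fourierL1E f (xi : V) :
  fourierL1 f xi = cint mu (fun x => f x * expi (- dotv xi x)).
Proof. by rewrite -[LHS]/(cint mu _); apply: eq_cint => x; rewrite mulrC. Qed.

Lemma cintegrable_fourier_integrand f (xi : V) : cintegrable mu f ->
  cintegrable mu (fun x => f x * expi (- dotv xi x)).
Proof.
move=> fi; apply: cintegrableM_bounded => //; last by move=> x; rewrite normc_expi.
by apply: cmeas_expi; apply: measurableT_comp => //; exact: measurable_dotvl.
Qed.

Lemma cmeas_fourierL1 f : cmeas f -> cmeas (fourierL1 f).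
Proof.
move=> mf; rewrite (funext (fourierL1E f)).
pose K (p : V * V) : R[i] := f p.2 * expi (- dotv p.1 p.2).
apply: (@cmeas_cint_param _ _ _ _ _ mu K); apply: cmeasM.
  by case: mf => re im; split; [exact: (measurableT_comp re measurable_snd)|
    exact: (measurableT_comp im measurable_snd)].
by apply: cmeas_expi; apply: measurableT_comp => //; exact: measurable_dotv.
Qed.

Lemma fourierL1_le f (xi : V) : cintegrable mu f ->
  normc (fourierL1 f xi) <= \int[mu]_x normc (f x).
Proof.
move=> fi; rewrite fourierL1E.
rewrite (le_trans (normc_cint_le (cintegrable_fourier_integrand xi fi)))//.
rewrite le_eqVlt; apply/orP; left; apply/eqP; apply: eq_Rintegral => x _.
by rewrite Normc.normcM normc_expi mulr1.
Qed.

Lemma fourierL1B f g : cintegrable mu f -> cintegrable mu g ->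
  fourierL1 (fun x => f x - g x) = (fun xi => fourierL1 f xi - fourierL1 g xi).
Proof.
move=> fi gi; apply/funext => xi; rewrite !fourierL1E.
under eq_cint do rewrite mulrBl.
by rewrite cintB//; exact: cintegrable_fourier_integrand.
Qed.

(** The convolution of f with the kernel, up to the symmetry of the kernel. *)
Definition smooth e f (x : V) : R[i] :=
  cint mu (fun z => (pkernel e z)%:C * f (x + z)).

Lemma cintegrable_pkernelM e f : 0 < e -> cintegrable mu f ->
  cintegrable mu (fun z => (pkernel e z)%:C * f z).
Proof.
move=> e0 fi; pose M := (pi^-1 * e^-1) ^+ n.
have [mf _] := fi.
apply: (@le_cintegrable _ _ _ _ _ (fun z => M * normc (f z))).
- by apply: cmeasM => //; apply: cmeas_real; exact: measurable_pkernel.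
- exact: (integrableZl measurableT M (cintegrable_normc fi)).
- move=> z; rewrite Normc.normcM normc_real ger0_norm ?pkernel_ge0//.
  by rewrite ler_wpM2r ?normc_ge0// pkernel_le.
Qed.

Lemma cintegrable_smooth_integrand e f (x : V) : 0 < e -> cintegrable mu f ->
  cintegrable mu (fun z : V => (pkernel e z)%:C * f (x + z)).
Proof.
move=> e0 fi; apply: cintegrable_pkernelM => //.
by under eq_fun do rewrite addrC; exact: cintegrable_translate.
Qed.

(** Inserting the integrable factor [damp e] in the Fourier inversion integral
    yields a smoothing of f: exchange the integrals and use that the Fourier
    transform of [damp e] is the kernel. *)
Lemma cint_damp_fourierL1 e f (x : V) : 0 < e -> cintegrable mu f ->
  cint mu (fun xi => (damp e xi)%:C * (expi (dotv x xi) * fourierL1 f xi)) =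
  ((2 * pi) ^+ n)%:C * smooth e f x.
Proof.
move=> e0 fi.
pose k (p : V * V) : R[i] := expi (dotv x p.1 - dotv p.1 p.2).
have mk : cmeas k.
  apply: cmeas_expi; apply: measurable_funB; last exact: measurable_dotv.
  exact: (measurableT_comp (measurable_dotvl x) measurable_fst).
have k1 p : normc (k p) <= 1 by rewrite normc_expi.
have di : cintegrable mu (fun xi : V => (damp e xi)%:C).
  by apply: cintegrable_real; exact: integrable_damp.
transitivity (cint mu (fun xi : V => (damp e xi)%:C *
    cint mu (fun y : V => f y * k (xi, y)))).
  apply: eq_cint => xi; congr (_ * _); rewrite fourierL1E -cintZl.
    by apply: eq_cint => y; rewrite mulrCA /k expiD.
  exact: cintegrable_fourier_integrand.
rewrite (cint_tensor_swap di fi mk k1).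
have mf : cmeas f by case: fi.
have mG : cmeas (fun y : V => f y * ((2 * pi) ^+ n * pkernel e (y - x))%:C).
  apply: cmeasM => //; apply: cmeas_real.
  apply: measurable_funM; first exact: measurable_cst.
  exact: (measurableT_comp (measurable_pkernel e0) (measurable_translate (- x))).
transitivity (cint mu (fun y : V => f y * ((2 * pi) ^+ n * pkernel e (y - x))%:C)).
  apply: eq_cint => y; congr (_ * _).
  rewrite -pkernelN opprB -cint_damp_expi//; apply: eq_cint => xi.
  by rewrite /k /= dotvDr dotvNr (dotvC x).
rewrite -(cint_translate x mG) /smooth -cintZl; last exact: cintegrable_smooth_integrand.
apply: eq_cint => z; rewrite addrK rmorphM/= [in LHS]mulrC -mulrA; congr (_ * (_ * f _)).
by rewrite addrC.
Qed.

Lemma cmeas_smooth e f : 0 < e -> cmeas f -> cmeas (smooth e f).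
Proof.
move=> e0 mf.
pose K (p : V * V) : R[i] := (pkernel e p.2)%:C * f (p.1 + p.2).
apply: (@cmeas_cint_param _ _ _ _ _ mu K); apply: cmeasM.
  apply: cmeas_real; exact: (measurableT_comp (measurable_pkernel e0) measurable_snd).
have mD : measurable_fun setT (fun p : V * V => p.1 + p.2).
  apply: measurable_fun_rVP => i.
  rewrite (_ : (fun p => _) = (fun p : V * V => p.1 ord0 i + p.2 ord0 i)).
    apply: measurable_funD; first exact: (measurableT_comp (measurable_coord i) measurable_fst).
    exact: (measurableT_comp (measurable_coord i) measurable_snd).
  by apply/funext => p; rewrite mxE.
by case: mf => re im; split; [exact: (measurableT_comp re mD)|exact: (measurableT_comp im mD)].
Qed.

Lemma smooth_sub_le e f (x : V) : 0 < e -> cintegrable mu f ->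
  ((normc (smooth e f x - f x) ^+ 2)%:E <=
   \int[mu]_z (pkernel e z * normc (f (z + x)%R - f x) ^+ 2)%:E)%E.
Proof.
move=> e0 fi; have [mf _] := fi.
have ki : cintegrable mu (fun z : V => (pkernel e z)%:C * f x).
  under eq_fun do rewrite mulrC; apply: cintegrableZl.
  by apply: cintegrable_real; exact: integrable_pkernel.
have zi := cintegrable_smooth_integrand x e0 fi.
have E z : (pkernel e z)%:C * (f (z + x) - f x) =
    (pkernel e z)%:C * f (x + z) - (pkernel e z)%:C * f x.
  by rewrite mulrBr (addrC z x).
have -> : smooth e f x - f x = cint mu (fun z : V => (pkernel e z)%:C * (f (z + x) - f x)).
  rewrite (eq_cint _ E) cintB//; congr (_ - _).
  under eq_cint do rewrite mulrC.
  rewrite cintZl; last by apply: cintegrable_real; exact: integrable_pkernel.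
  by rewrite cint_real /Rintegral integral_pkernel//= mulr1.
apply: normc_cint_density_sqr_le.
- by move=> z; exact: pkernel_ge0.
- exact: measurable_pkernel.
- exact: integral_pkernel.
- by apply: cmeasB; [exact: cmeas_translate|exact: cmeas_cst].
- by rewrite (funext E); exact: cintegrableB.
Qed.

(** The smoothing is an average of translates, so that convexity of the
    square bounds its distance to f by the average distance between f and its
    translates. *)
Lemma energy_smooth_sub_le e f : 0 < e -> cintegrable mu f ->
  (energy mu (fun x => smooth e f x - f x)%R <=
   \int[mu]_z ((pkernel e z)%:E * energy mu (fun x : V => f (x + z) - f x)%R))%E.
Proof.
move=> e0 fi; have [mf _] := fi.
pose H (p : V * V) := (pkernel e p.2 * normc (f (p.2 + p.1) - f p.1) ^+ 2)%:E.
have mH : measurable_fun setT H.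
  apply/measurable_EFinP; apply: measurable_funM.
    exact: (measurableT_comp (measurable_pkernel e0) measurable_snd).
  apply: measurable_funX; apply: measurable_normc; apply: cmeasB.
    have mD : measurable_fun setT (fun p : V * V => p.2 + p.1).
      apply: measurable_fun_rVP => i.
      rewrite (_ : (fun p => _) = (fun p : V * V => p.2 ord0 i + p.1 ord0 i)).
        apply: measurable_funD; first exact: (measurableT_comp (measurable_coord i) measurable_snd).
        exact: (measurableT_comp (measurable_coord i) measurable_fst).
      by apply/funext => p; rewrite mxE.
    by case: mf => re im; split; [exact: (measurableT_comp re mD)|exact: (measurableT_comp im mD)].
  by case: mf => re im; split; [exact: (measurableT_comp re measurable_fst)|
    exact: (measurableT_comp im measurable_fst)].
have H0 p : (0 <= H p)%E by rewrite lee_fin mulr_ge0 ?sqr_ge0// pkernel_ge0.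
apply: (@le_trans _ _ (\int[mu]_x \int[mu]_z H (x, z))%E).
  apply: ge0_le_integral => //.
  - by move=> x _; rewrite lee_fin sqr_ge0.
  - by apply: measurable_normc_sqr; apply: cmeasB => //; exact: cmeas_smooth.
  - exact: (measurable_fun_fubini_tonelli_F H mH H0).
  - by move=> x _; exact: smooth_sub_le.
rewrite (@fubini_tonelli _ _ _ _ _ mu mu H)// le_eqVlt; apply/orP; left; apply/eqP.
apply: eq_integral => z _; rewrite /H/= /energy -ge0_integralZl//.
- by apply: eq_integral => x _; rewrite EFinM (addrC z x).
- by apply: measurable_normc_sqr; apply: cmeasB => //; exact: cmeas_translate.
- by move=> x _; rewrite lee_fin sqr_ge0.
- by rewrite lee_fin pkernel_ge0.
Qed.

End smoothing.

Section smoothing_converges.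
Context {R : realType} (n : nat).
Local Notation mu := (@lebesgue_rV R n).
Local Notation V := 'rV[R]_n.

Lemma pkernel_mass_cvg (r : R) : 0 < r ->
  (2 / pi * atan (k.+1%:R^-1^-1 * r)) ^+ n @[k --> \oo] --> (1 : R).
Proof.
move=> r0.
have h : k.+1%:R^-1^-1 * r @[k --> \oo] --> +oo%R.
  apply/cvgryPge => A; exists (Num.truncn (A / r)).+1 => // k /= Ak.
  rewrite invrK -ler_pdivrMr// ltW// (lt_le_trans (truncnS_gt _))//.
  by rewrite ler_nat ltnW.
have a : atan (k.+1%:R^-1^-1 * r) @[k --> \oo] --> (pi / 2 : R).
  exact: (cvg_comp _ _ h (@cvgy_atan R)).
have b : 2 / pi * atan (k.+1%:R^-1^-1 * r) @[k --> \oo] --> (1 : R).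
  rewrite [X in _ --> X](_ : 1 = 2 / pi * (pi / 2) :> R).
    by apply: cvgM => //; exact: cvg_cst.
  by rewrite -mulrA mulKf ?mulfV// lt0r_neq0// pi_gt0.
have c : {for (1 : R), continuous (fun x : R => x ^+ n)} by exact: exprn_continuous.
have H : (2 / pi * atan (k.+1%:R^-1^-1 * r)) ^+ n @[k --> \oo] --> (1 : R) ^+ n.
  exact: (continuous_cvg _ c b).
by rewrite expr1n in H.
Qed.

Lemma integral_pkernel_boxC (e r : R) : 0 < e -> 0 < r ->
  (\int[mu]_(z in ~` box r) (pkernel e z)%:E =
   (1 - (2 / pi * atan (e^-1 * r)) ^+ n)%:E)%E.
Proof.
move=> e0 r0; have mB := @measurable_box R n r.
have mPE : measurable_fun setT (fun z => (@pkernel R n e z)%:E).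
  by apply/measurable_EFinP; exact: measurable_pkernel.
have P0 z : (0 <= (@pkernel R n e z)%:E)%E by rewrite lee_fin pkernel_ge0.
have : (\int[mu]_(z in box r `|` ~` box r) (pkernel e z)%:E = 1%:E)%E.
  by rewrite setUv integral_pkernel.
rewrite ge0_integral_setU//.
- rewrite integral_pkernel_box//.
  case: (\int[_]_(_ in _) _)%E => [t| |] //.
  by rewrite -EFinD => -[ct]; congr EFin; rewrite [RHS]addrC -[LHS](addKr ((2 / pi * atan (e^-1 * r)) ^+ n)) ct.
- exact: measurableC.
- by rewrite setUv.
- exact/disj_setPCl.
Qed.

(** The kernel concentrates at the origin, where translates are close to f;
    away from it, the distance between f and its translates is bounded and
    the mass of the kernel is small. *)
Lemma smooth_cvg (f : V -> R[i]) : cintegrable mu f -> (energy mu f < +oo)%E ->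
  (energy mu (fun x => smooth k.+1%:R^-1 f x - f x)%R @[k --> \oo] --> 0)%E.
Proof.
move=> fi foo; have [mf _] := fi.
apply/cvge0_small => [k|e e0]; first exact: energy_ge0.
pose F := fine (energy mu f).
have FE : energy mu f = F%:E by rewrite fineK// ge0_fin_numE ?energy_ge0.
have F0 : 0 <= F by rewrite fine_ge0// energy_ge0.
have e20 : 0 < e / 2 by rewrite divr_gt0.
have [r r0 rP] := translation_small mf foo e20.
(* |a - b|^2 <= 2 (|a|^2 + |b|^2), and f and its translate have the same
   energy. *)
have TB z : (energy mu (fun x : V => f (x + z) - f x)%R <= (4 * F)%:E)%E.
  have mfz : cmeas (fun x : V => f (x + z)) by exact: cmeas_translate.
  apply: le_trans (energyD_le mu mfz (cmeasN mf)) _.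
  by rewrite energyN energy_translate// FE -EFinD -EFinM lee_fin; lra.
have c1 := pkernel_mass_cvg r0.
have d0 : 4 * F * (1 - (2 / pi * atan (k.+1%:R^-1^-1 * r)) ^+ n) @[k --> \oo] --> (0 : R).
  rewrite -[X in _ --> X](mulr0 (4 * F)); apply: cvgM; first exact: cvg_cst.
  by rewrite -(subrr (1 : R)); apply: cvgB => //; exact: cvg_cst.
have /cvgrPdist_le/(_ _ e20) := d0; apply: filterS => k.
rewrite sub0r normrN => dk; have ek : 0 < k.+1%:R^-1 :> R by rewrite invr_gt0.
apply: le_trans (energy_smooth_sub_le ek fi) _.
have mB := @measurable_box R n r.
have P0 z : 0 <= pkernel k.+1%:R^-1 z by exact: pkernel_ge0.
have mP : measurable_fun setT (@pkernel R n k.+1%:R^-1) by exact: measurable_pkernel.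
have mPI : measurable_fun setT (fun z : V => pkernel k.+1%:R^-1 z * \1_(~` box r) z).
  by apply: measurable_funM => //; apply: measurable_indic; exact: measurableC.
apply: (@le_trans _ _ (\int[mu]_z ((e / 2)%:E * (pkernel k.+1%:R^-1 z)%:E +
    (4 * F)%:E * (pkernel k.+1%:R^-1 z * \1_(~` box r) z)%:E))%E).
  apply: ge0_le_integral => //.
  - by move=> z _; apply: mule_ge0; [rewrite lee_fin; exact: P0|exact: energy_ge0].
  - apply: emeasurable_funM; first exact/measurable_EFinP.
    pose K (p : V * V) := (normc (f (p.2 + p.1) - f p.2) ^+ 2)%:E.
    apply: (measurable_fun_fubini_tonelli_F K); last first.
      by move=> p; rewrite lee_fin sqr_ge0.
    apply: measurable_normc_sqr; apply: cmeasB.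
      have mD : measurable_fun setT (fun p : V * V => p.2 + p.1).
        apply: measurable_fun_rVP => i.
        rewrite (_ : (fun p => _) = (fun p : V * V => p.2 ord0 i + p.1 ord0 i)).
          apply: measurable_funD; first exact: (measurableT_comp (measurable_coord i) measurable_snd).
          exact: (measurableT_comp (measurable_coord i) measurable_fst).
        by apply/funext => p; rewrite mxE.
      by case: mf => re im; split; [exact: (measurableT_comp re mD)|exact: (measurableT_comp im mD)].
    by case: mf => re im; split; [exact: (measurableT_comp re measurable_snd)|
      exact: (measurableT_comp im measurable_snd)].
  - apply: emeasurable_funD; apply: emeasurable_funM; try exact: measurable_cst.
      exact/measurable_EFinP.
    exact/measurable_EFinP.
  - move=> z _; rewrite indicE; have [zr|zr] := boolP (z \in box r).
      rewrite in_setC zr/= mulr0 mule0 adde0 muleC lee_wpmul2r ?lee_fin ?P0//.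
      by apply: rP; exact: set_mem.
    rewrite in_setC zr/= mulr1 muleC.
    apply: (@le_trans _ _ ((4 * F)%:E * (pkernel k.+1%:R^-1 z)%:E)%E).
      by rewrite lee_wpmul2r ?lee_fin ?P0.
    by rewrite leeDr// mule_ge0 ?lee_fin ?P0// ltW.
rewrite ge0_integralD//.
- rewrite ge0_integralZl//; last 3 first.
  + exact/measurable_EFinP.
  + by move=> z _; rewrite lee_fin P0.
  + by rewrite lee_fin ltW.
  rewrite ge0_integralZl//; last 3 first.
  + exact/measurable_EFinP.
  + by move=> z _; rewrite lee_fin mulr_ge0 ?P0// indicE.
  + by rewrite lee_fin mulr_ge0.
  rewrite integral_pkernel// mule1.
  have -> : (\int[mu]_z (pkernel k.+1%:R^-1 z * \1_(~` box r) z)%:E =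
      \int[mu]_(z in ~` box r) (pkernel k.+1%:R^-1 z)%:E)%E.
    rewrite [RHS]integral_mkcond; apply: eq_integral => z _.
    by rewrite indicE /patch; case: ifPn => _; rewrite ?mulr1 ?mulr0.
  rewrite integral_pkernel_boxC// -EFinM -EFinD lee_fin.
  by have := le_trans (ler_norm _) dk; lra.
- by move=> z _; rewrite mule_ge0 ?lee_fin ?P0// ltW.
- by apply: emeasurable_funM; [exact: measurable_cst|exact/measurable_EFinP].
- by move=> z _; rewrite mule_ge0 ?lee_fin ?mulr_ge0 ?P0// indicE.
- by apply: emeasurable_funM; [exact: measurable_cst|exact/measurable_EFinP].
Qed.

End smoothing_converges.

(** * Completeness of the space of square-integrable functions *)

Section riesz_fischer.
Context d (T : measurableType d) (R : realType) (mu : {measure set T -> \bar R}).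

Lemma series_cvgn_bounded (c : nat -> R) M : (forall j, 0 <= c j) ->
  (forall k, \sum_(0 <= j < k) c j <= M) -> cvgn (series c).
Proof.
move=> c0 cM; apply: nondecreasing_is_cvgn.
  by apply: nondecreasing_series => j _ _.
by exists M => _ [k _ <-]; exact: cM.
Qed.

(** If the weighted squares of the increments are summable, then so are the
    increments, by |t| <= 2^-j + 2^j t^2. *)
Lemma cvgn_summable_increments (a c : nat -> R) (M : R) :
  (forall j, `|a j.+1 - a j| <= c j) ->
  (forall k, \sum_(0 <= j < k) (2 ^+ j * c j ^+ 2) <= M) -> cvgn a.
Proof.
move=> ac cM.
have c0 j : 0 <= c j by exact: le_trans (normr_ge0 _) (ac j).
have half : `|2^-1| < 1 :> R by rewrite ger0_norm ?invr_ge0// invf_lt1// ltr1n.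
have cs : cvgn [normed series (telescope a)].
  apply: (@series_cvgn_bounded _ (2 + M)) => [j|k]; first exact: normr_ge0.
  apply: (@le_trans _ _ (\sum_(0 <= j < k) (geometric 1 2^-1 j + 2 ^+ j * c j ^+ 2))).
    apply: ler_sum => j _; rewrite /telescope/=; apply: (le_trans (ac j)).
    rewrite /geometric/= mul1r exprVn; set p : R := 2 ^+ j.
    have p0 : 0 < p by rewrite exprn_gt0.
    rewrite -(ler_pM2l p0) mulrDr mulfV ?lt0r_neq0//.
    by have := sqr_ge0 (p * c j - 1); have := sqr_ge0 (p * c j); nra.
  rewrite big_split lerD//.
  have h := @geometric_le_lim R k 1 2^-1 ler01 _ half.
  apply: le_trans (h _) _; first by rewrite invr_gt0.
  by rewrite mul1r; have -> : (1 - 2^-1)^-1 = 2 :> R by field.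
have /cvg_ex[l tl] := normed_cvg cs.
apply/cvg_ex; exists (a 0%N + l).
have H : (fun k => a 0%N + series (telescope a) k) @ \oo --> a 0%N + l.
  by apply: cvgD => //; exact: cvg_cst.
have E : (fun k => a 0%N + series (telescope a) k) = a.
  by apply/funext => k; rewrite -eq_sum_telescope.
by rewrite E in H.
Qed.

Lemma limn_einf_le (u : nat -> \bar R) (e : \bar R) (N : nat) :
  (forall j, (N <= j)%N -> (u j <= e)%E) -> (limn_einf u <= e)%E.
Proof.
move=> ue; rewrite limn_einf_lim; apply: lime_le; first exact: is_cvg_einfs.
apply: nearW => k; apply: (@le_trans _ _ (u (maxn N k))).
  by apply: ereal_inf_lbound; exists (maxn N k) => //=; exact: leq_maxr.
by apply: ue; exact: leq_maxl.
Qed.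

Lemma measurable_fun_limn_einf (u : nat -> T -> \bar R) :
  (forall j, measurable_fun setT (u j)) ->
  measurable_fun setT (fun x => limn_einf (u ^~ x)).
Proof.
move=> mu_; rewrite (_ : (fun x => _) = fun x => - limn_esup (fun j => - u j x))%E.
  apply: measurableT_comp => //.
  by apply: measurable_fun_limn_esup => j; exact: measurableT_comp.
by apply/funext => x; rewrite limn_esupN oppeK.
Qed.

(** The integral of the series of the weighted squares is at most the sum of
    2^j 4^-j, which is finite. *)
Lemma ae_bounded_weighted_squares (D : nat -> T -> R[i]) :
  (forall j, cmeas (D j)) ->
  (forall j, (energy mu (D j) <= (4^-1 ^+ j)%:E)%E) ->
  {ae mu, forall x, exists M : R,
     forall k, \sum_(0 <= j < k) (2 ^+ j * normc (D j x) ^+ 2) <= M}.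
Proof.
move=> mD De.
pose s j x := (2 ^+ j * normc (D j x) ^+ 2)%:E.
have s0 j x : (0 <= s j x)%E by rewrite lee_fin mulr_ge0 ?sqr_ge0// exprn_ge0.
have ms j : measurable_fun setT (s j).
  apply/measurable_EFinP; apply: measurable_funM; first exact: measurable_cst.
  by apply: measurable_funX; exact: measurable_normc.
pose S x := (\sum_(0 <= j <oo) s j x)%E.
have mS : measurable_fun setT S.
  by apply: (ge0_emeasurable_sum (P := xpredT)) => // j x _ _; exact: s0.
have S0 x : (0 <= S x)%E by exact: nneseries_ge0.
have IS : (\int[mu]_x S x < +oo)%E.
  rewrite integral_nneseries//; apply: (@le_lt_trans _ _ (2 : R)%:E); last by rewrite ltry.
  apply: lime_le.
    by apply: is_cvg_nneseries => j _ _; exact: integral_ge0.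
  apply: nearW => k; apply: (@le_trans _ _ (\sum_(0 <= j < k) (geometric 1 2^-1 j)%:E)%E).
    apply: lee_sum => j _; rewrite /s; under eq_integral do rewrite EFinM.
    rewrite ge0_integralZl//.
    - rewrite -[X in (_ * X)%E]/(energy mu (D j)).
      apply: le_trans (lee_wpmul2l _ (De j)) _; first by rewrite lee_fin exprn_ge0.
      rewrite -EFinM lee_fin /geometric/= mul1r -exprMn le_eqVlt; apply/orP; left.
      by apply/eqP; congr (_ ^+ _); field.
    - exact: measurable_normc_sqr.
    - by move=> x _; rewrite lee_fin sqr_ge0.
  rewrite sumEFin lee_fin.
  have half : `|2^-1| < 1 :> R by rewrite ger0_norm ?invr_ge0// invf_lt1// ltr1n.
  have h := @geometric_le_lim R k 1 2^-1 ler01 _ half.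
  apply: le_trans (h _) _; first by rewrite invr_gt0.
  by rewrite mul1r; have -> : (1 - 2^-1)^-1 = 2 :> R by field.
have Si : mu.-integrable setT S.
  by apply/integrableP; split => //; under eq_integral do rewrite gee0_abs//.
apply: filterS (integrable_ae measurableT Si) => x /(_ I) Sx.
exists (fine (S x)) => k; rewrite -lee_fin fineK// -sumEFin.
by apply: nneseries_lim_ge => j _ _; exact: s0.
Qed.

(** A subsequence with increments of energy at most 4^-j converges almost
    everywhere, and the lemma of Fatou turns the Cauchy condition into
    convergence in square mean. *)
Theorem riesz_fischer (F : nat -> T -> R[i]) :
  (forall k, cmeas (F k)) ->
  (forall e : R, 0 < e -> exists N, forall m k, (N <= m)%N -> (N <= k)%N ->
     (energy mu (fun x => F m x - F k x)%R <= e%:E)%E) ->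
  exists2 g, cmeas g & (energy mu (fun x => F k x - g x)%R @[k --> \oo] --> 0)%E.
Proof.
move=> mF FC.
have /choice[N NP] (j : nat) : exists Nj, forall m k, (Nj <= m)%N -> (Nj <= k)%N ->
    (energy mu (fun x => F m x - F k x)%R <= (4^-1 ^+ j)%:E)%E.
  by apply: FC; rewrite exprn_gt0// invr_gt0.
(* From phi j on, the bounds of index at most j hold together. *)
pose phi j := (\max_(i < j.+1) N i)%N.
have Nphi i j : (i <= j)%N -> (N i <= phi j)%N.
  by move=> ij; exact: (leq_bigmax (Ordinal (ij : (i < j.+1)%N))).
pose G j := F (phi j).
have mG j : cmeas (G j) by exact: mF.
pose D j x := G j.+1 x - G j x.
have mD j : cmeas (D j) by exact: cmeasB.
have De j : (energy mu (D j) <= (4^-1 ^+ j)%:E)%E.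
  by apply: NP; apply: Nphi.
(* The upper limit is measurable and equals the limit wherever it exists. *)
pose g x : R[i] := fine (limn_esup (fun j => (Re (G j x))%:E)) +i*
                   fine (limn_esup (fun j => (Im (G j x))%:E)).
have mg : cmeas g.
  split; apply: (measurableT_comp (fine_measurable measurableT));
    apply: measurable_fun_limn_esup => j; apply/measurable_EFinP; by case: (mG j).
have Gg : {ae mu, forall x, (fun j => Re (G j x)) @ \oo --> Re (g x) /\
                            (fun j => Im (G j x)) @ \oo --> Im (g x)}.
  apply: filterS (ae_bounded_weighted_squares mD De) => x [M DM].
  have cR : cvgn (fun j => Re (G j x)).
    apply: (@cvgn_summable_increments _ (fun j => normc (D j x)) M) => // j.
    by rewrite -cReB; exact: Re_le_normc.
  have cI : cvgn (fun j => Im (G j x)).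
    apply: (@cvgn_summable_increments _ (fun j => normc (D j x)) M) => // j.
    by rewrite -cImB; exact: Im_le_normc.
  have lim_fine (a : nat -> R) : cvgn a -> a @ \oo --> fine (limn_esup (EFin \o a)).
    move=> /cvg_ex[l al].
    have /cvg_limn_einf_sup[_ ->] : EFin \o a @ \oo --> l%:E.
      by apply: cvg_EFin; [exact: nearW|exact: al].
    exact: al.
  by split; apply: lim_fine.
exists g => //; apply/cvge0_small => [k|e e0]; first exact: energy_ge0.
have [j je] : exists j, 4^-1 ^+ j <= e.
  have /cvgrPdist_le/(_ _ e0)[j _ /(_ j (leqnn j))] := @cvg_geometric R 1 4^-1
    (ltac:(by rewrite ger0_norm ?invr_ge0// invf_lt1// ltr1n)).
  rewrite sub0r normrN /geometric/= mul1r => h; exists j.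
  exact: le_trans (ler_norm _) h.
exists (N j) => // m /= Nm.
pose u i x := (normc (F m x - G i x) ^+ 2)%:E.
have mu_ i : measurable_fun setT (u i) by apply: measurable_normc_sqr; exact: cmeasB.
apply: (@le_trans _ _ (\int[mu]_x limn_einf (u ^~ x))%E).
  rewrite le_eqVlt; apply/orP; left; apply/eqP; apply: ge0_ae_eq_integral => //.
  - by apply: measurable_normc_sqr; exact: cmeasB.
  - exact: measurable_fun_limn_einf.
  - by move=> x _; rewrite lee_fin sqr_ge0.
  - move=> x _; rewrite limn_einf_lim; apply: lime_ge; first exact: is_cvg_einfs.
    by apply: nearW => i; apply: le_ereal_inf_tmp => _ [k _ <-]; rewrite lee_fin sqr_ge0.
  - apply: filterS Gg => x [gr gi] _.
    suff /cvg_limn_einf_sup[-> _] : u ^~ x @ \oo --> (normc (F m x - g x) ^+ 2)%:E by [].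
    apply: cvg_EFin; first exact: nearW.
    rewrite normc_sqr; rewrite (_ : fine \o _ = fun i =>
      (Re (F m x) - Re (G i x)) ^+ 2 + (Im (F m x) - Im (G i x)) ^+ 2); last first.
      by apply/funext => i; rewrite /u/= normc_sqr cReB cImB.
    rewrite cReB cImB; under eq_fun do rewrite !expr2; rewrite !expr2.
    by apply: cvgD; apply: cvgM; apply: cvgB => //; exact: cvg_cst.
apply: (le_trans (fatou mu measurableT mu_ _)).
  by move=> i x _; rewrite lee_fin sqr_ge0.
apply: (@limn_einf_le _ _ j) => i ji; apply: (@le_trans _ _ (4^-1 ^+ j)%:E).
  by apply: NP => //; exact: Nphi.
by rewrite lee_fin.
Qed.

End riesz_fischer.

(** * The Plancherel theorem *)

Section plancherel_L1.
Context {R : realType} (n : nat).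
Local Notation mu := (@lebesgue_rV R n).
Local Notation V := 'rV[R]_n.
Implicit Types (f g : V -> R[i]).

Lemma normc_cint_mul_le f g : cmeas f -> cmeas g ->
  cintegrable mu (fun x => f x * g x) ->
  ((normc (cint mu (fun x => f x * g x)))%:E <= norm2 mu f * norm2 mu g)%E.
Proof.
move=> mf mg fgi.
have H := @hoelder _ _ R mu (fun x => normc (f x)) (fun x => normc (g x)) 2 2
  (measurable_normc mf) (measurable_normc mg).
have h2 : 2^-1 + 2^-1 = 1 :> R by field.
have {H} := H (ltr0n _ 2) (ltr0n _ 2) h2.
rewrite -!norm2E; apply: le_trans; rewrite Lnorm1.
have -> : (\int[mu]_x `|((fun x => normc (f x)) \* (fun x => normc (g x)))%R x|%:E =
    \int[mu]_x (normc (f x * g x))%:E)%E.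
  apply: eq_integral => x _ /=.
  by rewrite ger0_norm ?mulr_ge0 ?normc_ge0// Normc.normcM.
rewrite -[leRHS]fineK; first by rewrite lee_fin; exact: normc_cint_le.
rewrite ge0_fin_numE; first by case: fgi.
by apply: integral_ge0 => x _; rewrite lee_fin normc_ge0.
Qed.

Lemma cintegrable_normc_sqr f : cmeas f -> (energy mu f < +oo)%E ->
  mu.-integrable setT (EFin \o (fun x => normc (f x) ^+ 2)).
Proof.
move=> mf foo; apply/integrableP; split; first exact: measurable_normc_sqr.
by under eq_integral do rewrite /= ger0_norm ?sqr_ge0//.
Qed.

Lemma cintegrable_damp_fourierL1 e f : 0 < e -> cintegrable mu f ->
  cintegrable mu (fun xi => (damp e xi)%:C * fourierL1 f xi).
Proof.
move=> e0 fi; pose M := \int[mu]_x normc (f x).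
apply: (@le_cintegrable _ _ _ _ _ (fun x => M * damp e x)).
- apply: cmeasM; first by apply: cmeas_real; exact: measurable_damp.
  by apply: cmeas_fourierL1; case: fi.
- exact: (integrableZl measurableT M (integrable_damp _ e0)).
- move=> x; rewrite Normc.normcM normc_real ger0_norm ?damp_ge0// mulrC.
  by rewrite ler_wpM2r ?damp_ge0// fourierL1_le.
Qed.

Lemma smooth_le e f (x : V) : 0 < e -> cintegrable mu f ->
  normc (smooth e f x) <= (pi^-1 * e^-1) ^+ n * \int[mu]_y normc (f y).
Proof.
move=> e0 fi; have [mf _] := fi.
have zi := cintegrable_smooth_integrand x e0 fi.
rewrite (le_trans (normc_cint_le zi))//.
have Ci : cintegrable mu (fun z : V => f (z + x)) by exact: cintegrable_translate.
have -> : \int[mu]_y normc (f y) = \int[mu]_z normc (f (z + x)).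
  rewrite /Rintegral -(integral_translate x (f := fun z => (normc (f z))%:E))//.
  by apply/measurable_EFinP; exact: measurable_normc.
rewrite -RintegralZl//; last exact: cintegrable_normc.
apply: le_Rintegral => //.
- exact: cintegrable_normc.
- exact: (integrableZl measurableT _ (cintegrable_normc Ci)).
- move=> z _; rewrite Normc.normcM normc_real ger0_norm ?pkernel_ge0// addrC.
  by rewrite ler_wpM2r ?normc_ge0// pkernel_le.
Qed.

Lemma cintegrable_conj_smooth e f : 0 < e -> cintegrable mu f ->
  cintegrable mu (fun x => conjc (f x) * smooth e f x).
Proof.
move=> e0 fi; have [mf _] := fi.
pose M := (pi^-1 * e^-1) ^+ n * \int[mu]_y normc (f y).
apply: (@le_cintegrable _ _ _ _ _ (fun x => M * normc (f x))).
- by apply: cmeasM; [exact: cmeas_conj|exact: cmeas_smooth].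
- exact: (integrableZl measurableT _ (cintegrable_normc fi)).
- move=> x; rewrite Normc.normcM normcJ_eq mulrC.
  by rewrite ler_wpM2r ?normc_ge0// smooth_le.
Qed.

(** Write |f^|^2 as the product of f^ and of a conjugate integral and exchange
    the integrals: the damped inverse transform of f^ appears, and this is the
    smoothing of f. *)
Lemma damped_energy e f : 0 < e -> cintegrable mu f ->
  (\int[mu]_xi (damp e xi * normc (fourierL1 f xi) ^+ 2))%:C =
  ((2 * pi) ^+ n)%:C * cint mu (fun x => conjc (f x) * smooth e f x).
Proof.
move=> e0 fi; have [mf _] := fi.
have cfi := cintegrable_conj fi.
have ai := cintegrable_damp_fourierL1 e0 fi.
pose k (p : V * V) : R[i] := expi (dotv p.1 p.2).
have mk : cmeas k by apply: cmeas_expi; exact: measurable_dotv.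
have k1 p : normc (k p) <= 1 by rewrite normc_expi.
rewrite -cint_real.
transitivity (cint mu (fun xi : V => (damp e xi)%:C * fourierL1 f xi *
    cint mu (fun x : V => conjc (f x) * k (xi, x)))).
  apply: eq_cint => xi.
  have -> : cint mu (fun x : V => conjc (f x) * k (xi, x)) = conjc (fourierL1 f xi).
    rewrite fourierL1E -cint_conj; last exact: cintegrable_fourier_integrand.
    by apply: eq_cint => x; rewrite conjcM -expiN opprK.
  by rewrite -mulrA [_ * conjc _]mulrC mulJc_normc rmorphM.
rewrite (cint_tensor_swap ai cfi mk k1).
rewrite -cintZl; last exact: cintegrable_conj_smooth.
apply: eq_cint => x; rewrite [RHS]mulrCA -cint_damp_fourierL1//.
congr (_ * _); apply: eq_cint => xi; rewrite -mulrA; congr (_ * _).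
by rewrite mulrC /k dotvC.
Qed.

Lemma damp_nondecreasing (x : V) :
  {homo (fun k : nat => damp k.+1%:R^-1 x : R) : i j / (i <= j)%N >-> i <= j}.
Proof.
move=> i j ij; apply: ler_prod => l _; rewrite expR_ge0/= ler_expR.
rewrite ler_wpM2r// lerN2 lef_pV2 ?posrE//.
by rewrite ler_nat.
Qed.

Lemma cint_conj_smooth_cvg f : cintegrable mu f -> (energy mu f < +oo)%E ->
  (normc (cint mu (fun x => conjc (f x) * smooth k.+1%:R^-1 f x) -
     (fine (energy mu f))%:C))%:E @[k --> \oo] --> 0%E.
Proof.
move=> fi foo; have [mf _] := fi.
have E0 (k : nat) : 0 < k.+1%:R^-1 :> R by rewrite invr_gt0.
have ffi : cintegrable mu (fun x => conjc (f x) * f x).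
  rewrite (funext (fun x => mulJc_normc (f x))).
  by apply: cintegrable_real; exact: cintegrable_normc_sqr.
have ffE : cint mu (fun x => conjc (f x) * f x) = (fine (energy mu f))%:C.
  by rewrite (eq_cint _ (fun x => mulJc_normc (f x))) cint_real.
have mw k : cmeas (fun x => smooth k.+1%:R^-1 f x - f x).
  by apply: cmeasB => //; exact: cmeas_smooth.
have W := (norm2_cvg0 _ _).2 (smooth_cvg fi foo).
pose N := fine (norm2 mu f).
have NE : norm2 mu f = N%:E.
  by rewrite fineK// ge0_fin_numE ?norm2_ge0// norm2_lty.
apply: (@cvge0_squeeze _ _ (fun k => N%:E * norm2 mu (fun x => smooth k.+1%:R^-1 f x - f x)%R)%E).
- by move=> k; rewrite lee_fin normc_ge0.
- move=> k; rewrite -ffE -cintB//; last exact: cintegrable_conj_smooth.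
  rewrite (eq_cint _ (fun x => esym (mulrBr (conjc (f x)) (smooth k.+1%:R^-1 f x) (f x)))).
  have -> : N%:E = norm2 mu (fun x => conjc (f x)) by rewrite -NE /norm2 energy_conj.
  apply: normc_cint_mul_le => //; first exact: cmeas_conj.
  under eq_fun do rewrite mulrBr.
  by apply: cintegrableB => //; exact: cintegrable_conj_smooth.
- rewrite -[X in _ --> X](mule0 N%:E); exact: cvgeZl.
Qed.

(** As e decreases to 0, the damped energy of the transform increases to its
    energy, while the scalar product of f with its smoothing tends to the
    energy of f. *)
Theorem plancherel_L1 f : cintegrable mu f -> (energy mu f < +oo)%E ->
  energy mu (fourierL1 f) = (((2 * pi) ^+ n)%:E * energy mu f)%E.
Proof.
move=> fi foo; have [mf _] := fi.
have mh : cmeas (fourierL1 f) by exact: cmeas_fourierL1.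
have E0 (k : nat) : 0 < k.+1%:R^-1 :> R by rewrite invr_gt0.
pose c : R := (2 * pi) ^+ n.
pose F := fine (energy mu f).
have FE : energy mu f = F%:E by rewrite fineK// ge0_fin_numE ?energy_ge0.
pose I (k : nat) := \int[mu]_xi (damp k.+1%:R^-1 xi * normc (fourierL1 f xi) ^+ 2).
have Icvg : I k @[k --> \oo] --> c * F.
  apply/cvgrPdist_le => e e0.
  have c0 : 0 < c by rewrite exprn_gt0// mulr_gt0// pi_gt0.
  have ec0 : 0 < e / c by rewrite divr_gt0.
  have := iffLR (cvge0_small (fun k => normc_ge0 _ : (0 <= (normc _)%:E)%E))
    (cint_conj_smooth_cvg fi foo) _ ec0.
  apply: filterS => k; rewrite lee_fin => hk.
  have EI : (I k)%:C = c%:C * cint mu (fun x => conjc (f x) * smooth k.+1%:R^-1 f x).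
    exact: damped_energy.
  have EcI : (c * F - I k)%:C =
      c%:C * (F%:C - cint mu (fun x => conjc (f x) * smooth k.+1%:R^-1 f x)).
    rewrite mulrBr -EI; apply: complex_ext; rewrite ?cReB ?cReM ?cImB ?cImM/=.
      by rewrite !mul0r subr0.
    by rewrite !mulr0 mul0r !addr0 subr0.
  rewrite -[leLHS]normc_real EcI.
  rewrite Normc.normcM normc_real (ger0_norm (ltW c0)) normcBC.
  by rewrite -ler_pdivlMl// mulrC.
have mI (k : nat) : measurable_fun setT
    (fun xi => (damp k.+1%:R^-1 xi * normc (fourierL1 f xi) ^+ 2)%:E).
  apply/measurable_EFinP; apply: measurable_funM; first exact: measurable_damp.
  by apply: measurable_funX; exact: measurable_normc.
have IE (k : nat) : (\int[mu]_xi (damp k.+1%:R^-1 xi * normc (fourierL1 f xi) ^+ 2)%:E)%E =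
    (I k)%:E.
  rewrite /I /Rintegral fineK// ge0_fin_numE; last first.
    by apply: integral_ge0 => x _; rewrite lee_fin mulr_ge0 ?damp_ge0// sqr_ge0.
  have ai := cintegrable_damp_fourierL1 (E0 k) fi.
  pose M := \int[mu]_x normc (f x).
  have := integrableZl measurableT M (cintegrable_normc ai).
  move=> /integrableP[mA]; apply: le_lt_trans; apply: ge0_le_integral => //.
  - by move=> x _; rewrite lee_fin mulr_ge0 ?damp_ge0// sqr_ge0.
  - exact: measurableT_comp.
  - move=> x _; rewrite -[leRHS]/((`|M * normc ((damp k.+1%:R^-1 x)%:C * fourierL1 f x)|)%:E) lee_fin.
    rewrite (le_trans _ (ler_norm _))// Normc.normcM normc_real ger0_norm ?damp_ge0//.
    rewrite [leRHS]mulrCA ler_wpM2l ?damp_ge0// expr2 ler_wpM2r ?normc_ge0//.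
    exact: fourierL1_le.
pose D (k : nat) xi := (damp k.+1%:R^-1 xi * normc (fourierL1 f xi) ^+ 2)%:E.
have D0 k x : setT x -> (0 <= D k x)%E.
  by move=> _; rewrite lee_fin mulr_ge0 ?damp_ge0// sqr_ge0.
have nd x : setT x -> {homo D^~ x : i j / (i <= j)%N >-> (i <= j)%E}.
  move=> _ i j ij; rewrite lee_fin ler_wpM2r ?sqr_ge0//.
  exact: damp_nondecreasing.
have Dcvg := cvg_monotone_convergence measurableT mI D0 nd.
rewrite FE -[RHS]/((c * F)%:E) /energy.
have -> : (\int[mu]_xi (normc (fourierL1 f xi) ^+ 2)%:E = \int[mu]_xi limn (D ^~ xi))%E.
  apply: eq_integral => xi _; apply/esym/cvg_lim => //.
  apply: cvg_EFin; first exact: nearW.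
  rewrite -[X in _ --> X]mul1r; apply: cvgM; last exact: cvg_cst.
  exact: cvg_damp.
rewrite -(cvg_lim (@ereal_hausdorff R) (Dcvg mu)); apply/cvg_lim => //.
rewrite (_ : (fun k => _) = (fun k => (I k)%:E)); last by apply/funext => k; exact: IE.
by apply: cvg_EFin; [exact: nearW|exact: Icvg].
Qed.

End plancherel_L1.

(** * The Fourier transform of square-integrable functions *)

Section energy_limits.
Context d (T : measurableType d) (R : realType) (mu : {measure set T -> \bar R}).
Implicit Types (F G : nat -> T -> R[i]) (f g : T -> R[i]).

Lemma energy_cvg0D F G : (forall k, cmeas (F k)) -> (forall k, cmeas (G k)) ->
  (energy mu (F k) @[k --> \oo] --> 0)%E -> (energy mu (G k) @[k --> \oo] --> 0)%E ->
  (energy mu (fun x => F k x + G k x)%R @[k --> \oo] --> 0)%E.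
Proof.
move=> mF mG F0 G0.
apply: (@cvge0_squeeze _ _ (fun k => 2%:E * (energy mu (F k) + energy mu (G k)))%E).
- by move=> k; exact: energy_ge0.
- by move=> k; exact: energyD_le.
- rewrite -[X in _ --> X](mule0 2%:E); apply: cvgeZl => //.
  by rewrite -[X in _ --> X](adde0 0%E); apply: cvgeD.
Qed.

Lemma energy_cvg_trans F G f : (forall k, cmeas (F k)) -> (forall k, cmeas (G k)) ->
  cmeas f ->
  (energy mu (fun x => F k x - G k x)%R @[k --> \oo] --> 0)%E ->
  (energy mu (fun x => G k x - f x)%R @[k --> \oo] --> 0)%E ->
  (energy mu (fun x => F k x - f x)%R @[k --> \oo] --> 0)%E.
Proof.
move=> mF mG mf FG Gf.
have E k : (fun x => F k x - f x) = (fun x => (F k x - G k x) + (G k x - f x)).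
  by apply/funext => x; rewrite addrA subrK.
rewrite (_ : (fun k => _) = (fun k => energy mu (fun x => (F k x - G k x) + (G k x - f x))%R)).
  by apply: energy_cvg0D => // k; exact: cmeasB.
by apply/funext => k; rewrite E.
Qed.

Lemma energy_cvg_cauchy F f : (forall k, cmeas (F k)) -> cmeas f ->
  (energy mu (fun x => F k x - f x)%R @[k --> \oo] --> 0)%E ->
  forall e : R, 0 < e -> exists N, forall m k, (N <= m)%N -> (N <= k)%N ->
     (energy mu (fun x => F m x - F k x)%R <= e%:E)%E.
Proof.
move=> mF mf Ff e e0; have e40 : 0 < e / 4 by rewrite divr_gt0.
have [N _ NP] := iffLR (cvge0_small (fun k => energy_ge0 _ _)) Ff _ e40.
exists N => m k Nm Nk.
have -> : (fun x => F m x - F k x) = (fun x => (F m x - f x) + (f x - F k x)).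
  by apply/funext => x; rewrite addrA subrK.
apply: le_trans (energyD_le _ (cmeasB (mF m) mf) (cmeasB mf (mF k))) _.
have := leeD (NP m Nm) (NP k Nk); rewrite /= (energyBC mu f) => h.
apply: le_trans (lee_wpmul2l _ h) _; first by rewrite lee_fin.
by rewrite -EFinD -EFinM lee_fin; lra.
Qed.

Lemma energy_lim_lty F f : (forall k, cmeas (F k)) -> cmeas f ->
  (forall k, (energy mu (F k) < +oo)%E) ->
  (energy mu (fun x => F k x - f x)%R @[k --> \oo] --> 0)%E ->
  (energy mu f < +oo)%E.
Proof.
move=> mF mf Foo Ff.
have [N _ /(_ N (leqnn N))/= h] :=
  iffLR (cvge0_small (fun k => energy_ge0 _ _)) Ff 1 ltr01.
have -> : f = (fun x => F N x - (F N x - f x)).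
  by apply/funext => x; rewrite opprB addrC subrK.
apply: energyB_lty => //; first exact: cmeasB.
by apply: le_lt_trans h _; rewrite ltry.
Qed.

Lemma energy_dominated_cvg F f : (forall k, cmeas (F k)) -> cmeas f ->
  (energy mu f < +oo)%E ->
  (forall k x, normc (F k x - f x) <= normc (f x)) ->
  (forall x, normc (F k x - f x) @[k --> \oo] --> (0 : R)) ->
  (energy mu (fun x => F k x - f x)%R @[k --> \oo] --> 0)%E.
Proof.
move=> mF mf foo dom cvg.
have mD k : cmeas (fun x => F k x - f x) by exact: cmeasB.
have [] := @dominated_convergence _ T R mu setT measurableT
  (fun k x => (normc (F k x - f x) ^+ 2)%:E) (cst 0%E) (fun x => (normc (f x) ^+ 2)%:E).
- by move=> k; exact: measurable_normc_sqr.
- exact: measurable_cst.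
- apply: aeW => x _; apply: cvg_EFin; first exact: nearW.
  rewrite -[X in _ --> X](mulr0 (0 : R)); exact: (cvgM (cvg x) (cvg x)).
- apply/integrableP; split; first exact: measurable_normc_sqr.
  by under eq_integral do rewrite /= ger0_norm ?sqr_ge0//.
- apply: aeW => x k _; rewrite /= lee_fin ger0_norm ?sqr_ge0//.
  by rewrite ler_pXn2r ?nnegrE ?normc_ge0.
by rewrite integral0.
Qed.

End energy_limits.

Section fourier_L2.
Context {R : realType} (n : nat).
Local Notation mu := (@lebesgue_rV R n).
Local Notation V := 'rV[R]_n.
Implicit Types (f g u : V -> R[i]).

Let twopi : R := (2 * pi) ^+ n.

Let twopi_gt0 : 0 < twopi.
Proof. by rewrite exprn_gt0// mulr_gt0// pi_gt0. Qed.

Lemma is_fourierP f g : is_fourier f g <->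
  [/\ cmeas f /\ (energy mu f < +oo)%E, cmeas g /\ (energy mu g < +oo)%E &
   exists F : nat -> V -> R[i],
   [/\ forall k, cintegrable mu (F k) /\ (energy mu (F k) < +oo)%E,
       (energy mu (fun x => F k x - f x)%R @[k --> \oo] --> 0)%E &
       (energy mu (fun x => fourierL1 (F k) x - g x)%R @[k --> \oo] --> 0)%E]].
Proof.
have N2 (H : nat -> V -> R[i]) (h : V -> R[i]) : (L2norm (H k \- h)%R @[k --> \oo] --> 0)%E <->
    (energy mu (fun x => H k x - h x)%R @[k --> \oo] --> 0)%E.
  rewrite -norm2_cvg0; under eq_fun do rewrite L2normE; exact: iff_refl.
split=> [[/in_L2P fL /in_L2P gL [F [FL Ff Fg]]]|[fL gL [F [FL Ff Fg]]]].
  split => //; exists F; split; [|exact/N2|exact/N2].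
  by move=> k; have [/in_L1P ? /in_L2P[]] := FL k.
split; [exact/in_L2P|exact/in_L2P|exists F; split; [|exact/N2|exact/N2]].
by move=> k; have [Fi Foo] := FL k; split; [exact/in_L1P|apply/in_L2P; split => //; case: Fi].
Qed.

Definition boxed f (k : nat) (x : V) : R[i] := f x * (\1_(box k%:R) x)%:C.

Lemma boxed_or0 f k x : boxed f k x = f x \/ boxed f k x = 0.
Proof.
by rewrite /boxed indicE; case: (x \in _); [left; rewrite mulr1|right; rewrite mulr0].
Qed.

Lemma boxed_le f k x : normc (boxed f k x) <= normc (f x).
Proof. by case: (boxed_or0 f k x) => ->//; rewrite Normc.normc0 normc_ge0. Qed.

Lemma cmeas_boxed f k : cmeas f -> cmeas (boxed f k).
Proof.
move=> mf; apply: cmeasM => //; apply: cmeas_real.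
by apply: measurable_indic; exact: measurable_box.
Qed.

Lemma energy_boxed_lty f k : cmeas f -> (energy mu f < +oo)%E ->
  (energy mu (boxed f k) < +oo)%E.
Proof.
move=> mf; apply: le_lt_trans; apply: le_energy => //; first exact: cmeas_boxed.
by move=> x; exact: boxed_le.
Qed.

(** On a box, |f| <= |f|^2 + 1 is integrable. *)
Lemma cintegrable_boxed f k : cmeas f -> (energy mu f < +oo)%E ->
  cintegrable mu (boxed f k).
Proof.
move=> mf foo.
apply: (@le_cintegrable _ _ _ _ _ (fun x => normc (f x) ^+ 2 + \1_(box k%:R) x)).
- exact: cmeas_boxed.
- have bi : mu.-integrable setT (EFin \o (\1_(@box R n k%:R))).
    apply/integrableP; split.
      by apply/measurable_EFinP; apply: measurable_indic; exact: measurable_box.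
    under eq_integral do rewrite /= ger0_norm//.
    rewrite integral_indic ?setIT//; last exact: measurable_box.
    exact: lebesgue_box_lty.
  exact: (integrableD _ (cintegrable_normc_sqr mf foo) bi).
- move=> x; rewrite /boxed indicE; case: (x \in _).
    rewrite mulr1 -[true%:R]/(1 : R).
    by have := sqr_ge0 (normc (f x) - 1); have := sqr_ge0 (normc (f x)); nra.
  by rewrite mulr0 Normc.normc0 addr0 sqr_ge0.
Qed.

Lemma boxed_cvg f : cmeas f -> (energy mu f < +oo)%E ->
  (energy mu (fun x => boxed f k x - f x)%R @[k --> \oo] --> 0)%E.
Proof.
move=> mf foo; apply: energy_dominated_cvg => //.
- by move=> k; exact: cmeas_boxed.
- move=> k x; case: (boxed_or0 f k x) => ->.
    by rewrite subrr Normc.normc0 normc_ge0.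
  by rewrite sub0r normcNE.
- move=> x; apply: cvg_near_cst; have [N xN] := box_exhaust x.
  exists N => // k /= Nk; rewrite /boxed indicE mem_set/=.
    by rewrite mulr1 subrr Normc.normc0.
  by move=> i; rewrite (le_trans (xN i))// ler_nat.
Qed.

(** Truncations of f to boxes are integrable, and their transforms form a
    Cauchy sequence by the Plancherel identity. *)
Theorem is_fourier_exists f : in_L2 f -> exists g, is_fourier f g.
Proof.
move=> /in_L2P[mf foo]; pose F := boxed f.
have Fi k : cintegrable mu (F k) by exact: cintegrable_boxed.
have Foo k : (energy mu (F k) < +oo)%E by exact: energy_boxed_lty.
have mF k : cmeas (F k) by exact: cmeas_boxed.
have Ff := boxed_cvg mf foo.
have mH k : cmeas (fourierL1 (F k)) by exact: cmeas_fourierL1.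
have [|g mg Hg] := @riesz_fischer _ _ R mu (fun k => fourierL1 (F k)) mH.
  move=> e e0; have e'0 : 0 < e / twopi by rewrite divr_gt0.
  have [N NP] := energy_cvg_cauchy mF mf Ff e'0; exists N => m k Nm Nk.
  rewrite -[X in energy mu X](fourierL1B (Fi m) (Fi k)) plancherel_L1.
  - apply: le_trans (lee_wpmul2l _ (NP m k Nm Nk)) _; first by rewrite lee_fin ltW.
    by rewrite -EFinM mulrC divfK ?lt0r_neq0.
  - exact: cintegrableB.
  - exact: energyB_lty.
exists g; apply/is_fourierP; split => //.
  split => //; apply: (energy_lim_lty mH mg _ Hg) => k.
  by rewrite plancherel_L1// lte_mul_pinfty// lee_fin ltW.
by exists F.
Qed.

(** The Plancherel identity passes to the limit along the sequence that
    witnesses the transform, whichever it is. Hence it holds for every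
    function chosen as a transform of f. *)
Theorem is_fourier_energy f g : is_fourier f g ->
  energy mu g = (twopi%:E * energy mu f)%E.
Proof.
move=> /is_fourierP[[mf foo] [mg goo] [F [FL Ff Fg]]].
have mF k : cmeas (F k) by case: (FL k) => -[].
have mH k : cmeas (fourierL1 (F k)) by exact: cmeas_fourierL1.
pose c := Num.sqrt twopi; have c0 : 0 < c by rewrite sqrtr_gt0.
have NE k : norm2 mu (fourierL1 (F k)) = (c%:E * norm2 mu (F k))%E.
  rewrite /norm2 plancherel_L1; [|by case: (FL k)|by case: (FL k)].
  rewrite poweRM ?energy_ge0//; last by rewrite lee_fin ltW.
  by rewrite poweR_EFin powR12_sqrt// ltW.
have h1 : (norm2 mu g <= c%:E * norm2 mu f)%E.
  by apply: (norm2_lim_le (ltW c0) mg mf mH mF _ Fg Ff) => k; rewrite NE.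
have h2 : (norm2 mu f <= c^-1%:E * norm2 mu g)%E.
  apply: (norm2_lim_le _ mf mg mF mH _ Ff Fg); first by rewrite invr_ge0 ltW.
  by move=> k; rewrite NE muleA -EFinM mulVf ?lt0r_neq0// mul1e.
have h3 : norm2 mu g = (c%:E * norm2 mu f)%E.
  apply/eqP; rewrite eq_le h1/=.
  have := lee_wpmul2l (_ : 0 <= c%:E)%E h2; rewrite lee_fin => /(_ (ltW c0)).
  by rewrite muleA -EFinM mulfV ?lt0r_neq0// mul1e.
rewrite -norm2_sqr h3 poweRM ?norm2_ge0//; last by rewrite lee_fin ltW.
by rewrite norm2_sqr poweR_EFin powR_mulrn ?ltW// sqr_sqrtr// ltW.
Qed.

(** Conjugation turns the inversion integral into a direct transform. *)
Lemma fourierL1_damp e f (xi : V) : 0 < e -> cintegrable mu f ->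
  fourierL1 (fun x => (damp e x)%:C *
    (twopi^-1%:C * conjc (fourierL1 (fun y => conjc (f y)) x))) xi =
  conjc (smooth e (fun y => conjc (f y)) xi).
Proof.
move=> e0 fi; have cfi := cintegrable_conj fi.
have di := cintegrable_damp_fourierL1 e0 cfi.
set H := fourierL1 (fun y => conjc (f y)) in di *.
have Ki : cintegrable mu (fun x => (damp e x)%:C * (expi (dotv xi x) * H x)).
  rewrite (_ : (fun x => _) = (fun x => (damp e x)%:C * H x * expi (dotv xi x))).
    apply: cintegrableM_bounded => //; last by move=> x; rewrite normc_expi.
    by apply: cmeas_expi; exact: measurable_dotvl.
  by apply/funext => x; rewrite -mulrA [_ * H x]mulrC.
rewrite fourierL1E.
transitivity (cint mu (fun x => twopi^-1%:C *
    conjc ((damp e x)%:C * (expi (dotv xi x) * H x)))).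
  apply: eq_cint => x; rewrite !conjcM conjc_real -expiN.
  by rewrite mulrCA -!mulrA; congr (_ * (_ * _)); rewrite mulrC.
rewrite cintZl; last exact: cintegrable_conj.
rewrite cint_conj// cint_damp_fourierL1// conjcM conjc_real mulrA.
have -> : twopi^-1%:C * ((2 * pi) ^+ n)%:C = 1 :> R[i].
  by rewrite -rmorphM/= mulVf ?lt0r_neq0.
by rewrite mul1r.
Qed.

(** The inverse transform of a truncation of g is the limit of its damped
    versions, which are integrable, and whose Fourier transforms are smoothings
    of the truncation. *)
Theorem is_fourier_surjective g : in_L2 g -> exists u, is_fourier u g.
Proof.
move=> /in_L2P[mg goo]; pose G := boxed g.
have Gi k : cintegrable mu (G k) by exact: cintegrable_boxed.
have Goo k : (energy mu (G k) < +oo)%E by exact: energy_boxed_lty.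
have mG k : cmeas (G k) by exact: cmeas_boxed.
have Gg := boxed_cvg mg goo.
pose Gc k x := conjc (G k x).
have Gci k : cintegrable mu (Gc k) by exact: cintegrable_conj.
have mGc k : cmeas (Gc k) by exact: cmeas_conj.
have Gcoo k : (energy mu (Gc k) < +oo)%E by rewrite /Gc energy_conj.
pose U k x := twopi^-1%:C * conjc (fourierL1 (Gc k) x).
have mU k : cmeas (U k).
  by apply: cmeasM; [exact: cmeas_cst|apply: cmeas_conj; exact: cmeas_fourierL1].
have ntp : normc (twopi^-1%:C : R[i]) = twopi^-1.
  by rewrite normc_real ger0_norm// invr_ge0 ltW.
have UE (h : V -> R[i]) : cintegrable mu h -> (energy mu h < +oo)%E ->
    energy mu (fun x => twopi^-1%:C * conjc (fourierL1 h x)) = (twopi^-1%:E * energy mu h)%E.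
  move=> hi hoo; have mh : cmeas h by case: hi.
  rewrite energyZ; last by apply: cmeas_conj; exact: cmeas_fourierL1.
  rewrite energy_conj plancherel_L1// muleA -EFinM ntp; congr (_%:E * _)%E.
  by rewrite -/twopi expr2 -mulrA mulVf ?mulr1// lt0r_neq0.
have Uoo k : (energy mu (U k) < +oo)%E.
  by rewrite /U UE// lte_mul_pinfty// lee_fin invr_ge0 ltW.
have [|u mu_ Uu] := @riesz_fischer _ _ R mu U mU.
  move=> e e0; have e'0 : 0 < e * twopi by rewrite mulr_gt0.
  have [N NP] := energy_cvg_cauchy mG mg Gg e'0; exists N => m k Nm Nk.
  have -> : (fun x => U m x - U k x) =
      (fun x => twopi^-1%:C * conjc (fourierL1 (fun y => Gc m y - Gc k y) x)).
    by apply/funext => x; rewrite /U -mulrBr fourierL1B// rmorphB.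
  rewrite UE; [|exact: cintegrableB|exact: energyB_lty].
  have -> : energy mu (fun y => Gc m y - Gc k y) = energy mu (fun y => G m y - G k y).
    by rewrite -energy_conj; apply: eq_energy => x; rewrite /Gc rmorphB/= !conjcK.
  apply: le_trans (lee_wpmul2l _ (NP m k Nm Nk)) _; first by rewrite lee_fin invr_ge0 ltW.
  by rewrite -EFinM mulrC mulfK ?lt0r_neq0.
pose F k (j : nat) x := (damp j.+1%:R^-1 x)%:C * U k x.
have E0 (j : nat) : 0 < j.+1%:R^-1 :> R by rewrite invr_gt0.
have mF k j : cmeas (F k j).
  by apply: cmeasM => //; apply: cmeas_real; exact: measurable_damp.
have Fi k j : cintegrable mu (F k j).
  pose M := twopi^-1 * \int[mu]_x normc (Gc k x).
  apply: (@le_cintegrable _ _ _ _ _ (fun x => M * damp j.+1%:R^-1 x)) => //.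
    exact: (integrableZl measurableT M (integrable_damp _ (E0 j))).
  move=> x; rewrite Normc.normcM normc_real ger0_norm ?damp_ge0// mulrC.
  rewrite ler_wpM2r ?damp_ge0// Normc.normcM normcJ_eq ntp.
  by apply: ler_wpM2l; [rewrite invr_ge0 ltW|exact: fourierL1_le].
have Foo k j : (energy mu (F k j) < +oo)%E.
  apply: le_lt_trans (Uoo k); apply: le_energy => // x.
  rewrite Normc.normcM normc_real ger0_norm ?damp_ge0//.
  by rewrite ler_piMl ?normc_ge0// damp_le1.
have FU k : (energy mu (fun x => F k j x - U k x)%R @[j --> \oo] --> 0)%E.
  have FUE j x : normc (F k j x - U k x) = (1 - damp j.+1%:R^-1 x) * normc (U k x).
    have -> : F k j x - U k x = (damp j.+1%:R^-1 x - 1)%:C * U k x.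
      by rewrite rmorphB mulrBl mul1r.
    by rewrite Normc.normcM normc_real distrC ger0_norm// subr_ge0 damp_le1.
  apply: energy_dominated_cvg => //.
  - move=> j x; rewrite FUE ler_piMl ?normc_ge0// gerBl; exact: damp_ge0.
  - move=> x; rewrite (_ : (fun j => _) =
      (fun j : nat => (1 - damp j.+1%:R^-1 x) * normc (U k x))); last first.
      by apply/funext => j; exact: FUE.
    rewrite -[X in _ --> X](mul0r (normc (U k x))); apply: cvgM; last exact: cvg_cst.
    by rewrite -(subrr (1 : R)); apply: cvgB; [exact: cvg_cst|exact: cvg_damp].
have FG k : (energy mu (fun x => fourierL1 (F k j) x - G k x)%R @[j --> \oo] --> 0)%E.
  have := smooth_cvg (Gci k) (Gcoo k).
  rewrite (_ : (fun j => _) = (fun j => energy mu (fun x => fourierL1 (F k j) x - G k x)%R))//.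
  apply/funext => j; rewrite -energy_conj; apply: eq_energy => x.
  by rewrite rmorphB/= conjcK fourierL1_damp.
(* The strength of the damping is chosen for each truncation so that a single
   sequence has both required limits. *)
have /choice[j jP] (k : nat) : exists j,
    (energy mu (fun x => F k j x - U k x)%R <= (k.+1%:R^-1)%:E)%E /\
    (energy mu (fun x => fourierL1 (F k j) x - G k x)%R <= (k.+1%:R^-1)%:E)%E.
  have h1 := iffLR (cvge0_small (fun k => energy_ge0 _ _)) (FU k) _ (E0 k).
  have h2 := iffLR (cvge0_small (fun k => energy_ge0 _ _)) (FG k) _ (E0 k).
  by have [j _ /(_ j (leqnn j))[]] := filterI h1 h2; exists j.
have harm : ((k.+1%:R^-1 : R)%:E @[k --> \oo] --> 0)%E.
  by apply: cvg_EFin; [exact: nearW|exact: cvg_harmonic].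
exists u; apply/is_fourierP; split => //.
  by split => //; exact: (energy_lim_lty mU mu_ Uoo Uu).
exists (fun k => F k (j k)); split => //.
- apply: (energy_cvg_trans _ mU mu_ _ Uu) => //.
  apply: (cvge0_squeeze _ _ harm) => k; first exact: energy_ge0.
  by case: (jP k).
- apply: (energy_cvg_trans _ mG mg _ Gg) => [k|]; first exact: cmeas_fourierL1.
  apply: (cvge0_squeeze _ _ harm) => k; first exact: energy_ge0.
  by case: (jP k).
Qed.

End fourier_L2.

(** * Fourier representation of differences *)

Section differences.
Context {R : realType} (n : nat).
Local Notation mu := (@lebesgue_rV R n).
Local Notation V := 'rV[R]_n.
Implicit Types (f g u : V -> R[i]) (y xi : V) (m : R).

Let twopi : R := (2 * pi) ^+ n.

Let twopi_gt0 : 0 < twopi.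
Proof. by rewrite exprn_gt0// mulr_gt0// pi_gt0. Qed.

Lemma fourierL1_translate f (a xi : V) : cintegrable mu f ->
  fourierL1 (fun x : V => f (x + a)) xi = expi (dotv xi a) * fourierL1 f xi.
Proof.
move=> fi; have [mf _] := fi; rewrite !fourierL1E -cintZl; last first.
  exact: cintegrable_fourier_integrand.
have mG : cmeas (fun x : V => expi (dotv xi a) * (f x * expi (- dotv xi x))).
  apply: cmeasM; first exact: cmeas_cst.
  by case: (cintegrable_fourier_integrand xi fi).
rewrite -(cint_translate a mG); apply: eq_cint => x.
by rewrite mulrCA -expiD dotvDr opprD addrCA subrr addr0.
Qed.

Lemma fourierL1_lincomb f g c (xi : V) : cintegrable mu f -> cintegrable mu g ->
  fourierL1 (fun x => f x + c * g x) xi = fourierL1 f xi + c * fourierL1 g xi.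
Proof.
move=> fi gi; rewrite !fourierL1E -cintZl; last exact: cintegrable_fourier_integrand.
rewrite -cintD; last 2 first.
- exact: cintegrable_fourier_integrand.
- by apply: cintegrableZl; exact: cintegrable_fourier_integrand.
by apply: eq_cint => x; rewrite mulrDl mulrA.
Qed.

Lemma energy_bounded_mul (k f : V -> R[i]) (M : R) : cmeas k -> cmeas f ->
  0 <= M -> (forall x, normc (k x) <= M) ->
  (energy mu (fun x => k x * f x)%R <= (M ^+ 2)%:E * energy mu f)%E.
Proof.
move=> mk mf M0 kM; have -> : M ^+ 2 = normc (M%:C : R[i]) ^+ 2.
  by rewrite normc_real ger0_norm.
rewrite -energyZ//; apply: le_energy; first exact: cmeasM.
  by apply: cmeasM => //; exact: cmeas_cst.
move=> x; rewrite !Normc.normcM normc_real ger0_norm//.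
by rewrite ler_wpM2r ?normc_ge0.
Qed.

Lemma energy_bounded_mul_lty (k f : V -> R[i]) (M : R) : cmeas k -> cmeas f ->
  0 <= M -> (forall x, normc (k x) <= M) -> (energy mu f < +oo)%E ->
  (energy mu (fun x => k x * f x)%R < +oo)%E.
Proof.
move=> mk mf M0 kM foo; apply: le_lt_trans (energy_bounded_mul mk mf M0 kM) _.
by rewrite lte_mul_pinfty// lee_fin sqr_ge0.
Qed.

Lemma energy_bounded_mul_cvg (k : V -> R[i]) (F : nat -> V -> R[i]) (M : R) :
  cmeas k -> (forall j, cmeas (F j)) -> 0 <= M -> (forall x, normc (k x) <= M) ->
  (energy mu (F j) @[j --> \oo] --> 0)%E ->
  (energy mu (fun x => k x * F j x)%R @[j --> \oo] --> 0)%E.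
Proof.
move=> mk mF M0 kM F0.
apply: (@cvge0_squeeze _ _ (fun j => (M ^+ 2)%:E * energy mu (F j))%E).
- by move=> j; exact: energy_ge0.
- by move=> j; exact: energy_bounded_mul.
- by rewrite -[X in _ --> X](mule0 (M ^+ 2)%:E); exact: cvgeZl.
Qed.

Lemma cmeas_expi_dotv (a : V) : cmeas (fun xi : V => expi (dotv xi a)).
Proof. by apply: cmeas_expi; exact: measurable_dotvr. Qed.

Lemma is_fourier_lincomb_translate f g u v c (a : V) :
  is_fourier f g -> is_fourier u v ->
  is_fourier (fun x : V => f x + c * u (x + a))
             (fun xi => g xi + c * (expi (dotv xi a) * v xi)).
Proof.
move=> /is_fourierP[[mf foo] [mg goo] [F [FL Ff Fg]]].
move=> /is_fourierP[[mu_ uoo] [mv voo] [U [UL Uu Uv]]].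
have mF k : cmeas (F k) by case: (FL k) => -[].
have mU k : cmeas (U k) by case: (UL k) => -[].
have mc : cmeas (fun _ : V => c : R[i]) by exact: cmeas_cst.
have mua (h : V -> R[i]) : cmeas h -> cmeas (fun x : V => h (x + a)).
  exact: cmeas_translate.
have nc (x : V) : normc c <= normc c by [].
have ncE (x : V) : normc (expi (dotv x a)) <= 1 by rewrite normc_expi.
have mE := cmeas_expi_dotv a.
have Z0 := normc_ge0 c.
apply/is_fourierP; split.
- split; first by apply: cmeasD => //; apply: cmeasM => //; exact: mua.
  apply: energyD_lty => //; first by apply: cmeasM => //; exact: mua.
  apply: (energy_bounded_mul_lty mc (mua _ mu_) Z0 nc).
  by rewrite energy_translate.
- split; first by apply: cmeasD => //; apply: cmeasM => //; exact: cmeasM.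
  apply: energyD_lty => //; first by apply: cmeasM => //; exact: cmeasM.
  apply: (energy_bounded_mul_lty mc (cmeasM mE mv) Z0 nc).
  exact: (energy_bounded_mul_lty mE mv ler01 ncE).
exists (fun k (x : V) => F k x + c * U k (x + a)); split.
- move=> k; have [[Fi Foo] [Ui Uoo]] := (FL k, UL k); split.
    by apply: cintegrableD => //; apply: cintegrableZl; exact: cintegrable_translate.
  apply: energyD_lty => //; first by apply: cmeasM => //; exact: mua.
  apply: (energy_bounded_mul_lty mc (mua _ (mU k)) Z0 nc).
  by rewrite energy_translate.
- have E k : (fun x : V => F k x + c * U k (x + a) - (f x + c * u (x + a))) =
      (fun x : V => (F k x - f x) + c * (U k (x + a) - u (x + a))).
    by apply/funext => x; rewrite mulrBr opprD addrACA.
  rewrite (_ : (fun k => _) = (fun k => energy mu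
      (fun x : V => (F k x - f x) + c * (U k (x + a) - u (x + a)))%R)); last first.
    by apply/funext => k; rewrite E.
  have mB k : cmeas (fun x => U k x - u x) by exact: cmeasB.
  apply: energy_cvg0D => //.
  + by move=> k; exact: cmeasB.
  + by move=> k; apply: cmeasM => //; exact: (mua _ (mB k)).
  + apply: (energy_bounded_mul_cvg mc (fun k => mua _ (mB k)) Z0 nc).
    rewrite (_ : (fun k => _) = (fun k => energy mu (fun x => U k x - u x)%R))//.
    by apply/funext => k; rewrite -(energy_translate a (mB k)).
- have E k : (fun xi => fourierL1 (fun x : V => F k x + c * U k (x + a)) xi -
      (g xi + c * (expi (dotv xi a) * v xi))) =
      (fun xi => (fourierL1 (F k) xi - g xi) +
        c * (expi (dotv xi a) * (fourierL1 (U k) xi - v xi))).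
    apply/funext => xi; have [[Fi _] [Ui _]] := (FL k, UL k).
    rewrite fourierL1_lincomb//; last exact: cintegrable_translate.
    by rewrite fourierL1_translate// opprD addrACA !mulrBr.
  rewrite (_ : (fun k => _) = (fun k => energy mu
      (fun xi => (fourierL1 (F k) xi - g xi) +
        c * (expi (dotv xi a) * (fourierL1 (U k) xi - v xi)))%R)); last first.
    by apply/funext => k; rewrite E.
  have mB k : cmeas (fun x => fourierL1 (U k) x - v x).
    by apply: cmeasB => //; exact: cmeas_fourierL1.
  have mEB k : cmeas (fun xi => expi (dotv xi a) * (fourierL1 (U k) xi - v xi)).
    exact: cmeasM.
  apply: energy_cvg0D => //.
  + by move=> k; apply: cmeasB => //; exact: cmeas_fourierL1.
  + by move=> k; exact: cmeasM.
  + apply: (energy_bounded_mul_cvg mc mEB Z0 nc).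
    exact: (energy_bounded_mul_cvg mE mB ler01 ncE).
Qed.

Lemma is_fourier0 : is_fourier (fun _ : V => 0 : R[i]) (fun _ : V => 0 : R[i]).
Proof.
have e0 : energy mu (fun _ : V => 0 : R[i]) = 0%E.
  rewrite /energy; under eq_integral do rewrite Normc.normc0 expr0n/=.
  by rewrite integral0.
have i0 : cintegrable mu (fun _ : V => 0 : R[i]).
  split; first exact: cmeas_cst.
  by under eq_integral do rewrite Normc.normc0; rewrite integral0.
have f0 : fourierL1 (fun _ : V => 0 : R[i]) = fun _ : V => 0.
  apply/funext => xi; rewrite fourierL1E (eq_cint _ (fun x => mul0r _)).
  by rewrite (cint_real mu (fun=> 0)) /Rintegral integral0.
apply/is_fourierP; split; [|by split; [exact: cmeas_cst|rewrite e0 ltry]|].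
  by split; [exact: cmeas_cst|rewrite e0 ltry].
exists (fun _ _ => 0); rewrite f0; split; first by move=> k; rewrite e0 ltry.
- rewrite (_ : (fun k => _) = cst 0%E); first exact: cvg_cst.
  by apply/funext => k; rewrite (eq_energy _ (fun x => subrr _)) e0.
- rewrite (_ : (fun k => _) = cst 0%E); first exact: cvg_cst.
  by apply/funext => k; rewrite (eq_energy _ (fun x => subrr _)) e0.
Qed.

Lemma expiX (t : R) k : expi t ^+ k = expi (k%:R * t).
Proof.
elim: k => [|k IH]; first by rewrite expr0 mul0r expi0.
by rewrite exprS IH -expiD -natr1 mulrDl mul1r addrC.
Qed.

(** The symbol is the binomial expansion of (exp (i y.xi) - 1)^k. *)
Lemma is_fourier_diff_nat f g k y : is_fourier f g ->
  is_fourier (diff_nat k y f) (fun xi => (expi (dotv y xi) - 1) ^+ k * g xi).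
Proof.
move=> fg; rewrite (_ : (fun xi => _) = (fun xi => \sum_(j <- index_enum 'I_k.+1)
    ((-1) ^+ (k - j) * 'C(k, j)%:R) * (expi (dotv xi (j%:R *: y)) * g xi))); last first.
  apply/funext => xi; rewrite addrC exprDn mulr_suml; apply: eq_bigr => j _.
  by rewrite expiX -mulr_natr dotvZr (dotvC xi) -!mulrA; congr (_ * _); rewrite mulrCA.
rewrite /diff_nat; elim: (index_enum _) => [|j s IH].
  under eq_fun do rewrite big_nil; under [X in is_fourier _ X]eq_fun do rewrite big_nil.
  exact: is_fourier0.
under eq_fun do rewrite big_cons addrC.
under [X in is_fourier _ X]eq_fun do rewrite big_cons addrC.
exact: is_fourier_lincomb_translate.
Qed.

End differences.

Section difference_energy.
Context {R : realType} (n : nat).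
Local Notation mu := (@lebesgue_rV R n).
Local Notation V := 'rV[R]_n.
Implicit Types (f g u : V -> R[i]) (y xi : V) (m : R).

Lemma normc_imag (s : R) : normc (0 +i* s) = `|s|.
Proof. by rewrite /= expr0n/= add0r sqrtr_sqr. Qed.

Lemma normc_expi_sub1 (t : R) : normc (expi t - 1) = `|2 * sin (t / 2)|.
Proof.
have H : normc (expi t - 1) ^+ 2 = `|2 * sin (t / 2)| ^+ 2.
  rewrite normc_sqr cReB cImB /= subr0 real_normK ?num_real//.
  have -> : t = t / 2 + t / 2 by lra.
  rewrite cosD sinD; have -> : (t / 2 + t / 2) / 2 = t / 2 by lra.
  move: (t / 2) => r; have := cos2Dsin2 r; move: (cos r) (sin r) => c s cs.
  have cE : c ^+ 2 = 1 - s ^+ 2 by rewrite -cs addrK.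
  have -> : c * c - s * s - 1 = - (2 * s ^+ 2) by rewrite -expr2 cE; ring.
  have -> : (- (2 * s ^+ 2)) ^+ 2 + (s * c + c * s) ^+ 2 = 4 * s ^+ 2 * (c ^+ 2 + s ^+ 2) by ring.
  by rewrite cs; ring.
by apply/eqP; rewrite -(@eqrXn2 _ 2)// ?normc_ge0//; apply/eqP.
Qed.

Let argi (s : R) : R := if 0 <= s then pi / 2 else - (pi / 2).

(** The principal argument of 2 i sin (y.xi / 2) is pi / 2 or - pi / 2, so
    that the power is the power of the modulus times a unimodular factor. *)
Lemma diff_symbolE m y xi : 0 < m ->
  diff_symbol m y xi = (`|2 * sin (dotv y xi / 2)| `^ m)%:C *
    (expi (m * argi (2 * sin (dotv y xi / 2))) * expi (m * dotv y xi / 2)).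
Proof.
move=> m0; rewrite /diff_symbol; set s := 2 * sin _; rewrite mulrA; congr (_ * _).
rewrite /cpow normc_imag; case: ifPn => [/eqP[->]|_].
  by rewrite normr0 powR0 ?lt0r_neq0// mul0r.
congr (_ * expi (m * _)); rewrite /carg /argi.
by rewrite -[complex.Re _]/0 -[complex.Im _]/s mul0r acos0.
Qed.

Lemma normc_diff_symbol m y xi : 0 < m ->
  normc (diff_symbol m y xi) = `|2 * sin (dotv y xi / 2)| `^ m.
Proof.
move=> m0; rewrite diff_symbolE// !Normc.normcM !normc_expi !mulr1 normc_real.
by rewrite ger0_norm// powR_ge0.
Qed.

Lemma measurable_diff_multiplier y :
  measurable_fun setT (fun xi : V => 2 * sin (dotv y xi / 2)).
Proof.
apply: measurable_funM; first exact: measurable_cst.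
have ms : measurable_fun setT (@sin R).
  by apply: continuous_measurable_fun; exact: continuous_sin.
apply: (measurableT_comp ms); apply: measurable_funM; last exact: measurable_cst.
exact: measurable_dotvl.
Qed.

Lemma cmeas_diff_symbol m y : 0 < m -> cmeas (diff_symbol m y).
Proof.
move=> m0; rewrite (funext (fun xi => diff_symbolE y xi m0)).
have ms := measurable_diff_multiplier y.
apply: cmeasM.
  apply: cmeas_real; apply: (measurableT_comp (measurable_powR m)).
  exact: measurableT_comp.
apply: cmeasM; apply: cmeas_expi.
  apply: measurable_funM; first exact: measurable_cst.
  apply: measurable_fun_ifT; [|exact: measurable_cst|exact: measurable_cst].
  by apply: measurable_fun_ler => //; exact: measurable_cst.
apply: measurable_funM; last exact: measurable_cst.
by apply: measurable_funM; [exact: measurable_cst|exact: measurable_dotvl].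
Qed.

Lemma normr_2sin_le2 (t : R) : `|2 * sin t| <= 2.
Proof.
by rewrite normrM ger0_norm// ger_pMr// ler_norml sin_geN1 sin_le1.
Qed.

Lemma normc_diff_symbol_le m y xi : 0 < m -> normc (diff_symbol m y xi) <= 2 `^ m.
Proof.
move=> m0; rewrite normc_diff_symbol//; apply: ge0_ler_powR; rewrite ?nnegrE ?(ltW m0)//; exact: normr_2sin_le2.
Qed.

Lemma fourierP f : in_L2 f -> is_fourier f (fourier f).
Proof.
move=> /is_fourier_exists[g fg]; rewrite /fourier.
exact: (@xgetPex _ _ [set g | is_fourier f g] (ex_intro _ g fg)).
Qed.

Lemma inv_fourierP g : in_L2 g -> is_fourier (inv_fourier g) g.
Proof.
move=> /is_fourier_surjective[u ug]; rewrite /inv_fourier.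
exact: (@xgetPex _ _ [set u | is_fourier u g] (ex_intro _ u ug)).
Qed.

(** Differences of integral order and of other orders are defined differently,
    but both have a Fourier transform of modulus |2 sin (y.xi / 2)|^m |f^(xi)|,
    to which the Plancherel theorem applies. *)
Theorem diff_energy m y f : 0 < m -> in_L2 f ->
  energy mu (Defs.diff m y f) = ((((2 * pi) ^+ n)^-1)%:E *
    \int[mu]_xi (`|2 * sin (dotv y xi / 2)| `^ (2 * m) *
                 normc (fourier f xi) ^+ 2)%:E)%E.
Proof.
move=> m0 fL; have fg := fourierP fL; set g := fourier f in fg *.
have [_ /in_L2P[mg goo] _] := fg.
have tp0 : 0 < (2 * pi) ^+ n :> R by rewrite exprn_gt0// mulr_gt0// pi_gt0.
have [s [ds sE]] : exists s : V -> R[i], is_fourier (Defs.diff m y f) (fun xi => s xi * g xi) /\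
    forall xi, normc (s xi) = `|2 * sin (dotv y xi / 2)| `^ m.
  rewrite /Defs.diff; case: ifPn => mnat.
    exists (fun xi => (expi (dotv y xi) - 1) ^+ Num.truncn m); split.
      exact: is_fourier_diff_nat.
    move=> xi; rewrite -[in RHS](Num.Theory.truncnK mnat) powR_mulrn//.
    rewrite -normc_expi_sub1; elim: (Num.truncn m) => [|k IH].
      by rewrite !expr0 Normc.normc1.
    by rewrite !exprS Normc.normcM IH.
  exists (diff_symbol m y); split; last by move=> xi; exact: normc_diff_symbol.
  apply: inv_fourierP; apply/in_L2P; split.
    by apply: cmeasM => //; exact: cmeas_diff_symbol.
  exact: (energy_bounded_mul_lty (cmeas_diff_symbol y m0) mg (powR_ge0 2 m)
    (fun xi => normc_diff_symbol_le y xi m0) goo).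
have -> : (\int[mu]_xi (`|2 * sin (dotv y xi / 2)| `^ (2 * m) * normc (g xi) ^+ 2)%:E)%E =
    energy mu (fun xi => s xi * g xi).
  apply: eq_integral => xi _; rewrite Normc.normcM exprMn sE.
  by congr ((_ * _)%:E); rewrite -powR_mulrn ?powR_ge0// -powRrM (mulrC m).
by rewrite (is_fourier_energy ds) muleA -EFinM mulVf ?mul1e// lt0r_neq0.
Qed.

End difference_energy.

(** * Averages of the difference multiplier over segments *)

Section sine_bounds.
Context {R : realType}.
Implicit Types t x r s : R.

Lemma derive_ge0_le (F f : R -> R) t : 0 < t -> continuous f ->
  (forall x : R, is_derive x (1 : R) F (f x)) ->
  (forall x, 0 <= x <= t -> 0 <= f x) -> F 0 <= F t.
Proof.
move=> t0 cf dF f0; rewrite -subr_ge0 -lee_fin -(integral_derive_itv t0 cf dF).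
by apply: integral_ge0 => x /=; rewrite in_itv/= lee_fin; exact: f0.
Qed.

Lemma sin_le_id t : 0 <= t -> sin t <= t.
Proof.
rewrite le_eqVlt => /predU1P[<-|t0]; first by rewrite sin0.
have dF x : is_derive x (1 : R) (fun x => x - sin x) (1 - cos x).
  exact: (is_deriveB (is_derive_id x 1) (is_derive_sin x)).
have cf : continuous (fun x : R => 1 - cos x).
  by move=> x; apply: cvgB; [exact: cvg_cst|exact: continuous_cos].
have := derive_ge0_le t0 cf dF; rewrite sin0 subrr subr_ge0; apply.
by move=> x _; rewrite subr_ge0 cos_le1.
Qed.

Lemma normr_sin_le t : `|sin t| <= `|t|.
Proof.
wlog t0 : t / 0 <= t.
  move=> H; have [/H//|/ltW t0] := leP 0 t.
  by rewrite -normrN -(normrN t) -sinN; apply: H; rewrite oppr_ge0.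
rewrite (ger0_norm t0); have [t1|t1] := leP t 1.
  rewrite ger0_norm ?sin_le_id// le_eqVlt.
  move: t0; rewrite le_eqVlt => /predU1P[<-|t0]; first by rewrite sin0 eqxx.
  by rewrite sin2_gt0 ?orbT// t0/= (le_lt_trans t1)// ltr1n.
by rewrite (le_trans _ (ltW t1))// ler_norml sin_geN1 sin_le1.
Qed.

Lemma cos_half t : cos t = 1 - 2 * sin (t / 2) ^+ 2.
Proof.
have {1}-> : t = t / 2 + t / 2 by lra.
rewrite cosD; have := cos2Dsin2 (t / 2); move: (cos _) (sin _) => c s cs.
by rewrite -!expr2 (_ : c ^+ 2 = 1 - s ^+ 2); [ring|rewrite -cs addrK].
Qed.

Lemma sin_half t : sin t = 2 * sin (t / 2) * cos (t / 2).
Proof. by have {1}-> : t = t / 2 + t / 2 by [lra]; rewrite sinD; ring. Qed.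

Lemma cos_ge_half t : `|t| <= 1 -> 2^-1 <= cos t.
Proof.
move=> t1; rewrite cos_half.
have h : `|sin (t / 2)| <= 2^-1.
  apply: (le_trans (normr_sin_le _)); rewrite normrM (ger0_norm (_ : 0 <= 2^-1)) ?invr_ge0//.
  by rewrite ler_piMl// invr_ge0.
have : `|sin (t / 2)| ^+ 2 <= 2^-1 ^+ 2 by rewrite ler_pXn2r ?nnegrE ?invr_ge0.
by rewrite real_normK ?num_real//; lra.
Qed.

Lemma sin_ge_half t : 0 <= t <= 1 -> t / 2 <= sin t.
Proof.
move=> /andP[]; rewrite le_eqVlt => /predU1P[<-|t0 t1]; first by rewrite mul0r sin0.
have dF x : is_derive x (1 : R) (fun x => sin x - 2^-1 * x) (cos x - 2^-1).
  exact: (is_deriveB (is_derive_sin x) (is_derive_mulr 2^-1 x)).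
have cf : continuous (fun x : R => cos x - 2^-1).
  by move=> x; apply: cvgB; [exact: continuous_cos|exact: cvg_cst].
have := derive_ge0_le t0 cf dF; rewrite sin0 mulr0 subrr subr_ge0 mulrC; apply.
move=> x /andP[x0 xt]; rewrite subr_ge0 cos_ge_half// ger0_norm//.
exact: le_trans xt t1.
Qed.

(** For x <= 2, halving the angle twice reduces the claim to sin t >= t / 2
    on [0, 1], as sin x = 2 sin (x / 2) (1 - 2 sin^2 (x / 4)); for larger x,
    the bound |sin x| <= 1 suffices. *)
Lemma id_sub_sin_ge x : 0 <= x -> Num.min x (x ^+ 3) / 64 <= x - `|sin x|.
Proof.
move=> x0; have [x2|x2] := leP x 2; last first.
  have : `|sin x| <= 1 by rewrite ler_norml sin_geN1 sin_le1.
  have : Num.min x (x ^+ 3) <= x by rewrite ge_min lexx.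
  lra.
have s0 : 0 <= sin x.
  move: x0; rewrite le_eqVlt => /predU1P[<-|x0]; first by rewrite sin0.
  apply: sin_ge0_pi; rewrite (ltW x0)/= (le_trans x2)//.
  exact: pi_ge2.
rewrite ger0_norm//; apply: (@le_trans _ _ (x ^+ 3 / 64)).
  by rewrite ler_pM2r ?invr_gt0// ge_min lexx orbT.
have s2 : x / 4 <= sin (x / 2).
  have := @sin_ge_half (x / 2); rewrite (_ : x / 2 / 2 = x / 4); last by field.
  by apply; apply/andP; split; lra.
have s4 : x / 8 <= sin (x / 4).
  have := @sin_ge_half (x / 4); rewrite (_ : x / 4 / 2 = x / 8); last by field.
  by apply; apply/andP; split; lra.
have s2' : sin (x / 2) <= x / 2 by apply: sin_le_id; lra.
rewrite sin_half cos_half (_ : x / 2 / 2 = x / 4); last by field.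
move: (sin (x / 2)) (sin (x / 4)) s2 s4 s2' => a b ha hb ha'.
have b2 : (x / 8) ^+ 2 <= b ^+ 2 by rewrite ler_pXn2r ?nnegrE//; lra.
have ab : x / 4 * (x / 8) ^+ 2 <= a * b ^+ 2.
  by apply: ler_pM => //; [lra|exact: sqr_ge0].
have -> : 2 * a * (1 - 2 * b ^+ 2) = 2 * a - 4 * (a * b ^+ 2) by ring.
have E : x / 4 * (x / 8) ^+ 2 = x ^+ 3 / 256 by field.
by rewrite E in ab; lra.
Qed.

Lemma sin_sub_le (a b : R) : sin b - sin a <= 2 * `|sin ((b - a) / 2)|.
Proof.
have E (p q : R) : sin (p + q) - sin (p - q) = 2 * (cos p * sin q).
  by rewrite sinD sinB; ring.
have := E ((a + b) / 2) ((b - a) / 2).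
have -> : (a + b) / 2 + (b - a) / 2 = b by field.
have -> : (a + b) / 2 - (b - a) / 2 = a by field.
move=> ->; rewrite ler_pM2l// (le_trans (ler_norm _))// normrM ler_piMl//.
by rewrite ler_norml cos_geN1 cos_le1.
Qed.

(** The bound A on g' compares the integral of sin^2 (r g / 2) with that of
    g' sin^2 (r g / 2), which has the explicit primitive g / 2 - sin (r g) / (2 r).
    Its increment is at least (X - |sin X|) / r, where X is r / 2 times the
    increment of g, which the bound a keeps away from 0. *)
Lemma integral_sin_sqr_ge (g dg : R -> R) (a A T r : R) :
  0 < a -> 0 < A -> 0 < T -> 0 < r -> continuous dg ->
  (forall s : R, is_derive s (1 : R) g (dg s)) ->
  (forall s, 0 <= s <= T -> a <= dg s <= A) ->
  ((A^-1 * (Num.min (a * T / 2) ((a * T / 2) ^+ 3) / 64 *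
      Num.min 1 (r ^+ 2)))%:E <=
   \int[@lebesgue_measure R]_(s in `[0%R, T]) (sin (r * g s / 2) ^+ 2)%:E)%E.
Proof.
move=> a0 A0 T0 r0 cdg dG adg; set b := a * T / 2.
have b0 : 0 < b by rewrite divr_gt0// mulr_gt0.
have cg : continuous g := is_derive_continuous dG.
have csin : continuous (fun s : R => sin (r * g s / 2)).
  apply: (continuous_compR _ (@continuous_sin R)) => s.
  apply: cvgM; last exact: cvg_cst.
  by apply: cvgM; [exact: cvg_cst|exact: cg].
have csq : continuous (fun s : R => sin (r * g s / 2) ^+ 2).
  exact: (continuous_compR csin (@exprn_continuous R 2)).
have L_ge : a * T <= g T - g 0.
  have aT := @integral_derive_itv R (fun s => a * s) (fun=> a) 0 T T0
    (@cst_continuous R R a) (is_derive_mulr a).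
  rewrite mulr0 subr0 in aT.
  rewrite -lee_fin -aT -(integral_derive_itv T0 cdg dG).
  apply: ge0_le_integral => //.
  - by move=> s _; rewrite lee_fin ltW.
  - by apply/measurable_EFinP; apply: measurable_funTS; exact: continuous_measurable_fun.
  - by move=> s /=; rewrite in_itv/= lee_fin => /adg/andP[].
pose F s := 2^-1 * g s - (2 * r)^-1 * sin (r * g s).
have dF s : is_derive s (1 : R) F (dg s * sin (r * g s / 2) ^+ 2).
  have d1 := @is_deriveZ _ _ _ _ 2^-1 s (1 : R) _ (dG s).
  have drg := @is_deriveZ _ _ _ _ r s (1 : R) _ (dG s).
  have ds := @is_derive1_comp _ (@sin R) (fun s => r * g s) s _ _
    (is_derive_sin (r * g s)) drg.
  have h := is_deriveB d1 (@is_deriveZ _ _ _ _ (2 * r)^-1 s (1 : R) _ ds).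
  apply: (is_derive_eq h); rewrite /GRing.scale/= cos_half.
  by field; exact: lt0r_neq0.
have cF : continuous (fun s => dg s * sin (r * g s / 2) ^+ 2).
  by move=> s; apply: cvgM; [exact: cdg|exact: csq].
have FE := integral_derive_itv T0 cF dF.
have msq : measurable_fun `[0, T] (fun s => sin (r * g s / 2) ^+ 2).
  by apply: measurable_funTS; exact: continuous_measurable_fun.
have le1 : ((F T - F 0)%:E <= A%:E *
    \int[@lebesgue_measure R]_(s in `[0%R, T]) (sin (r * g s / 2) ^+ 2)%:E)%E.
  rewrite -FE -ge0_integralZl//.
  - apply: ge0_le_integral => //.
    + move=> s /=; rewrite in_itv/= lee_fin => /adg/andP[ag _].
      by rewrite mulr_ge0 ?sqr_ge0// (le_trans (ltW a0)).
    + by apply/measurable_EFinP; apply: measurable_funTS; exact: continuous_measurable_fun.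
    + by apply: emeasurable_funM; [exact: measurable_cst|exact/measurable_EFinP].
    + move=> s /=; rewrite in_itv/= -EFinM lee_fin => /adg/andP[_ gA].
      by rewrite ler_wpM2r// sqr_ge0.
  - exact/measurable_EFinP.
  - by move=> s _; rewrite lee_fin sqr_ge0.
  - by rewrite lee_fin ltW.
rewrite EFinM lee_pdivrMl//; apply: le_trans le1; rewrite lee_fin.
pose x := r * (g T - g 0) / 2.
have xb : r * b <= x by rewrite /x /b -[leRHS]mulrA ler_pM2l// ler_pM2r ?invr_gt0.
have x0 : 0 <= x by apply: le_trans xb; rewrite mulr_ge0 ?ltW.
have F_ge : r^-1 * (x - `|sin x|) <= F T - F 0.
  have -> : F T - F 0 = r^-1 * (x - (sin (r * g T) - sin (r * g 0)) / 2).
    by rewrite /F /x; field; rewrite gt_eqF.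
  rewrite ler_pM2l ?invr_gt0// lerD2l lerN2 ler_pdivrMr// [leRHS]mulrC.
  by have := sin_sub_le (r * g 0) (r * g T); rewrite -mulrBr.
apply: le_trans F_ge; rewrite ler_pdivlMl//.
apply: le_trans (id_sub_sin_ge x0); rewrite mulrCA mulrAC ler_pM2r ?invr_gt0//.
rewrite mulrCA le_min; apply/andP; split.
  apply: le_trans xb; rewrite ler_pM2l//.
  rewrite -[leRHS]mulr1; apply: ler_pM; rewrite ?ge_min ?lexx//.
    by rewrite le_min ltW//= exprn_ge0// ltW.
  by rewrite le_min ler01 sqr_ge0.
apply: (@le_trans _ _ ((r * b) ^+ 3)); last by rewrite ler_pXn2r ?nnegrE// mulr_ge0// ltW.
rewrite [leRHS]exprMn [r ^+ 3]exprS -[leRHS]mulrA ler_pM2l// [leRHS]mulrC; apply: ler_pM.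
- by rewrite le_min (ltW b0) exprn_ge0// ltW.
- by rewrite le_min ler01 sqr_ge0.
- by rewrite ge_min lexx orbT.
- by rewrite ge_min lexx orbT.
Qed.

End sine_bounds.

(** * Euclidean norm and integration over the unit sphere *)

Section enorm_theory.
Context {R : realType} (n : nat).
Local Notation V := 'rV[R]_n.
Implicit Types x y : V.

Lemma dotv_ge0 x : 0 <= dotv x x.
Proof. by apply: sumr_ge0 => i _; rewrite -expr2 sqr_ge0. Qed.

Lemma dotv_eq0 x : (dotv x x == 0) = (x == 0).
Proof.
apply/idP/eqP => [|->]; last by rewrite -(scale0r 0) dotvZl mul0r.
rewrite psumr_eq0; last by move=> i _; rewrite -expr2 sqr_ge0.
move=> /allP x0; apply/rowP => i; rewrite mxE.
by have := x0 i (mem_index_enum i); rewrite mulf_eq0 orbb => /eqP.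
Qed.

Lemma enorm_ge0 x : 0 <= enorm x.
Proof. exact: sqrtr_ge0. Qed.

Lemma enorm_sqr x : enorm x ^+ 2 = dotv x x.
Proof. by rewrite sqr_sqrtr ?dotv_ge0. Qed.

Lemma enormZ c x : enorm (c *: x) = `|c| * enorm x.
Proof.
by rewrite /enorm dotvZl dotvZr mulrA -expr2 sqrtrM ?sqr_ge0// sqrtr_sqr.
Qed.

Lemma enorm_eq0 x : (enorm x == 0) = (x == 0).
Proof. by rewrite -sqrf_eq0 enorm_sqr dotv_eq0. Qed.

Lemma sqr_dotv_le x y : dotv x y ^+ 2 <= dotv x x * dotv y y.
Proof.
have [->|y0] := eqVneq y 0.
  by rewrite -(scale0r 0) dotvZr mul0r expr0n mulr_ge0// dotv_ge0.
have yy : 0 < dotv y y by rewrite lt_neqAle eq_sym dotv_eq0 y0 dotv_ge0.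
have := dotv_ge0 (dotv y y *: x + - dotv x y *: y).
rewrite dotvDl !dotvZl !dotvDr !dotvZr (dotvC y x).
move: (dotv x x) (dotv y y) (dotv x y) yy => a b c b0.
rewrite (_ : _ + _ = b * (a * b - c ^+ 2)); last by ring.
by rewrite pmulr_rge0// subr_ge0.
Qed.

Lemma normr_dotv_le x y : `|dotv x y| <= enorm x * enorm y.
Proof.
rewrite -(ler_pXn2r (_ : (0 < 2)%N))// ?nnegrE ?mulr_ge0 ?enorm_ge0//.
by rewrite exprMn !enorm_sqr real_normK ?num_real// sqr_dotv_le.
Qed.

Lemma normr_coord_le_enorm x i : `|x ord0 i| <= enorm x.
Proof.
rewrite -(ler_pXn2r (_ : (0 < 2)%N))// ?nnegrE ?enorm_ge0//.
rewrite enorm_sqr real_normK ?num_real// expr2 /dotv (bigD1 i)//= lerDl.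
by apply: sumr_ge0 => j _; rewrite -expr2 sqr_ge0.
Qed.

Lemma enorm_normalize x : 0 < enorm x -> enorm (normalize x) = 1.
Proof.
by move=> x0; rewrite /normalize enormZ ger0_norm ?invr_ge0 ?ltW// mulVf// gt_eqF.
Qed.

Lemma measurable_enorm : measurable_fun setT (@enorm R n).
Proof.
apply: (@measurableT_comp _ _ _ _ _ _ (@Num.sqrt R : R -> R)).
  by apply: continuous_measurable_fun; exact: sqrt_continuous.
apply: measurable_sum => i; apply: measurable_funM; exact: measurable_coord.
Qed.

Lemma measurable_sphere : measurable (@sphere R n).
Proof.
have -> : @sphere R n = (@enorm R n) @^-1` [set 1] by [].
by rewrite -[X in measurable X]setTI; apply: measurable_enorm.
Qed.

Lemma punctured_ball_subset_box : @punctured_ball R n `<=` box 1.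
Proof.
by move=> x /andP[_ x1] i; exact: le_trans (normr_coord_le_enorm x i) x1.
Qed.

End enorm_theory.

Section sphere_integral.
Context {R : realType} (n : nat).
Local Notation V := 'rV[R]_n.
Local Notation mu := (lebesgue_rV n : {measure set V -> \bar R}).
Local Notation S := (@sphere R n).
Local Notation P := (@punctured_ball R n).
Local Notation mP := (@measurable_punctured_ball R n).

Lemma integral_mrestr (F : V -> \bar R) :
  measurable_fun setT F -> (forall x, 0 <= F x)%E ->
  (\int[mrestr mu mP]_x F x = \int[mu]_(x in P) F x)%E.
Proof.
move=> mF F0; rewrite (@ge0_negligible_integral _ _ _ _ _ (~` P))//; first last.
- by rewrite /= /mrestr setICl measure0.
- exact: (measurableC mP).
rewrite setTD setCK; apply: eq_measure_integral => A mA AP.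
by rewrite /= /mrestr setIidl.
Qed.

(** Polar integration reduces to the volume of the ball because the surface
    measure is the push-forward of n times the volume of the ball. *)
Lemma ge0_integral_sphere (G : V -> \bar R) :
  measurable_fun setT G -> (forall y, 0 <= G y)%E ->
  (\int[sphere_measure n]_(y in S) G y =
   n%:R%:E * \int[mu]_(x in P) G (normalize x))%E.
Proof.
move=> mG G0; rewrite integral_mkcond.
have mGS : measurable_fun setT (G \_ S).
  by apply/(measurable_restrictT _ (@measurable_sphere R n)); exact: measurable_funTS.
have GS0 x : (0 <= (G \_ S) x)%E by rewrite patchE; case: ifPn.
pose nu := measure_function_pushforward__canonical__measure_function_Measure
  (mrestr mu mP) (@measurable_normalize R n).
rewrite (eq_measure_integral (mscale n%:R%:nng nu))//.
rewrite ge0_integral_mscale//=; congr (_ * _)%E.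
rewrite ge0_integral_pushforward//=; last exact: measurable_normalize.
rewrite preimage_setT integral_mrestr//; last first.
  exact: (measurableT_comp mGS (@measurable_normalize R n)).
apply: eq_integral => x; rewrite inE => /andP[x0 _] /=.
by rewrite patchE mem_set//; exact: enorm_normalize.
Qed.

Lemma sphere_measure_lty : (sphere_measure n S < +oo)%E.
Proof.
rewrite /= /sphere_measure lte_mul_pinfty//.
apply: le_lt_trans (lebesgue_box_lty n 1); apply: le_measure; rewrite ?inE.
- apply: measurableI => //; last exact: mP.
  rewrite -[X in measurable X]setTI; apply: measurable_normalize => //.
  exact: measurable_sphere.
- exact: measurable_box.
- by move=> x [_ /punctured_ball_subset_box].
Qed.

End sphere_integral.

(** * Averages of the difference multiplier over the sphere *)

Section segment.
Context {R : realType}.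

Lemma is_derive_sqrtD_sqr (p k s : R) : 0 < k ->
  is_derive s (1 : R) (fun s => Num.sqrt (k + (p + s) ^+ 2))
    ((p + s) / Num.sqrt (k + (p + s) ^+ 2)).
Proof.
move=> k0; have D0 : 0 < k + (p + s) ^+ 2 by rewrite ltr_pwDl// sqr_ge0.
have dps : is_derive s (1 : R) (fun s => p + s) 1.
  have := is_deriveD (is_derive_cst p s 1) (is_derive_id s 1).
  by rewrite add0r.
have dsq : is_derive s (1 : R) (fun s => k + (p + s) ^+ 2) (2 * (p + s)).
  have h := is_deriveD (is_derive_cst k s 1) (@is_deriveX _ _ (fun s => p + s) 2 s 1 1 dps).
  rewrite (_ : (fun s => _) = cst k + (fun s => p + s) ^+ 2); last by apply/funext.
  apply: (is_derive_eq h); rewrite add0r /GRing.scale/=.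
  by ring.
have h := @is_derive1_comp _ Num.sqrt (fun s => k + (p + s) ^+ 2) s _ _ (is_derive1_sqrt D0) dsq.
apply: (is_derive_eq h); rewrite invfM.
have : Num.sqrt (k + (p + s) ^+ 2) != 0 by rewrite gt_eqF ?sqrtr_gt0.
by move=> q0; field.
Qed.

(** This is the cosine of the angle between a direction and a point that moves
    in this direction at unit speed from a point with component p along it, on
    a line at squared distance k from the origin. *)
Lemma is_derive_cos_angle (p k s : R) : 0 < k ->
  is_derive s (1 : R) (fun s => (p + s) / Num.sqrt (k + (p + s) ^+ 2))
    (k / Num.sqrt (k + (p + s) ^+ 2) ^+ 3).
Proof.
move=> k0; have D0 : 0 < k + (p + s) ^+ 2 by rewrite ltr_pwDl// sqr_ge0.
have q0 : Num.sqrt (k + (p + s) ^+ 2) != 0 by rewrite gt_eqF ?sqrtr_gt0.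
have dps : is_derive s (1 : R) (fun s => p + s) 1.
  have := is_deriveD (is_derive_cst p s 1) (is_derive_id s 1).
  by rewrite add0r.
have dV := @is_deriveV _ (fun s => Num.sqrt (k + (p + s) ^+ 2)) s _ 1 q0
  (is_derive_sqrtD_sqr p s k0).
have h := is_deriveM dps dV.
apply: (is_derive_eq h); rewrite /GRing.scale/=.
have qq : Num.sqrt (k + (p + s) ^+ 2) ^+ 2 = k + (p + s) ^+ 2 by rewrite sqr_sqrtr// ltW.
move: (Num.sqrt _) q0 qq => q q0 qq.
have -> : k = q ^+ 2 - (p + s) ^+ 2 by rewrite qq addrK.
by field.
Qed.

Lemma continuous_cos_angle_derive (p k : R) : 0 < k ->
  continuous (fun s => k / Num.sqrt (k + (p + s) ^+ 2) ^+ 3).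
Proof.
move=> k0 s; apply: cvgM; first exact: cvg_cst.
have D0 : 0 < k + (p + s) ^+ 2 by rewrite ltr_pwDl// sqr_ge0.
apply: cvgV; first by rewrite expf_neq0// gt_eqF ?sqrtr_gt0.
have cq := is_derive_continuous (fun s => is_derive_sqrtD_sqr p s k0).
exact: (continuous_compR cq (@exprn_continuous R 3)).
Qed.

(** The constant of [integral_sin_sqr_ge] for a derivative between a = 1/16
    and A = 4 on an interval of length T = 1/4; thus a T / 2 = 1/128. *)
Definition segment_const : R := 4^-1 * (Num.min 128^-1 (128^-1 ^+ 3) / 64).

Lemma segment_const_gt0 : 0 < segment_const.
Proof.
by rewrite mulr_gt0 ?invr_gt0// divr_gt0// lt_min exprn_gt0 invr_gt0 ltr0n.
Qed.

Lemma integral_sin_cos_angle_ge (p k r : R) : 16^-1 <= k -> 0 < r ->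
  (forall s, 0 <= s <= 4^-1 -> k + (p + s) ^+ 2 <= 1) ->
  ((segment_const * Num.min 1 (r ^+ 2))%:E <=
   \int[@lebesgue_measure R]_(s in `[0%R, (4^-1)%R])
     (sin (r * ((p + s) / Num.sqrt (k + (p + s) ^+ 2)) / 2) ^+ 2)%:E)%E.
Proof.
move=> k16 r0 D1; have k0 : 0 < k by apply: lt_le_trans k16.
have T0 : 0 < (4^-1 : R) by rewrite invr_gt0.
have a0 : 0 < (16^-1 : R) by rewrite invr_gt0.
have h s : 0 <= s <= 4^-1 ->
    16^-1 <= k / Num.sqrt (k + (p + s) ^+ 2) ^+ 3 <= 4.
  move=> sT.
  have qq : Num.sqrt (k + (p + s) ^+ 2) ^+ 2 = k + (p + s) ^+ 2.
    by rewrite sqr_sqrtr// addr_ge0 ?sqr_ge0// ltW.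
  have q0 : 0 < Num.sqrt (k + (p + s) ^+ 2).
    by rewrite sqrtr_gt0 ltr_pwDl// sqr_ge0.
  have q1' : Num.sqrt (k + (p + s) ^+ 2) ^+ 2 <= 1 by rewrite qq; exact: D1.
  have kq : k <= Num.sqrt (k + (p + s) ^+ 2) ^+ 2 by rewrite qq lerDl sqr_ge0.
  move: (Num.sqrt _) q0 q1' kq => q q0 q1' kq.
  have q1 : q <= 1 by rewrite -(@ler_pXn2r _ 2)// ?nnegrE ?(ltW q0)// expr1n.
  have q4 : 4^-1 <= q.
    rewrite -(@ler_pXn2r _ 2)// ?nnegrE ?(ltW q0)// ?(ltW T0)//.
    by apply: le_trans kq; rewrite (le_trans _ k16)// exprVn -natrX.
  rewrite ler_pdivlMr ?exprn_gt0// ler_pdivrMr ?exprn_gt0//; apply/andP; split.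
    have : 16^-1 * q ^+ 3 <= 16^-1 by rewrite ler_piMr ?(ltW a0)// exprn_ile1// ltW.
    lra.
  apply: (le_trans kq); rewrite [q ^+ 3]exprS mulrA ler_peMl ?sqr_ge0//.
  by rewrite -ler_pdivrMl//; lra.
have := integral_sin_sqr_ge a0 (_ : 0 < 4) T0 r0 (continuous_cos_angle_derive (p := p) k0)
  (fun s => is_derive_cos_angle p s k0) h.
have -> : 16^-1 * 4^-1 / 2 = 128^-1 :> R by field.
by rewrite mulrA; exact.
Qed.

End segment.

Section sphere_average.
Context {R : realType} (n : nat).
Local Notation V := 'rV[R]_n.
Local Notation mu := (lebesgue_rV n : {measure set V -> \bar R}).
Local Notation leb := (@lebesgue_measure R).
Local Notation S := (@sphere R n).
Local Notation P := (@punctured_ball R n).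

Lemma dotv_segment (v e : V) s : dotv e e = 1 ->
  dotv (v + s *: e) (v + s *: e) = (dotv v v - dotv v e ^+ 2) + (dotv v e + s) ^+ 2.
Proof.
move=> e1; rewrite !dotvDl !dotvDr !dotvZl !dotvZr e1 (dotvC e v).
by ring.
Qed.

Lemma dotv_normalize_segment (v e : V) s : dotv e e = 1 ->
  dotv (normalize (v + s *: e)) e =
  (dotv v e + s) / Num.sqrt ((dotv v v - dotv v e ^+ 2) + (dotv v e + s) ^+ 2).
Proof.
move=> e1; rewrite /normalize /enorm dotv_segment// dotvZl dotvDl dotvZl.
by rewrite e1 mulr1 mulrC.
Qed.

(** This is where the dimension is used: on the line, a unit vector has a
    coordinate of square 1, and the sphere is reduced to two points, at which
    the multiplier vanishes for suitable frequencies. *)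
Lemma small_coordinate (e : V) : (2 <= n)%N -> dotv e e = 1 ->
  exists i, e ord0 i ^+ 2 <= 2^-1.
Proof.
move=> n2 e1; pose i0 : 'I_n := Ordinal (ltnW n2); pose i1 : 'I_n := Ordinal n2.
have : e ord0 i0 ^+ 2 + e ord0 i1 ^+ 2 <= 1.
  rewrite -e1 /dotv (bigD1 i0)//= (bigD1 i1)//= -!expr2 addrA lerDl.
  by apply: sumr_ge0 => j _; rewrite -expr2 sqr_ge0.
have [h _|h1 h2] := leP (e ord0 i0 ^+ 2) 2^-1; first by exists i0.
by exists i1; lra.
Qed.

(** Small enough for the vectors of the box of this radius to have Euclidean
    norm at most 1/64. *)
Definition base_radius : R := (64 * n%:R)^-1.

(** Half the basis vector i is at distance at least 1/sqrt 8 from the line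
    directed by e, and it can move by 1/4 along e without leaving the unit
    ball. The radius of the box leaves room for a perturbation. *)
Lemma base_point_bounds (e b : V) i : (0 < n)%N -> dotv e e = 1 ->
  e ord0 i ^+ 2 <= 2^-1 -> box base_radius b ->
  let v := 2^-1 *: delta_mx 0 i + b in
  16^-1 <= dotv v v - dotv v e ^+ 2 /\
  forall s, 0 <= s <= 4^-1 ->
    (dotv v v - dotv v e ^+ 2) + (dotv v e + s) ^+ 2 <= 1.
Proof.
move=> n0 e1 ei bb /=.
have n1 : 1 <= n%:R :> R by rewrite ler1n.
have dd (y : V) : dotv (delta_mx 0 i) y = y ord0 i.
  rewrite /dotv (bigD1 i)//= mxE !eqxx mul1r big1 ?addr0// => j ji.
  by rewrite mxE eqxx (negbTE ji) mul0r.
have r64 : base_radius <= 64^-1.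
  rewrite /base_radius lef_pV2 ?posrE ?mulr_gt0 ?ltr0n//.
  by rewrite ler_peMr.
have bi : `|b ord0 i| <= 64^-1 := le_trans (bb i) r64.
have b2 : dotv b b <= 64^-1 ^+ 2.
  apply: (@le_trans _ _ (\sum_(j < n) base_radius ^+ 2)).
    apply: ler_sum => j _; rewrite -expr2 -real_normK ?num_real//.
    by rewrite ler_pXn2r ?nnegrE// (le_trans _ (bb j)).
  have nn0 : n%:R != 0 :> R by rewrite gt_eqF ?ltr0n.
  rewrite sumr_const card_ord (_ : _ *+ n = 64^-1 ^+ 2 * n%:R^-1); last first.
    by rewrite -mulr_natr /base_radius; field.
  by rewrite ler_piMr ?exprn_ge0 ?invr_ge0// invf_le1// ltr0n.
have be : `|dotv b e| <= 64^-1.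
  apply: (le_trans (normr_dotv_le b e)).
  rewrite [X in _ * X](_ : _ = 1) ?mulr1; last by rewrite /enorm e1 sqrtr1.
  by rewrite -(@ler_pXn2r _ 2)// ?nnegrE ?enorm_ge0 ?invr_ge0// enorm_sqr.
have vv : dotv (2^-1 *: delta_mx 0 i + b) (2^-1 *: delta_mx 0 i + b) =
    4^-1 + b ord0 i + dotv b b.
  rewrite dotvDl !dotvDr !dotvZl !dotvZr (dotvC b (delta_mx 0 i)) !dd mxE !eqxx/=.
  by field.
have ve : dotv (2^-1 *: delta_mx 0 i + b) e = e ord0 i / 2 + dotv b e.
  by rewrite dotvDl dotvZl dd mulrC.
rewrite vv ve; have b0 := dotv_ge0 b.
have E1 : e ord0 i <= 1 by nra.
have E2 : -1 <= e ord0 i by nra.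
move: bi be b2 b0 E1 E2 ei; rewrite !ler_norml => /andP[bi1 bi2] /andP[].
move: (e ord0 i) (dotv b e) (b ord0 i) (dotv b b) bi1 bi2 => x p c q bi1 bi2.
move=> p1 p2 q2 q0 x1 x2 xx.
have p2' : p ^+ 2 <= 64^-1 ^+ 2.
  by rewrite -(real_normK (num_real p)) ler_pXn2r ?nnegrE// ?invr_ge0// ler_norml p1.
have xp : x * p <= 64^-1.
  rewrite (le_trans (ler_norm _))// normrM -[leRHS]mul1r ler_pM// ler_norml ?x1 ?x2//.
  by rewrite p1.
have E : 64^-1 ^+ 2 = 4096^-1 :> R by rewrite exprVn -natrX.
rewrite E in q2 p2'; split.
  have -> : (x / 2 + p) ^+ 2 = x ^+ 2 / 4 + x * p + p ^+ 2 by field.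
  by lra.
move=> s /andP[s0 s4].
have -> : 4^-1 + c + q - (x / 2 + p) ^+ 2 + (x / 2 + p + s) ^+ 2 =
  4^-1 + c + q + s * (x + 2 * p) + s ^+ 2 by field.
have s2 : s ^+ 2 <= 16^-1.
  have -> : 16^-1 = 4^-1 ^+ 2 :> R by rewrite exprVn -natrX.
  by rewrite ler_pXn2r ?nnegrE ?invr_ge0.
have sx : s * (x + 2 * p) <= 4^-1 * (1 + 2 * 64^-1).
  by apply: (@le_trans _ _ (s * (1 + 2 * 64^-1))); [rewrite ler_wpM2l//; lra|rewrite ler_wpM2r//; lra].
by lra.
Qed.

(** Lebesgue measure being invariant under translations, the integral of F
    equals its average over the translates along a segment. *)
Lemma integral_segment_ge (F : V -> \bar R) (e : V) (T c : R) (B : set V) :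
  measurable_fun setT F -> (forall x, 0 <= F x)%E -> 0 <= T -> 0 <= c ->
  measurable B ->
  (forall x, B x -> (c%:E <= \int[leb]_(s in `[0%R, T]) F (x + s *: e)%R)%E) ->
  (c%:E * mu B <= T%:E * \int[mu]_x F x)%E.
Proof.
move=> mF F0 T0 c0 mB BF.
have mI : measurable (`[0, T]%classic : set R) by exact: measurable_itv.
pose K (p : measurableTypeR R * V) : \bar R :=
  (F (p.2 + p.1 *: e)%R * (\1_(`[0, T]%classic) p.1)%:E)%E.
have mK : measurable_fun setT K.
  apply: emeasurable_funM.
    apply: (measurableT_comp mF); apply: measurable_fun_rVP => i.
    rewrite (_ : (fun t => _) = (fun t : measurableTypeR R * V =>
      t.2 ord0 i + t.1 * e ord0 i)); last by apply/funext => t; rewrite !mxE.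
    apply: measurable_funD.
      exact: (measurableT_comp (measurable_coord i) measurable_snd).
    by apply: measurable_funM; [exact: measurable_fst|exact: measurable_cst].
  apply/measurable_EFinP; exact: (measurableT_comp (measurable_indic mI) measurable_fst).
have K0 p : (0 <= K p)%E by rewrite /K mule_ge0// lee_fin indicE ler0n.
have Kin x : (\int[leb]_s K (s, x) = \int[leb]_(s in `[0%R, T]) F (x + s *: e)%R)%E.
  by rewrite [RHS]integral_mkcond; apply: eq_integral => s _; rewrite /K/= epatch_indic.
have Kout s : (\int[mu]_x K (s, x) = (\1_(`[0, T]%classic) s)%:E * \int[mu]_x F x)%E.
  rewrite /K/=; under eq_integral do rewrite muleC.
  rewrite ge0_integralZl//.
  - by rewrite ge0_integral_translate.
  - exact: (measurableT_comp mF (measurable_translate _)).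
have -> : (T%:E * \int[mu]_x F x = \int[leb]_s \int[mu]_x K (s, x))%E.
  under [RHS]eq_integral do rewrite Kout.
  rewrite ge0_integralZr//; last 2 first.
  - by apply/measurable_EFinP; exact: measurable_indic.
  - by apply: integral_ge0 => x _; exact: F0.
  - rewrite integral_indic// setIT/= lebesgue_measure_itv/= lte_fin.
    by move: T0; rewrite le_eqVlt => /predU1P[<-|->]; rewrite ?ltxx// oppr0 adde0.
rewrite (@fubini_tonelli _ _ _ _ R leb (lebesgue_rV n) K mK K0).
have -> : (c%:E * mu B = \int[mu]_x (c * \1_B x)%:E)%E.
  under eq_integral do rewrite EFinM.
  rewrite ge0_integralZl// ?integral_indic ?setIT//.
  by apply/measurable_EFinP; exact: measurable_indic.
apply: ge0_le_integral => //.
- by move=> x _; rewrite lee_fin mulr_ge0// indicE ler0n.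
- by apply/measurable_EFinP; apply: measurable_funM; [exact: measurable_cst|exact: measurable_indic].
- exact: (measurable_fun_fubini_tonelli_G K).
move=> x _; rewrite Kin indicE; have [/set_mem /BF|_] := boolP (x \in B).
  by rewrite mulr1.
by rewrite mulr0; apply: integral_ge0 => s _; exact: F0.
Qed.

End sphere_average.

Section sphere_multiplier.
Context {R : realType} (n : nat).
Hypothesis n2 : (2 <= n)%N.
Local Notation V := 'rV[R]_n.
Local Notation mu := (lebesgue_rV n : {measure set V -> \bar R}).
Local Notation S := (@sphere R n).
Local Notation P := (@punctured_ball R n).

Definition base_box i : set V :=
  (fun x => x + - (2^-1 *: delta_mx 0 i)) @^-1` box (base_radius n).

Lemma measurable_base_box i : measurable (base_box i).
Proof.
rewrite -[X in measurable X]setTI; apply: measurable_translate => //.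
exact: measurable_box.
Qed.

Lemma base_radius_gt0 : 0 < base_radius n :> R.
Proof. by rewrite invr_gt0 mulr_gt0// ltr0n (ltn_trans _ n2). Qed.

Lemma lebesgue_base_box i : mu (base_box i) = ((base_radius n *+ 2) ^+ n)%:E.
Proof.
rewrite -(lebesgue_box n (ltW base_radius_gt0)).
have mI : measurable_fun setT (EFin \o \1_(box (base_radius n) : set V) : V -> \bar R).
  by apply/measurable_EFinP; apply: measurable_indic; exact: measurable_box.
have I0 x : (0 <= (EFin \o \1_(box (base_radius n) : set V) : V -> \bar R) x)%E.
  by rewrite /= lee_fin indicE ler0n.
have -> : mu (base_box i) = (\int[mu]_x (\1_(base_box i) x)%:E)%E.
  by rewrite integral_indic ?setIT//; exact: measurable_base_box.
have -> : mu (box (base_radius n)) = (\int[mu]_x (\1_(box (base_radius n)) x)%:E)%E.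
  by rewrite integral_indic ?setIT//; exact: measurable_box.
by rewrite -(ge0_integral_translate (- (2^-1 *: delta_mx 0 i)) mI I0).
Qed.

Definition average_const : R :=
  4 * (segment_const * (base_radius n *+ 2) ^+ n).

Lemma average_const_gt0 : 0 < average_const.
Proof.
by rewrite !mulr_gt0 ?segment_const_gt0// exprn_gt0// mulrn_wgt0// base_radius_gt0.
Qed.

Lemma measurable_sin_normalize (e : V) r :
  measurable_fun setT (fun x : V => sin (r * dotv (normalize x) e / 2)).
Proof.
apply: (measurableT_comp (continuous_measurable_fun (@continuous_sin R))).
apply: measurable_funM; last exact: measurable_cst.
apply: measurable_funM; first exact: measurable_cst.
exact: (measurableT_comp (measurable_dotvr e) (@measurable_normalize R n)).
Qed.

(** Averaging over segments directed by e makes the cosine of the angle with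
    e the variable: on each segment it moves at a speed bounded above and
    below, so that sin^2 has an average comparable with min (1, r^2). *)
Lemma integral_sin_sqr_ball_ge (e : V) (r : R) : dotv e e = 1 -> 0 < r ->
  ((average_const * Num.min 1 (r ^+ 2))%:E <=
   \int[mu]_(x in P) (sin (r * dotv (normalize x) e / 2) ^+ 2)%:E)%E.
Proof.
move=> e1 r0; have n0 : (0 < n)%N by exact: ltnW n2.
have [i ei] := small_coordinate n2 e1.
pose f (x : V) := sin (r * dotv (normalize x) e / 2) ^+ 2.
have mf : measurable_fun setT f.
  by apply: measurable_funX; exact: measurable_sin_normalize.
pose F := (EFin \o f) \_ P.
have mF : measurable_fun setT F.
  apply/(measurable_restrictT _ (@measurable_punctured_ball R n)).
  by apply: measurable_funTS; exact/measurable_EFinP.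
have F0 x : (0 <= F x)%E.
  by rewrite /F patchE; case: ifPn => // _; rewrite lee_fin sqr_ge0.
have c0 : 0 <= segment_const * Num.min 1 (r ^+ 2).
  by rewrite mulr_ge0 ?(ltW segment_const_gt0)// le_min ler01 sqr_ge0.
have T0 : 0 < (4^-1 : R) by rewrite invr_gt0.
have seg x : base_box i x -> ((segment_const * Num.min 1 (r ^+ 2))%:E <=
    \int[@lebesgue_measure R]_(s in `[0%R, (4^-1)%R]) F (x + s *: e)%R)%E.
  move=> xB; have := base_point_bounds n0 e1 ei xB.
  rewrite /= addrCA subrr addr0 => -[k16 D1].
  apply: (le_trans (integral_sin_cos_angle_ge k16 r0 D1)).
  rewrite le_eqVlt; apply/orP; left; apply/eqP; apply: eq_integral => s.
  rewrite inE/= in_itv/= => sT; rewrite /F patchE mem_set/=.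
    by rewrite /f dotv_normalize_segment.
  rewrite /punctured_ball/= /enorm dotv_segment// sqrtr_gt0.
  rewrite ltr_pwDl ?sqr_ge0 ?(lt_le_trans _ k16) ?invr_gt0//=.
  by rewrite -sqrtr1 ler_wsqrtr// D1.
have := integral_segment_ge mF F0 (ltW T0) c0 (measurable_base_box i) seg.
rewrite lebesgue_base_box.
have -> : (\int[mu]_x F x = \int[mu]_(x in P) (f x)%:E)%E.
  by rewrite [RHS]integral_mkcond.
rewrite -lee_pdivrMl// invrK => H; apply: le_trans H.
rewrite -!EFinM lee_fin /average_const.
move: ((_ *+ 2) ^+ n) segment_const (Num.min _ _) => w s p.
by rewrite le_eqVlt; apply/orP; left; apply/eqP; ring.
Qed.

(** The case of the exponent 2 suffices: sin^2 being at most rho := min (1, r^2),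
    its mean over the ball is comparable with rho only if sin^2 is comparable
    with rho on a set of positive measure. *)
Lemma integral_sin_power_ball_ge m : 0 < m ->
  exists2 c : R, 0 < c & forall (e : V) (r : R), dotv e e = 1 -> 0 < r ->
  ((c * Num.min 1 (r `^ (2 * m)))%:E <=
   \int[mu]_(x in P) (`|2 * sin (r * dotv (normalize x) e / 2)| `^ (2 * m))%:E)%E.
Proof.
move=> m0.
have Plty : (mu P < +oo)%E.
  apply: le_lt_trans (lebesgue_box_lty n 1); apply: le_measure; rewrite ?inE.
  - exact: measurable_punctured_ball.
  - exact: measurable_box.
  - exact: punctured_ball_subset_box.
pose v := fine (mu P).
have vE : mu P = v%:E by rewrite fineK// ge0_fin_numE.
have v0 : 0 <= v by rewrite fine_ge0.
pose a := average_const; have a0 : 0 < a := average_const_gt0.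
(* The points with sin^2 < d rho contribute at most d v rho <= a rho / 2 to
   the integral of sin^2, which is at least a rho. *)
pose d := a / (2 * (v + 1)).
have d0 : 0 < d by rewrite divr_gt0// mulr_gt0// ltr_wpDl.
exists ((4 * d) `^ m * (a / 2)).
  by apply: mulr_gt0; [rewrite powR_gt0// mulr_gt0|rewrite divr_gt0].
move=> e r e1 r0; pose rho := Num.min 1 (r ^+ 2).
have rho0 : 0 < rho by rewrite lt_min ltr01 exprn_gt0.
have -> : Num.min 1 (r `^ (2 * m)) = rho `^ m.
  rewrite powRrM powR_mulrn ?(ltW r0)// /rho.
  have p1 : (1 : R) `^ m = 1 by rewrite powR1.
  have r2 : 0 <= r ^+ 2 := sqr_ge0 r.
  have [h|h] := leP 1 (r ^+ 2).
    rewrite p1 min_l//; have := ge0_ler_powR (ltW m0) (ler01 : 1 \in Num.nneg) r2 h.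
    by rewrite p1.
  rewrite min_r//; have := ge0_ler_powR (ltW m0) r2 (ler01 : 1 \in Num.nneg) (ltW h).
  by rewrite p1.
pose q x := sin (r * dotv (normalize x) e / 2) ^+ 2.
have qle x : P x -> q x <= rho.
  move=> /andP[x0 _]; rewrite le_min /q -real_normK ?num_real//; apply/andP; split.
    by rewrite exprn_ile1// ler_norml sin_geN1 sin_le1.
  rewrite ler_pXn2r ?nnegrE ?(ltW r0)// (le_trans (normr_sin_le _))//.
  rewrite -mulrA normrM (ger0_norm (ltW r0)) ler_piMr ?(ltW r0)//.
  rewrite normrM (ger0_norm (_ : 0 <= 2^-1)) ?invr_ge0//.
  apply: (@le_trans _ _ (1 * 2^-1)); last by rewrite mul1r invf_le1// ler1n.
  rewrite ler_wpM2r ?invr_ge0// (le_trans (normr_dotv_le _ _))//.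
  by rewrite enorm_normalize// /enorm e1 sqrtr1 mulr1.
have q0 x : 0 <= q x by exact: sqr_ge0.
have powE x : `|2 * sin (r * dotv (normalize x) e / 2)| `^ (2 * m) = (4 * q x) `^ m.
  rewrite powRrM powR_mulrn// real_normK ?num_real// exprMn.
  by rewrite (_ : 2 ^+ 2 = 4)// -natrX.
under eq_integral do rewrite powE.
pose K := (4 * d * rho) `^ m.
have K0 : 0 <= K by exact: powR_ge0.
have mq : measurable_fun setT q.
  by apply: measurable_funX; exact: measurable_sin_normalize.
have mqm : measurable_fun setT (fun x => (4 * q x) `^ m).
  apply: (measurableT_comp (measurable_powR m)).
  by apply: measurable_funM => //; exact: measurable_cst.
have pt x : P x -> K * rho^-1 * q x <= (4 * q x) `^ m + K * d.
  move=> /qle qr; have [h|h] := leP (d * rho) (q x).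
    apply: (@le_trans _ _ K); first by rewrite -mulrA ler_piMr// ler_pdivrMl// mulr1.
    apply: (@le_trans _ _ ((4 * q x) `^ m)); last by rewrite lerDl mulr_ge0// ltW.
    have d4 : 0 <= 4 * d * rho := mulr_ge0 (mulr_ge0 (ler0n _ 4) (ltW d0)) (ltW rho0).
    have q4 : 0 <= 4 * q x := mulr_ge0 (ler0n _ 4) (q0 x).
    apply: (ge0_ler_powR (ltW m0) d4 q4).
    by rewrite -mulrA ler_pM2l.
  apply: (@le_trans _ _ (K * d)); last by rewrite lerDr powR_ge0.
  by rewrite -mulrA ler_wpM2l// ler_pdivrMl// mulrC ltW.
have lower := integral_sin_sqr_ball_ge e1 r0.
have Kr0 : 0 <= K * rho^-1 by apply: mulr_ge0 => //; rewrite invr_ge0 ltW.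
have Kd0 : 0 <= K * d := mulr_ge0 K0 (ltW d0).
have h : ((K * rho^-1)%:E * \int[mu]_(x in P) (q x)%:E <=
    \int[mu]_(x in P) ((4 * q x) `^ m)%:E + (K * d * v)%:E)%E.
  have mP := @measurable_punctured_ball R n.
  have -> : ((K * d * v)%:E = \int[mu]_(x in P) (K * d)%:E)%E.
    by rewrite integral_cst// EFinM -vE.
  rewrite -ge0_integralZl//.
  - rewrite -ge0_integralD//.
    + apply: ge0_le_integral => //.
      * by move=> x _; rewrite -EFinM lee_fin; exact: mulr_ge0 Kr0 (q0 x).
      * by apply/measurable_EFinP; apply: measurable_funTS; apply: measurable_funM => //; exact: measurable_cst.
      * apply: emeasurable_funD; last exact: measurable_cst.
        by apply/measurable_EFinP; exact: measurable_funTS.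
    + by move=> x _; rewrite lee_fin powR_ge0.
    + by apply/measurable_EFinP; exact: measurable_funTS.
  - by apply/measurable_EFinP; exact: measurable_funTS.
  - by move=> x _; rewrite lee_fin; exact: q0.
have h2 : ((K * a)%:E <= (K * rho^-1)%:E * \int[mu]_(x in P) (q x)%:E)%E.
  apply: (@le_trans _ _ ((K * rho^-1)%:E * (a * rho)%:E)%E).
    by rewrite -EFinM lee_fin (_ : K * rho^-1 * (a * rho) = K * a)//; field; rewrite gt_eqF.
  by rewrite lee_wpmul2l// lee_fin.
have h3 := le_trans h2 h.
rewrite -leeBlDr// -EFinB in h3; apply: le_trans h3; rewrite lee_fin.
have dv : d * v <= a / 2.
  have v1 : 0 < v + 1 by rewrite ltr_wpDl.
  have -> : d * v = a / 2 * (v / (v + 1)) by rewrite /d; field; rewrite gt_eqF.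
  rewrite ler_piMr ?ler_pdivrMr ?mul1r ?lerDl//.
  by apply: divr_ge0 => //; exact: ltW a0.
have KE : K = (4 * d) `^ m * rho `^ m.
  exact: (powRM _ (mulr_ge0 (ler0n _ 4) (ltW d0)) (ltW rho0)).
have : K * (d * v) <= K * (a / 2) by rewrite ler_wpM2l.
rewrite (mulrAC _ (a / 2)) -KE; lra.
Qed.

Lemma measurable_dilated_multiplier (xi : V) (h p : R) :
  measurable_fun setT (fun y : V => `|2 * sin (dotv (h *: y) xi / 2)| `^ p).
Proof.
apply: (measurableT_comp (measurable_powR _)).
apply: (measurableT_comp (@normr_measurable _ _)).
apply: measurable_funM; first exact: measurable_cst.
apply: (measurableT_comp (continuous_measurable_fun (@continuous_sin R))).
apply: measurable_funM; last exact: measurable_cst.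
under eq_fun do rewrite dotvZl.
by apply: measurable_funM; [exact: measurable_cst|exact: measurable_dotvr].
Qed.

(** The frequency xi enters through its norm and its direction only. *)
Lemma sphere_multiplier_ge m : 0 < m ->
  exists2 c : R, 0 < c & forall (xi : V) (h : R), 0 < h ->
  ((c * Num.min 1 ((enorm xi * h) `^ (2 * m)))%:E <=
   \int[sphere_measure n]_(y in S)
     (`|2 * sin (dotv (h *: y) xi / 2)| `^ (2 * m))%:E)%E.
Proof.
move=> m0; have [c c0 hc] := integral_sin_power_ball_ge m0.
exists c => // xi h h0; rewrite ge0_integral_sphere; last 2 first.
- by apply/measurable_EFinP; exact: measurable_dilated_multiplier.
- by move=> y; rewrite lee_fin powR_ge0.
have n1 : (1 <= n%:R%:E :> \bar R)%E by rewrite lee_fin ler1n ltnW.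
have [->|xi0] := eqVneq xi 0.
  have -> : enorm (0 : V) = 0 by apply/eqP; rewrite enorm_eq0.
  rewrite mul0r powR0 ?mulf_neq0 ?gt_eqF// min_r// mulr0.
  apply: mule_ge0; first exact: le_trans lee01 n1.
  by apply: integral_ge0 => x _; rewrite lee_fin powR_ge0.
have N0 : 0 < enorm xi by rewrite lt_neqAle eq_sym enorm_eq0 xi0 enorm_ge0.
have e1 : dotv (normalize xi) (normalize xi) = 1.
  by rewrite -enorm_sqr enorm_normalize// expr1n.
apply: (le_trans (hc _ (enorm xi * h) e1 _)); first by rewrite mulr_gt0.
rewrite -[leLHS]mul1e; apply: lee_pmul.
- exact: lee01.
- by apply: integral_ge0 => x _; rewrite lee_fin powR_ge0.
- exact: n1.
rewrite le_eqVlt; apply/orP; left; apply/eqP; apply: eq_integral => x _.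
rewrite dotvZl {2}/normalize dotvZr (mulrC (enorm xi) h) -!mulrA.
by rewrite (mulrA (enorm xi)) mulfV ?mul1r// gt_eqF.
Qed.

End sphere_multiplier.

(** * Comparison of the moduli of continuity with the tail of the transform *)

Section comparison.
Context {R : realType} (n : nat).
Local Notation V := 'rV[R]_n.
Local Notation mu := (lebesgue_rV n : {measure set V -> \bar R}).
Local Notation S := (@sphere R n).
Local Notation P := (@punctured_ball R n).
Implicit Types (f : V -> R[i]) (m h t : R).

(** The radial extension of K turns integrals over the sphere into integrals
    over the ball with respect to the Lebesgue measure, to which the theorem
    of Tonelli applies. *)
Definition cone_extension (K : V * V -> \bar R) (p : V * V) : \bar R :=
  (K (normalize p.1, p.2) * (\1_P p.1)%:E)%E.

Section cone_extension.
Variable K : V * V -> \bar R.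
Hypotheses (mK : measurable_fun setT K) (K0 : forall p, (0 <= K p)%E).
Let mP := @measurable_punctured_ball R n.

Lemma cone_extension_ge0 p : (0 <= cone_extension K p)%E.
Proof. by rewrite /cone_extension mule_ge0// lee_fin indicE ler0n. Qed.

Lemma measurable_cone_extension : measurable_fun setT (cone_extension K).
Proof.
apply: emeasurable_funM.
  apply: (measurableT_comp mK); apply: measurable_fun_pair.
    exact: (measurableT_comp (@measurable_normalize R n) measurable_fst).
  exact: measurable_snd.
by apply/measurable_EFinP; exact: (measurableT_comp (measurable_indic mP) measurable_fst).
Qed.

Lemma sphere_integral_param (xi : V) :
  (\int[sphere_measure n]_(y in S) K (y, xi) =
   n%:R%:E * \int[mu]_x cone_extension K (x, xi))%E.
Proof.
rewrite ge0_integral_sphere//; last exact: (measurableT_comp mK (measurable_pair2 xi)).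
congr (_ * _)%E; rewrite [LHS]integral_mkcond; apply: eq_integral => x _.
by rewrite /cone_extension/= epatch_indic.
Qed.

Lemma measurable_sphere_integral :
  measurable_fun setT (fun xi : V => \int[sphere_measure n]_(y in S) K (y, xi))%E.
Proof.
under eq_fun do rewrite sphere_integral_param.
apply: emeasurable_funM; first exact: measurable_cst.
apply: (measurable_fun_fubini_tonelli_G (cone_extension K)).
- exact: measurable_cone_extension.
- exact: cone_extension_ge0.
Qed.

Lemma sphere_tonelli :
  (\int[mu]_xi \int[sphere_measure n]_(y in S) K (y, xi) =
   \int[sphere_measure n]_(y in S) \int[mu]_xi K (y, xi))%E.
Proof.
have mL := measurable_cone_extension; have L0 := cone_extension_ge0.
rewrite ge0_integral_sphere; last 2 first.
- exact: (measurable_fun_fubini_tonelli_F K).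
- by move=> y; apply: integral_ge0 => xi _.
have -> : (\int[mu]_(x in P) \int[mu]_xi K (normalize x, xi) =
    \int[mu]_x \int[mu]_xi cone_extension K (x, xi))%E.
  rewrite [LHS]integral_mkcond; apply: eq_integral => x _.
  rewrite /cone_extension/= epatch_indic/= ge0_integralZr//.
  exact: (measurableT_comp mK (measurable_pair1 (normalize x))).
pose I (xi : V) := (\int[mu]_x cone_extension K (x, xi))%E.
have mI : measurable_fun setT I.
  exact: (measurable_fun_fubini_tonelli_G (cone_extension K)).
have I0 xi : (0 <= I xi)%E by apply: integral_ge0 => x _; exact: L0.
have -> : (\int[mu]_xi \int[sphere_measure n]_(y in S) K (y, xi) =
    \int[mu]_xi (n%:R%:E * I xi))%E.
  by apply: eq_integral => xi _; exact: sphere_integral_param.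
have n0 : (0 <= n%:R%:E :> \bar R)%E by rewrite lee_fin ler0n.
rewrite (ge0_integralZl mu measurableT mI (fun xi _ => I0 xi) n0).
apply: (congr1 (fun z => (n%:R%:E * z)%E)).
exact: (esym (@fubini_tonelli _ _ _ _ R (lebesgue_rV n) (lebesgue_rV n) _ mL L0)).
Qed.

End cone_extension.

Definition multiplier m (y xi : V) : R := `|2 * sin (dotv y xi / 2)| `^ (2 * m).

Definition diff_density m f (p : V * V) : \bar R :=
  (multiplier m p.1 p.2 * normc (fourier f p.2) ^+ 2)%:E.

Lemma diff_density_ge0 m f p : (0 <= diff_density m f p)%E.
Proof. by rewrite lee_fin mulr_ge0 ?powR_ge0 ?sqr_ge0. Qed.

Lemma measurable_fourier_sqr f : in_L2 f ->
  measurable_fun setT (fun xi : V => normc (fourier f xi) ^+ 2).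
Proof.
move=> /fourierP[_ /in_L2P[mg _] _]; by apply: measurable_funX; exact: measurable_normc.
Qed.

Lemma measurable_diff_density m f : in_L2 f -> measurable_fun setT (diff_density m f).
Proof.
move=> fL2; apply/measurable_EFinP; apply: measurable_funM.
  apply: (measurableT_comp (measurable_powR _)).
  apply: (measurableT_comp (@normr_measurable _ _)).
  apply: measurable_funM; first exact: measurable_cst.
  apply: (measurableT_comp (continuous_measurable_fun (@continuous_sin R))).
  by apply: measurable_funM; [exact: measurable_dotv|exact: measurable_cst].
exact: (measurableT_comp (measurable_fourier_sqr fL2) measurable_snd).
Qed.

Definition dual_const : R := ((2 * pi) ^+ n)^-1.

Lemma dual_const_gt0 : 0 < dual_const.
Proof. by rewrite invr_gt0 exprn_gt0// mulr_gt0// pi_gt0. Qed.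

Lemma L2norm_diff_sqr m y f : 0 < m -> in_L2 f ->
  (L2norm (Defs.diff m y f) `^ 2 =
   dual_const%:E * \int[mu]_xi diff_density m f (y, xi))%E.
Proof. by move=> m0 fL2; rewrite L2normE norm2_sqr diff_energy. Qed.

Lemma measurable_L2norm_diff_sqr m f h : 0 < m -> in_L2 f ->
  measurable_fun setT (fun y : V => (L2norm (Defs.diff m (h *: y) f) `^ 2)%E).
Proof.
move=> m0 fL2; under eq_fun do rewrite L2norm_diff_sqr//.
apply: emeasurable_funM; first exact: measurable_cst.
have mF := @measurable_fun_fubini_tonelli_F _ _ _ _ R (lebesgue_rV n) _
  (measurable_diff_density m fL2) (@diff_density_ge0 m f).
apply: (measurableT_comp mF); apply: measurable_fun_rVP => i.
under eq_fun do rewrite mxE.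
by apply: measurable_funM; [exact: measurable_cst|exact: measurable_coord].
Qed.

Lemma poweR_sqrK (x : \bar R) : (0 <= x)%E -> ((x `^ 2) `^ 2^-1)%E = x.
Proof. by move=> x0; rewrite -poweRrM mulfV// poweRe1. Qed.

Lemma omegaoo_ge m f h y : enorm y <= h -> (L2norm (Defs.diff m y f) <= omegaoo m f h)%E.
Proof. by move=> yh; apply: ereal_sup_ubound; exists y. Qed.

Lemma omegaoo_ge0 m f h : 0 < h -> (0 <= omegaoo m f h)%E.
Proof.
move=> h0; apply: (@le_trans _ _ (L2norm (Defs.diff m 0 f))).
  by rewrite L2normE norm2_ge0.
apply: omegaoo_ge; rewrite (_ : enorm 0 = 0) ?ltW//.
by apply/eqP; rewrite enorm_eq0.
Qed.

(** The square of the left-hand side is the integral over the sphere of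
    quantities bounded by the square of the supremum. *)
Lemma omega2_le_omegaoo m f h : 0 < m -> in_L2 f -> 0 < h ->
  (omega2 m f h <=
   (fine (sphere_measure n S) `^ 2^-1)%:E * omegaoo m f h)%E.
Proof.
move=> m0 fL2 h0; have w0 := omegaoo_ge0 m f h0.
have sE : (sphere_measure n S = (fine (sphere_measure n S))%:E)%E.
  by rewrite fineK// ge0_fin_numE// sphere_measure_lty.
rewrite -[leRHS]poweR_sqrK; last by rewrite mule_ge0// lee_fin powR_ge0.
apply: le_poweR; rewrite ?invr_ge0//.
  by apply: integral_ge0 => y _; exact: poweR_ge0.
rewrite poweRM//; last by rewrite lee_fin powR_ge0.
rewrite -poweR_EFin -poweRrM mulVf// poweRe1 ?lee_fin ?fine_ge0// -sE.
rewrite muleC -integral_cst; last exact: measurable_sphere.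
apply: ge0_le_integral => //.
- exact: measurable_sphere.
- by move=> y _; exact: poweR_ge0.
- by apply: measurable_funTS; exact: measurable_L2norm_diff_sqr.
- move=> y yS; apply: le_poweR => //; first by rewrite L2normE norm2_ge0.
  by apply: omegaoo_ge; rewrite enormZ yS mulr1 gtr0_norm.
Qed.

(** |sin u| <= min (1, |u|), and |y.xi| <= |y| |xi|. *)
Lemma multiplier_le m (y xi : V) t : 0 < m -> 0 < t -> enorm y <= t^-1 ->
  multiplier m y xi <= 2 `^ (2 * m) * Num.min 1 ((enorm xi / t) `^ (2 * m)).
Proof.
move=> m0 t0 yt; have m2 : 0 <= 2 * m by rewrite mulr_ge0// ltW.
have p1 : (1 : R) `^ (2 * m) = 1 by rewrite powR1.
rewrite /multiplier minr_pMr ?powR_ge0// mulr1 le_min; apply/andP; split.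
  by apply: ge0_ler_powR => //; rewrite ?nnegrE// normr_2sin_le2.
have u0 : 0 <= enorm xi / t by rewrite divr_ge0 ?enorm_ge0// ltW.
rewrite -powRM//; apply: ge0_ler_powR; rewrite ?nnegrE//; first exact: mulr_ge0.
rewrite normrM (ger0_norm (ler0n _ 2)) ler_pM2l//.
apply: (le_trans (normr_sin_le _)); rewrite normrM (ger0_norm (_ : 0 <= 2^-1)) ?invr_ge0//.
apply: (@le_trans _ _ `|dotv y xi|); first by rewrite ler_piMr// invf_le1// ler1n.
by rewrite (le_trans (normr_dotv_le _ _))// mulrC ler_wpM2l// enorm_ge0.
Qed.

Local Notation tail m f t := (\int[mu]_xi (Num.min 1 ((enorm xi / t) `^ (2 * m))
                 * normc (fourier f xi) ^+ 2)%:E)%E.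

Lemma measurable_tail m f t : in_L2 f -> measurable_fun setT (fun xi : V =>
  Num.min 1 ((enorm xi / t) `^ (2 * m)) * normc (fourier f xi) ^+ 2).
Proof.
move=> fL2; apply: measurable_funM; last exact: measurable_fourier_sqr.
apply: measurable_minr; first exact: measurable_cst.
apply: (measurableT_comp (measurable_powR _)).
by apply: measurable_funM; [exact: measurable_enorm|exact: measurable_cst].
Qed.

Lemma tail_weight_ge0 m (xi : V) t : 0 <= Num.min 1 ((enorm xi / t) `^ (2 * m)).
Proof. by rewrite le_min ler01 powR_ge0. Qed.

Lemma tail_integrand_ge0 m f t (xi : V) : (0 <= (Num.min 1 ((enorm xi / t) `^ (2 * m))
                 * normc (fourier f xi) ^+ 2)%:E)%E.
Proof. by rewrite lee_fin mulr_ge0 ?tail_weight_ge0 ?sqr_ge0. Qed.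

Definition upper_const m : R := (dual_const * 2 `^ (2 * m)) `^ 2^-1.

Lemma upper_const_gt0 m : 0 < upper_const m.
Proof. by rewrite powR_gt0// mulr_gt0 ?dual_const_gt0// powR_gt0. Qed.

(** The multiplier is dominated by the weight of the tail for all small y at
    once. *)
Lemma omegaoo_le_psi m f t : 0 < m -> in_L2 f -> 0 < t ->
  (omegaoo m f t^-1 <= (upper_const m)%:E * psi m (fourier f) t)%E.
Proof.
move=> m0 fL2 t0; apply: ge_ereal_sup => _ [y /= yt <-].
have A0 : 0 <= dual_const * 2 `^ (2 * m).
  by rewrite mulr_ge0 ?powR_ge0// ltW// dual_const_gt0.
have I0 : (0 <= tail m f t)%E by apply: integral_ge0 => xi _; exact: tail_integrand_ge0.
rewrite -[leLHS]poweR_sqrK; last by rewrite L2normE norm2_ge0.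
rewrite /upper_const /psi -poweR_EFin -poweRM//.
apply: le_poweR; rewrite ?invr_ge0// ?poweR_ge0// L2norm_diff_sqr// EFinM -muleA.
rewrite lee_wpmul2l ?lee_fin ?(ltW dual_const_gt0)// -ge0_integralZl//; last 2 first.
- by apply/measurable_EFinP; exact: measurable_tail.
- by move=> xi _; exact: tail_integrand_ge0.
apply: ge0_le_integral => //.
- by move=> xi _; exact: diff_density_ge0.
- exact: (measurableT_comp (measurable_diff_density m fL2) (measurable_pair1 y)).
- by apply: emeasurable_funM; [exact: measurable_cst|apply/measurable_EFinP; exact: measurable_tail].
- by move=> xi _; rewrite -EFinM lee_fin [leRHS]mulrA; apply: ler_wpM2r (sqr_ge0 _) _ _ (multiplier_le xi m0 t0 yt).
Qed.

(** The weight of the tail is dominated by the average of the multiplier over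
    the sphere; exchanging the integrals gives the average over the sphere of
    the squared norms of the differences. *)
Lemma psi_le_omega2 m : (2 <= n)%N -> 0 < m ->
  exists2 c : R, 0 < c & forall f t, in_L2 f -> 0 < t ->
  (psi m (fourier f) t <= c%:E * omega2 m f t^-1)%E.
Proof.
move=> n2 m0; have [a a0 ha] := sphere_multiplier_ge n2 m0.
have D0 := dual_const_gt0.
exists ((a * dual_const)^-1 `^ 2^-1); first by rewrite powR_gt0// invr_gt0 mulr_gt0.
move=> f t fL2 t0; have ti0 : 0 < t^-1 by rewrite invr_gt0.
have I0 : (0 <= tail m f t)%E by apply: integral_ge0 => xi _; exact: tail_integrand_ge0.
pose K (p : V * V) := diff_density m f (t^-1 *: p.1, p.2).
have K0 p : (0 <= K p)%E by exact: diff_density_ge0.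
have mK : measurable_fun setT K.
  apply: (measurableT_comp (measurable_diff_density m fL2)).
  apply: measurable_fun_pair; last exact: measurable_snd.
  apply: measurable_fun_rVP => i; under eq_fun do rewrite mxE.
  apply: measurable_funM; first exact: measurable_cst.
  exact: (measurableT_comp (measurable_coord i) measurable_fst).
have mE : measurable_fun setT (fun y : V => \int[mu]_xi diff_density m f (t^-1 *: y, xi))%E.
  exact: (measurable_fun_fubini_tonelli_F K mK).
have lower : (a%:E * tail m f t <=
    \int[sphere_measure n]_(y in S) \int[mu]_xi diff_density m f (t^-1 *: y, xi))%E.
  rewrite -(sphere_tonelli mK K0).
  rewrite -ge0_integralZl//; last 3 first.
  - by apply/measurable_EFinP; exact: measurable_tail.
  - by move=> xi _; exact: tail_integrand_ge0.
  - by rewrite lee_fin ltW.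
  apply: ge0_le_integral => //.
  - by move=> xi _; rewrite mule_ge0 ?tail_integrand_ge0// lee_fin ltW.
  - by apply: emeasurable_funM; [exact: measurable_cst|apply/measurable_EFinP; exact: measurable_tail].
  - exact: (measurable_sphere_integral mK K0).
  - move=> xi _; rewrite /K /diff_density/=; under eq_integral do rewrite EFinM.
    rewrite ge0_integralZr//; last 4 first.
    + exact: measurable_sphere.
    + apply/measurable_EFinP; apply: measurable_funTS.
      exact: measurable_dilated_multiplier.
    + by move=> y _; rewrite lee_fin powR_ge0.
    + by rewrite lee_fin sqr_ge0.
    rewrite EFinM muleA lee_wpmul2r ?lee_fin ?sqr_ge0// -EFinM.
    exact: ha.
have omega2E : (omega2 m f t^-1 = (dual_const%:E *
    \int[sphere_measure n]_(y in S) \int[mu]_xi diff_density m f (t^-1 *: y, xi)) `^ 2^-1)%E.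
  rewrite /omega2; congr (_ `^ _)%E; under eq_integral do rewrite L2norm_diff_sqr//.
  rewrite ge0_integralZl//.
  - exact: measurable_sphere.
  - exact: measurable_funTS.
  - by move=> y _; apply: integral_ge0 => z _; exact: diff_density_ge0.
  - by rewrite lee_fin ltW.
rewrite omega2E -poweR_EFin -poweRM; last 2 first.
- by rewrite lee_fin invr_ge0 mulr_ge0 ?ltW.
- rewrite mule_ge0 ?lee_fin ?(ltW D0)//; apply: integral_ge0 => y _.
  by apply: integral_ge0 => xi _; exact: diff_density_ge0.
apply: le_poweR; rewrite ?invr_ge0// muleA -EFinM invfM -mulrA mulVf ?gt_eqF// mulr1.
by rewrite lee_pdivlMl.
Qed.

End comparison.

Theorem corollary1p2 (R : realType) (d : nat) (hd : (2 <= d)%N) :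
  (exists c0 : R, forall (m : R) (f : 'rV[R]_d -> R[i]) (h : R),
     0 < m -> in_L2 f -> 0 < h ->
     (omega2 m f h <= c0%:E * omegaoo m f h)%E) /\
  (forall m : R, 0 < m ->
   exists c1 c2 : R, [/\ 0 < c1, 0 < c2 &
   forall c0 : R,
     (forall (f : 'rV[R]_d -> R[i]) (h : R), in_L2 f -> 0 < h ->
        (omega2 m f h <= c0%:E * omegaoo m f h)%E) ->
     forall (f : 'rV[R]_d -> R[i]) (t : R), in_L2 f -> 0 < t ->
       [/\ (c1%:E * omegaoo m f t^-1 <= psi m (fourier f) t)%E,
           (psi m (fourier f) t <= c2%:E * omega2 m f t^-1)%E &
           (c2%:E * omega2 m f t^-1 <= (c2 * c0)%:E * omegaoo m f t^-1)%E]]).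
Proof.
split.
  exists (fine (sphere_measure d (@sphere R d)) `^ 2^-1) => m f h.
  exact: omega2_le_omegaoo.
move=> m m0; have [c2 c20 psi_le] := psi_le_omega2 (R := R) hd m0.
exists (upper_const d m)^-1, c2; split => //.
  by rewrite invr_gt0 upper_const_gt0.
move=> c0 omega_le f t fL2 t0; split.
- rewrite lee_pdivrMl ?upper_const_gt0//; exact: omegaoo_le_psi.
- exact: psi_le.
- rewrite EFinM -muleA; apply: lee_wpmul2l; first by rewrite lee_fin ltW.
  by apply: omega_le => //; rewrite invr_gt0.
Qed.
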